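(* If $N<10$, then there is no stable weak solution of $-Qu=e^{u}$ in $\mathbb{R}^{N}$.
   Context: Let $F:\mathbb{R}^{N}\to[0,+\infty)$ be a convex function, $F\in C^{2}(\mathbb{R}^{N}\setminus\{0\})$, with $F(t\xi)=|t|F(\xi)$ for all $t\in\mathbb{R}$, $\xi\in\mathbb{R}^{N}$, and $F(\xi)>0$ for $\xi\neq0$. Assume there are constants $0<a\le b<\infty$ and $0<\lambda\le\Lambda<\infty$ such that $a|\xi|\le F(\xi)\le b|\xi|$ for all $\xi\in\mathbb{R}^N$, and $\lambda^{2}|V|^{2}\le \sum_{i,j}F_{\xi_i\xi_j}(\xi)V_iV_j\le\Lambda|V|^{2}$ for all $\xi$ with $|\xi|=1$ and all $V\in\mathbb{R}^N$ with $\langle V,\xi\rangle=0$. Here $F_{\xi_i}=\partial F/\partial\xi_i$, $F_\xi=\nabla F$, and $F_{\xi_i\xi_j}$ are the second partial derivatives. The Finsler-Laplacian is $Qu:=\sum_{i=1}^{N}\frac{\partial}{\partial x_i}\big(F(\nabla u)F_{\xi_i}(\nabla u)\big)$. Weak solution of $-Qu=f(u)$ in $\Omega$: $u\in H^{1}_{loc}(\Omega)$, $f(u)\in L^{1}_{loc}(\Omega)$ and $\int_\Omega F(\nabla u)F_\xi(\nabla u)\cdot\nabla\phi\,dx=\int_\Omega f(u)\phi\,dx$ for all $\phi\in C_c^\infty(\Omega)$. A weak solution is stable if $f'(u)\in L^1_{loc}(\Omega)$ and, for all $\phi\in C_c^1(\Omega)$ (sum over repeated indices), $$\int_\Omega F_{\xi_i}(\nabla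 u)F_{\xi_j}(\nabla u)\phi_{x_i}\phi_{x_j}+F(\nabla u)F_{\xi_i\xi_j}(\nabla u)\phi_{x_i}\phi_{x_j}-f'(u)\phi^2\,dx\ge0.$$ Here $f(u)=e^u$ and $\Omega=\mathbb{R}^N$. *)

(* Defs.v *)
From HB Require Import structures.
From mathcomp Require Import all_boot all_order all_algebra.
From mathcomp Require Import all_classical all_reals all_analysis.
Import Order.TTheory GRing.Theory Num.Theory.
Import numFieldNormedType.Exports.

Set Implicit Arguments.
Unset Strict Implicit.
Unset Printing Implicit Defensive.

Local Open Scope classical_set_scope.
Local Open Scope ring_scope.

Definition rV_display : measure_display -> measure_display.
Proof. exact. Qed.

(* 'rV[T]_n carries the product sigma-algebra; for T = R this is the Borel
   sigma-algebra of R^n. *)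
Section measurable_rV.
Context {d} {T : measurableType d} (n : nat).

Let coords : 'I_n -> 'rV[T]_n -> T := fun i x => x ord0 i.

Let rV_set0 : g_sigma_preimage coords set0.
Proof. exact: sigma_algebra0. Qed.

Let rV_setC A : g_sigma_preimage coords A -> g_sigma_preimage coords (~` A).
Proof. exact: sigma_algebraC. Qed.

Let rV_bigcup (A : (set 'rV[T]_n)^nat) :
  (forall i, g_sigma_preimage coords (A i)) ->
  g_sigma_preimage coords (\bigcup_i A i).
Proof. exact: sigma_algebra_bigcup. Qed.

HB.instance Definition _ := @isMeasurable.Build (rV_display d)
  'rV[T]_n (g_sigma_preimage coords) rV_set0 rV_setC rV_bigcup.

End measurable_rV.

Lemma measurable_coord d (T : measurableType d) n (i : 'I_n) :
  measurable_fun [set: 'rV[T]_n] (fun x : 'rV[T]_n => x ord0 i).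
Proof.
move=> _ Y mY; rewrite setTI; apply: sub_sigma_algebra => /=.
rewrite -bigcup_seq/=; exists i => /=; first by rewrite mem_index_enum.
by exists Y => //; rewrite setTI.
Qed.

Lemma measurable_fun_rV d1 d2 (T1 : measurableType d1) (T2 : measurableType d2)
    n (f : T1 -> 'rV[T2]_n) :
  (forall i, measurable_fun [set: T1] (fun x => f x ord0 i)) ->
  measurable_fun [set: T1] f.
Proof.
move=> mf.
pose G := \big[setU/set0]_(i < n) preimage_set_system setT
  (fun x : 'rV[T2]_n => x ord0 i) measurable.
apply: (@measurability _ _ _ _ setT f G) => // _ [B + <-].
rewrite /G -bigcup_seq => -[i _ [C mC <-]].
by have := mf i measurableT C mC; rewrite !setTI.
Qed.

Section lebesgue_rV.
Context {R : realType}.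

Definition rV_cons n (p : measurableTypeR R * 'rV[R]_n) : 'rV[R]_n.+1 :=
  row_mx (const_mx p.1 : 'rV_1) p.2.

Lemma measurable_rV_cons n : measurable_fun setT (@rV_cons n).
Proof.
apply: measurable_fun_rV => i.
case: (splitP (i : 'I_(1 + n))) => [j|k] ij.
  rewrite (_ : (fun _ => _) = (fst : _ -> measurableTypeR R)).
    exact: measurable_fst.
  apply/funext => p.
  have -> : i = lshift n j by exact/val_inj.
  by rewrite [LHS]row_mxEl mxE.
rewrite (_ : (fun _ => _) = (fun x : 'rV[R]_n => x ord0 k) \o snd).
  by apply: measurableT_comp; [exact: measurable_coord|].
apply/funext => p /=.
have -> : i = rshift 1 k by exact/val_inj.
by rewrite [LHS]row_mxEr.
Qed.

Definition rV_uncons n (x : 'rV[R]_n.+1) : measurableTypeR R * 'rV[R]_n :=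
  (x ord0 ord0, @rsubmx _ 1 1 n x).

Lemma rV_consK n : cancel (@rV_cons n) (@rV_uncons n).
Proof.
move=> [t x]; rewrite /rV_uncons /rV_cons row_mxKr; congr pair.
have -> : ord0 = lshift n (ord0 : 'I_1) by exact/val_inj.
by rewrite [LHS]row_mxEl mxE.
Qed.

Lemma measurable_rV_uncons n : measurable_fun setT (@rV_uncons n).
Proof.
apply/measurable_fun_pairP; split.
  exact: (measurable_coord (ord0 : 'I_n.+1)).
apply: measurable_fun_rV => i.
rewrite (_ : (fun _ => _) = (fun x : 'rV[R]_n.+1 => x ord0 (rshift 1 i))).
  exact: (measurable_coord (rshift 1 i)).
by apply/funext => x /=; rewrite mxE.
Qed.

Section step.
Variables (n : nat) (m : {sigma_finite_measure set 'rV[R]_n -> \bar R}).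
Local Open Scope ereal_scope.

Definition lebesgue_rV_step : set 'rV[R]_n.+1 -> \bar R :=
  pushforward (lebesgue_measure \x m) (@rV_cons n).

Let preimage_rV_cons A :
  measurable A -> measurable (@rV_cons n @^-1` A).
Proof.
by move=> mA; rewrite -[X in measurable X]setTI; exact: measurable_rV_cons.
Qed.

Let step0 : lebesgue_rV_step set0 = 0.
Proof. by rewrite /lebesgue_rV_step /pushforward preimage_set0 measure0. Qed.

Let step_ge0 A : 0 <= lebesgue_rV_step A.
Proof. exact: (@measure_ge0 _ _ _ (lebesgue_measure \x m)%E). Qed.

Let step_sigma_additive : semi_sigma_additive lebesgue_rV_step.
Proof.
move=> A mA tA mUA; rewrite /lebesgue_rV_step /pushforward preimage_bigcup.
apply: measure_semi_sigma_additive.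
- by move=> i; exact: preimage_rV_cons.
- apply/trivIsetP => i j _ _ ij; rewrite -preimage_setI.
  by move/trivIsetP : tA => /(_ _ _ _ _ ij) ->//; rewrite preimage_set0.
- by rewrite -preimage_bigcup; exact: preimage_rV_cons.
Qed.

HB.instance Definition _ := isMeasure.Build _ _ _ lebesgue_rV_step
  step0 step_ge0 step_sigma_additive.

Let step_sigma_finite : sigma_finite setT lebesgue_rV_step.
Proof.
have /sigma_finiteP[A [TA ndA Aoo]] :=
  sigma_finiteT (@lebesgue_measure R : {sigma_finite_measure set _ -> \bar R}).
have /sigma_finiteP[B [TB ndB Boo]] := sigma_finiteT m.
exists (fun i => @rV_uncons n @^-1` (A i `*` B i)).
  rewrite -preimage_bigcup (_ : \bigcup_i _ = setT) ?preimage_setT//.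
  apply/seteqP; split => // -[t x] _.
  have [i _ Ait] : (\bigcup_i A i) t by rewrite -TA.
  have [j _ Bjx] : (\bigcup_i B i) x by rewrite -TB.
  exists (maxn i j) => //; split => /=.
  - by move: Ait; exact/subsetPset/ndA/leq_maxl.
  - by move: Bjx; exact/subsetPset/ndB/leq_maxr.
move=> i; have [mA Ai] := Aoo i; have [mB Bi] := Boo i; split.
  rewrite -[X in measurable X]setTI; apply: measurable_rV_uncons => //.
  exact: measurableX.
rewrite /lebesgue_rV_step /pushforward -comp_preimage.
rewrite (_ : _ \o _ = id); last by apply/funext => p; exact: rV_consK.
by rewrite preimage_id product_measure1E// lte_mul_pinfty// ge0_fin_numE.
Qed.

HB.instance Definition _ := Measure_isSigmaFinite.Build _ _ _ lebesgue_rV_step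
  step_sigma_finite.

End step.

Fixpoint lebesgue_rV n : {sigma_finite_measure set 'rV[R]_n -> \bar R} :=
  match n with
  | 0 => \d_(0 : 'rV[R]_0)
  | n'.+1 => lebesgue_rV_step (lebesgue_rV n')
  end.

End lebesgue_rV.

Section calculus.
Context {R : realType} {N : nat}.
Local Notation V := 'rV[R]_N.
Implicit Types (f : V -> R) (x y : V) (D Omega : set V).

Definition dotp x y : R := \sum_(i < N) x ord0 i * y ord0 i.

(* The library norm `|x| on 'rV[R]_N is the sup norm. *)
Definition enorm x : R := Num.sqrt (dotp x x).

Definition partial (i : 'I_N) f : V -> R := fun x => 'D_(delta_mx ord0 i) f x.

Definition grad f x : V := \row_(i < N) partial i f x.

(* f is of class C^k on D, for D open. *)
Fixpoint classC (k : nat) D f : Prop :=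
  match k with
  | 0 => forall x, D x -> {for x, continuous f}
  | k'.+1 => (forall x, D x -> {for x, continuous f}) /\
      forall i : 'I_N,
        (forall x, D x -> derivable f x (delta_mx ord0 i)) /\
        classC k' D (partial i f)
  end.

(* f is supported in a compact subset of Omega. Functions on Omega vanishing
   off such a set are identified with their extension by 0 to R^N. *)
Definition compact_support Omega f : Prop :=
  compact (closure [set x | f x != 0]) /\
  closure [set x | f x != 0] `<=` Omega.

Definition classCc (k : nat) Omega f : Prop :=
  classC k setT f /\ compact_support Omega f.

Definition classCcoo Omega f : Prop :=
  (forall k, classC k setT f) /\ compact_support Omega f.

End calculus.

Section function_spaces.
Context {R : realType} {N : nat}.
Local Notation V := 'rV[R]_N.
Local Notation mu := (@lebesgue_rV R N).
Implicit Types (f u : V -> R) (Omega : set V).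

Definition L1loc Omega f : Prop :=
  measurable_fun Omega f /\
  forall K : set V, compact K -> K `<=` Omega ->
    mu.-integrable K (EFin \o f).

Definition L2loc Omega f : Prop :=
  measurable_fun Omega f /\
  forall K : set V, compact K -> K `<=` Omega ->
    mu.-integrable K (EFin \o (fun x => f x ^+ 2)).

Definition weak_gradient Omega u (Du : V -> V) : Prop :=
  forall (i : 'I_N) (phi : V -> R), classCcoo Omega phi ->
    \int[mu]_(x in Omega) (u x * partial i phi x) =
    - \int[mu]_(x in Omega) (Du x ord0 i * phi x).

(* u is in H^1_loc(Omega), with distributional gradient Du; the latter is
   unique up to a null set. *)
Definition H1loc Omega u (Du : V -> V) : Prop :=
  [/\ L2loc Omega u,
      forall i : 'I_N, L2loc Omega (fun x => Du x ord0 i) &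
      weak_gradient Omega u Du].

End function_spaces.

Section finsler.
Context {R : realType} {N : nat}.
Local Notation V := 'rV[R]_N.
Local Notation mu := (@lebesgue_rV R N).
Variables (F : V -> R) (f : R -> R) (Omega : set V).
Implicit Types (u : V -> R) (Du : V -> V).

Definition weak_solution u Du : Prop :=
  [/\ H1loc Omega u Du,
      L1loc Omega (fun x => f (u x)) &
      forall phi : V -> R, classCcoo Omega phi ->
        \int[mu]_(x in Omega) (F (Du x) * dotp (grad F (Du x)) (grad phi x)) =
        \int[mu]_(x in Omega) (f (u x) * phi x)].

(* F is not differentiable at 0. For F positively homogeneous, even and positive
   off 0, the total operator 'D gives partial i F 0 = 0, and F 0 = 0, so where
   Du x = 0 both double sums vanish. *)
Definition stability_integrand u Du (phi : V -> R) (x : V) : R :=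
  \sum_(i < N) \sum_(j < N)
    partial i F (Du x) * partial j F (Du x) * partial i phi x * partial j phi x
  + \sum_(i < N) \sum_(j < N)
    F (Du x) * partial j (partial i F) (Du x) * partial i phi x * partial j phi x
  - derive1 f (u x) * phi x ^+ 2.

Definition stable u Du : Prop :=
  L1loc Omega (fun x => derive1 f (u x)) /\
  forall phi : V -> R, classCc 1 Omega phi ->
    0 <= \int[mu]_(x in Omega) stability_integrand u Du phi x.

Definition stable_weak_solution u : Prop :=
  exists Du : V -> V, weak_solution u Du /\ stable u Du.

End finsler.

(* Main.v *)
Require Import Defs.
From mathcomp Require Import all_boot all_order all_algebra.
From mathcomp Require Import all_classical all_reals all_analysis.
From mathcomp Require Import measurable_realfun.
From mathcomp Require Import ring lra.
Import Order.TTheory GRing.Theory Num.Theory.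
Import numFieldNormedType.Exports.

Set Implicit Arguments.
Unset Strict Implicit.
Unset Printing Implicit Defensive.

Local Open Scope classical_set_scope.
Local Open Scope ring_scope.

(** Suppose that [u] is a stable solution, with gradient [Du]. The idea is to
    test the stability inequality with [g(u) psi] and the equation with
    [h(u) psi^2], where [h' = g'^2] and [psi] is a cut-off function, and to
    subtract [19/18] times the equation. Because of Euler's identity
    [<F_xi(xi), xi> = F(xi)] (finsler_euler), and because [xi] lies in the kernel
    of the Hessian of [F] at [xi] (finsler_quad_shift), the gradient [Du] enters
    this difference only through the number [F(Du)]. The terms quadratic in
    [F(Du)] are [(1 - 19/18) F(Du)^2 g'(u)^2 psi^2], which is negative and
    absorbs the terms linear in [F(Du)]. There remain [grad psi], estimated with
    [|F_xi| <= b] and the upper bound on the Hessian (finsler_quad_bounds), and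
    [- e^u (g(u)^2 - 19/18 h(u)) psi^2].

    For [g = e^(alpha u)] one has [h = alpha/2 e^(2 alpha u)], and the last
    coefficient is negative, up to the small excess of [19/18] over [1], exactly
    when [alpha < 2]. Balancing [e^((2 alpha + 1) u) psi^2] against
    [e^(2 alpha u) |grad psi|^2] by Young's inequality gives a bound of order
    [rho^(N - 2 (2 alpha + 1))] for the integral of [e^((2 alpha + 1) u)] over a
    ball of radius [rho]; the exponent is negative for some [alpha < 2] as soon
    as [N < 10]. Here [alpha = 9/5], so that [2 (2 alpha + 1) = 46/5 > 9].

    Unbounded exponentials are not admissible, and rather than truncate them it
    is convenient to take [g = s^9] where [s = w / (1 + w)] and [w = e^(u/5)]:
    this behaves like [e^(9 u / 5)] where [u] is very negative and stays bounded
    where [u] is large. Both [g] and the corresponding [h] are polynomials in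
    [s], and so are all their derivatives. The inequality between the integrands
    is then a pointwise inequality between polynomials (energy_density_le), and
    it yields that the integral of [e^u s^18] over the unit cube is at most
    [C / r] for every large [r] (energy_decay). As [e^u s^18 > 0], this is
    absurd.

    Neither [g(u) psi] nor [h(u) psi^2] is smooth, since [u] is only in
    [H^1_loc]. Mollifying [u] turns them into genuine test functions. Along
    suitable scales the mollified functions and their gradients converge almost
    everywhere, with a square integrable bound (H1loc_approx), and dominated
    convergence gives the stability inequality and the equation for the limits
    (stability_limit, equation_limit). *)

(** * Directional derivatives and functions of class C^k *)

Section lines.
Context {R : realType} {V : normedModType R}.
Implicit Types (f : V -> R) (x v : V).

Lemma is_derive_lineP f x v (t d : R) :
  is_derive t 1 (fun s : R => f (s *: v + x)) d <->
  is_derive (t *: v + x) v f d.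
Proof.
have E : (fun h => h^-1 *: (((fun s : R => f (s *: v + x)) \o shift t) (h *: 1)
            - f (t *: v + x))) =
   (fun h => h^-1 *: ((f \o shift (t *: v + x)) (h *: v) - f (t *: v + x))).
  apply/funext => h /=; congr (_ *: (f _ - _)).
  by rewrite [h *: 1]mulr1 scalerDl addrA.
split => -[].
  rewrite /derivable /derive E => c <-; split => //.
move=> c <-; split; last by rewrite /derive E.
by rewrite /derivable E.
Qed.

(** The difference quotient stays multiplied by [h], which spares divisions in
    the applications. *)
Lemma is_derive_eps f x v (d : R) :
  (forall e, 0 < e -> exists2 r, 0 < r & forall h, `|h| < r ->
    `|f (h *: v + x) - f x - h * d| <= e * `|h|) ->
  is_derive x v f d.
Proof.
move=> fd.
have q : (fun h => h^-1 *: ((f \o shift x) (h *: v) - f x)) @ 0^' --> d.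
  apply/cvgrPdist_le => e e0; have [r r0 hr] := fd e e0.
  near=> h.
  have h0 : h != 0 by near: h; exact: nbhs_dnbhs_neq.
  have hr' : `|h| < r by near: h; exact: dnbhs0_lt.
  rewrite distrC -(ler_pM2r (x := `|h|)) ?normr_gt0// -normrM.
  rewrite mulrBl /= [_ *: _]mulrC mulfVK// [d * h]mulrC; exact: hr.
by split; [apply/cvg_ex; exists d | exact: cvg_lim].
Unshelve. all: by end_near. Qed.

Lemma is_derive_scale_dir f x v (a d : R) :
  is_derive x v f d -> is_derive x (a *: v) f (a * d).
Proof.
move=> fd; rewrite -[x](_ : 0 *: (a *: v) + x = x); last by rewrite scale0r add0r.
apply/is_derive_lineP.
have -> : (fun s : R => f (s *: (a *: v) + x)) =
    (fun s : R => f (s *: v + x)) \o (fun s => s * a).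
  by apply/funext => s /=; rewrite scalerA.
rewrite mulrC.
apply: (@is_derive1_comp _ (fun s : R => f (s *: v + x)) (fun s => s * a)).
  by apply/is_derive_lineP; rewrite mul0r scale0r add0r.
have -> : (fun s : R => s * a) = a *: id :> (R -> R).
  by apply/funext => s; rewrite /= mulrC.
by apply: is_derive_eq; rewrite [_ *: _]mulr1.
Qed.

Lemma line_mvt f x v :
  (forall s : R, 0 <= s <= 1 -> derivable f (s *: v + x) v) ->
  exists2 c : R, 0 <= c <= 1 & f (v + x) - f x = 'D_v f (c *: v + x).
Proof.
move=> fd.
have fd' (s : R) : 0 <= s <= 1 ->
    is_derive s 1 (fun s : R => f (s *: v + x)) ('D_v f (s *: v + x)).
  by move=> s01; apply/is_derive_lineP/derivableP/fd.
have [//|s||c] := @MVT_segment _ (fun s : R => f (s *: v + x))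
   (fun s : R => 'D_v f (s *: v + x)) 0 1.
- by rewrite in_itv/= => /andP[s0 s1]; apply: fd'; rewrite !ltW.
- apply: derivable_within_continuous => s; rewrite in_itv/= => s01.
  by have [] := fd' _ s01.
rewrite in_itv/= => c01; rewrite subr0 mulr1 scale1r scale0r add0r => ->.
by exists c.
Qed.

End lines.

Section rV_norm.
Context {R : realType} {N : nat}.
Implicit Types (x v : 'rV[R]_N).

Lemma coord_le_norm x i : `|x ord0 i| <= `|x|.
Proof.
rewrite [leRHS]/Num.norm /= mx_normrE.
exact: (le_bigmax _ (fun ij : 'I_1 * 'I_N => `|x ij.1 ij.2|) (ord0, i)).
Qed.

Lemma norm_le_coord x (e : R) : 0 <= e ->
  (forall i, `|x ord0 i| <= e) -> `|x| <= e.
Proof.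
move=> e0 xe; rewrite [leLHS]/Num.norm /= mx_normrE.
by apply/bigmax_leP; split => // -[i j] _ /=; rewrite ord1.
Qed.

Lemma dotp_sqr_le x : dotp x x <= N%:R * `|x| ^+ 2.
Proof.
rewrite /dotp; apply: (le_trans (ler_sum _ (G := fun=> `|x| ^+ 2) _)).
  move=> i _; rewrite -expr2 -real_normK ?num_real//.
  by rewrite lerXn2r ?nnegrE//; exact: coord_le_norm.
by rewrite sumr_const card_ord mulr_natl.
Qed.

Lemma sqr_coord_le_dotp x i : x ord0 i ^+ 2 <= dotp x x.
Proof.
rewrite /dotp (bigD1 i)//= -expr2 lerDl sumr_ge0// => j _.
by rewrite -expr2 sqr_ge0.
Qed.

Lemma dotp_ge0 x : 0 <= dotp x x.
Proof. by apply: sumr_ge0 => i _; rewrite -expr2 sqr_ge0. Qed.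

End rV_norm.

Section partial_derivatives.
Context {R : realType} {N : nat}.
Implicit Types (f : 'rV[R]_N -> R) (x v : 'rV[R]_N).

Let trunc k v : 'rV[R]_N := \row_j (if (j < k)%N then v ord0 j else 0).

Let truncS (k : 'I_N) v :
  trunc k.+1 v = v ord0 k *: delta_mx ord0 k + trunc k v.
Proof.
apply/rowP => j; rewrite !mxE /= ltnS.
have [->|jk] := eqVneq j k; first by rewrite leqnn ltnn addr0 mulr1.
by rewrite mulr0 add0r leq_eqVlt (val_eqE j k) (negbTE jk).
Qed.

(** Moving along one coordinate at a time reduces the increment to partial
    derivatives; each intermediate point stays in the cube around [x] because
    the norm is the sup norm. *)
Lemma telescoped_mvt f x v :
  (forall y i, `|y - x| <= `|v| -> derivable f y (delta_mx ord0 i)) ->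
  exists c : 'I_N -> 'rV[R]_N, (forall i, `|c i - x| <= `|v|) /\
    f (v + x) - f x = \sum_(i < N) v ord0 i * partial i f (c i).
Proof.
move=> fd.
have step (k : 'I_N) : exists c, `|c - x| <= `|v| /\
   f (trunc k.+1 v + x) - f (trunc k v + x) = v ord0 k * partial k f c.
  pose w : 'rV[R]_N := v ord0 k *: delta_mx ord0 k.
  have near_seg (s : R) : 0 <= s <= 1 -> `|s *: w + (trunc k v + x) - x| <= `|v|.
    move=> /andP[s0 s1]; rewrite addrA addrK; apply: norm_le_coord => // j.
    rewrite !mxE/=; have [->|jk] := eqVneq j k.
      rewrite ltnn addr0 mulr1 normrM (ger0_norm s0).
      by rewrite (le_trans _ (coord_le_norm v k))// ler_piMl.
    by rewrite !mulr0 add0r; case: ifP; rewrite ?normr0// coord_le_norm.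
  have wd (s : R) : 0 <= s <= 1 -> is_derive (s *: w + (trunc k v + x)) w f
     (v ord0 k * partial k f (s *: w + (trunc k v + x))).
    move=> s01; apply: is_derive_scale_dir; apply: derivableP.
    exact/fd/near_seg.
  have [|c c01] := @line_mvt _ _ f (trunc k v + x) w.
    by move=> s /wd[].
  rewrite addrA -(truncS k v) => ->; exists (c *: w + (trunc k v + x)); split.
    exact: near_seg.
  by have [_ ->] := wd _ c01.
have [c cP] := choice step; exists c; split; first by move=> i; exact: (cP i).1.
transitivity (\sum_(i < N) (f (trunc i.+1 v + x) - f (trunc i v + x))).
  rewrite -(big_mkord xpredT (fun i => f (trunc i.+1 v + x) - f (trunc i v + x))).
  rewrite telescope_sumr//; congr (f (_ + _) - f _).
    by apply/rowP => j; rewrite mxE ltn_ord.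
  by rewrite (_ : trunc 0 v = 0) ?add0r//; apply/rowP => j; rewrite !mxE.
by apply: eq_bigr => i _; exact: (cP i).2.
Qed.

(** Continuity of the partial derivatives makes the directional derivatives
    linear in the direction. *)
Lemma is_derive_C1 f x v :
  (\forall y \near x, forall i, derivable f y (delta_mx ord0 i)) ->
  (forall i, {for x, continuous (partial i f)}) ->
  is_derive x v f (\sum_(i < N) v ord0 i * partial i f x).
Proof.
move=> fd fc; apply: is_derive_eps => e e0.
have C0 : 0 < N%:R * `|v| + 1 by rewrite ltr_wpDl// mulr_ge0.
have e'0 : 0 < e / (N%:R * `|v| + 1) by rewrite divr_gt0.
have near_x : \forall y \near x, (forall i, derivable f y (delta_mx ord0 i)) /\
    (forall i, `|partial i f x - partial i f y| <= e / (N%:R * `|v| + 1)).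
  near=> y; split; first by near: y.
  by near: y; apply: filter_forall => i; move: (fc i) => /cvgrPdist_le; exact.
have [r /= r0 xr] := (nbhs_ballP _ _).1 near_x.
exists (r / (`|v| + 1)) => [|h hr]; first by rewrite divr_gt0// ltr_wpDl.
have hvr : `|h *: v| < r.
  rewrite normrZ (@le_lt_trans _ _ (`|h| * (`|v| + 1)))//.
    by rewrite ler_wpM2l// lerDl.
  by rewrite -ltr_pdivlMr// ltr_wpDl.
have inr y : `|y - x| <= `|h *: v| -> ball x r y.
  by move=> yx; rewrite -ball_normE/= distrC (le_lt_trans yx).
have [|c [cx ->]] := @telescoped_mvt f x (h *: v).
  by move=> y i /inr /xr[].
rewrite mulr_sumr -sumrB; apply: (le_trans (ler_norm_sum _ _ _)).
apply: (@le_trans _ _ (\sum_(i < N) `|h| * (`|v| * (e / (N%:R * `|v| + 1))))).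
  apply: ler_sum => i _; rewrite mxE -mulrA -mulrBr normrM ler_wpM2l//.
  rewrite -mulrBr normrM ler_pM//; first exact: coord_le_norm.
  by rewrite distrC; apply: (xr _ (inr _ (cx i))).2.
rewrite sumr_const card_ord -[leLHS]mulr_natl.
have E (n p q s t : R) : n * (p * (q * (s * t))) = s * p * (n * q * t) by ring.
rewrite E.
apply: ler_piMr; first by rewrite mulr_ge0// ltW.
by rewrite ler_pdivrMr// mul1r lerDl.
Unshelve. all: by end_near. Qed.

End partial_derivatives.

Section smooth_functions.
Context {R : realType} {N : nat}.
Local Notation V := 'rV[R]_N.
Implicit Types (f g : V -> R) (x v : V) (D : set V).

Lemma classC_cts k D f : classC k D f -> forall x, D x -> {for x, continuous f}.
Proof. by case: k => [|k] //= []. Qed.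

Lemma classCW k D f : classC k.+1 D f -> classC k D f.
Proof.
elim: k f => [|k IH] f [fc fd] //=.
by split => // i; have [? ?] := fd i; split => //; exact: IH.
Qed.

Lemma classC_is_derive k f x (i : 'I_N) : classC k.+1 setT f ->
  is_derive x (delta_mx ord0 i) f (partial i f x).
Proof. by move=> [_ /(_ i)[fd _]]; apply/derivableP/fd. Qed.

Lemma classCS_intro k f (df : 'I_N -> V -> R) : continuous f ->
  (forall i, (forall x, is_derive x (delta_mx ord0 i) f (df i x)) /\
    classC k setT (df i)) -> classC k.+1 setT f.
Proof.
move=> fc fd; split=> [x _|i]; first exact: fc.
have {fd}[fd dfk] := fd i; split=> [x _|]; first by have [] := fd x.
rewrite (_ : partial i f = df i)//; apply/funext => x.
by have [_] := fd x.
Qed.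

Lemma partial_val f x (i : 'I_N) (d : R) :
  is_derive x (delta_mx ord0 i) f d -> partial i f x = d.
Proof. by case. Qed.

Lemma classC_cst k (c : R) : classC k setT (fun _ : V => c).
Proof.
elim: k c => [c x _|k IH c]; first exact: (@cst_continuous V R c x).
refine (@classCS_intro _ _ (fun _ _ => 0) _ _) => [|i]; last split=> [x|].
- exact: (@cst_continuous V R c).
- exact: is_derive_cst.
- exact: IH.
Qed.

Lemma classC_coord k (j : 'I_N) : classC k setT (fun x : V => x ord0 j).
Proof.
have cc : continuous (fun x : V => x ord0 j) by exact: coord_continuous.
case: k => [x _|k]; first exact: cc.
refine (@classCS_intro _ _ (fun i _ => (i == j)%:R) _ _) => // i; split=> [x|].
  apply: is_derive_eps => e e0; exists 1 => // h _.
  by rewrite !mxE eqxx/= addrK eq_sym subrr normr0 mulr_ge0 // ltW.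
exact: classC_cst.
Qed.

Lemma classCD k f g : classC k setT f -> classC k setT g ->
  classC k setT (fun x => f x + g x).
Proof.
elim: k f g => [f g fc gc x xT|k IH f g fk gk].
  by apply: continuousD; [exact: fc | exact: gc].
refine (@classCS_intro _ _ (fun i x => partial i f x + partial i g x) _ _) => [|i]; last split=> [x|].
- move=> x; apply: continuousD; first exact: (classC_cts fk).
  exact: (classC_cts gk).
- apply: is_deriveD; [exact: classC_is_derive fk | exact: classC_is_derive gk].
- by apply: IH; [have [_ /(_ i)[]] := fk | have [_ /(_ i)[]] := gk].
Qed.

Lemma classCM k f g : classC k setT f -> classC k setT g ->
  classC k setT (fun x => f x * g x).
Proof.
elim: k f g => [f g fc gc x xT|k IH f g fk gk].
  by apply: continuousM; [exact: fc | exact: gc].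
refine (@classCS_intro _ _ (fun i x => f x * partial i g x + g x * partial i f x) _ _) => [|i]; last split=> [x|].
- move=> x; apply: continuousM; first exact: (classC_cts fk).
  exact: (classC_cts gk).
- apply: is_deriveM; [exact: classC_is_derive fk | exact: classC_is_derive gk].
- apply: classCD; apply: IH; do ?exact: classCW.
    by have [_ /(_ i)[]] := gk.
  by have [_ /(_ i)[]] := fk.
Qed.

Lemma classC_sum k (I : Type) (r : seq I) (F : I -> V -> R) :
  (forall i, classC k setT (F i)) -> classC k setT (fun x => \sum_(i <- r) F i x).
Proof.
move=> Fk; elim: r => [|i r IH].
  under eq_fun do rewrite big_nil; exact: classC_cst.
by under eq_fun do rewrite big_cons; exact: classCD.
Qed.

Lemma classCX k f n : classC k setT f -> classC k setT (fun x => f x ^+ n).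
Proof.
move=> fk; elim: n => [|n IH].
  by under eq_fun do rewrite expr0; exact: classC_cst.
by under eq_fun do rewrite exprS; exact: classCM.
Qed.

(** Iterated derivatives are carried along as a family, so that smoothness of a
    composition follows by induction on the order. *)
Definition smooth_family (H : nat -> R -> R) :=
  forall (j : nat) (t : R), is_derive t 1 (H j) (H j.+1 t).

Lemma smooth_family_cts H j : smooth_family H -> continuous (H j).
Proof.
move=> Hs t; apply: differentiable_continuous; apply/derivable1_diffP.
by have [] := Hs j t.
Qed.

Lemma is_derive_comp1 (h : R -> R) f x v (dh df : R) :
  is_derive (f x) 1 h dh -> is_derive x v f df ->
  is_derive x v (fun y => h (f y)) (dh * df).
Proof.
move=> hd fd; rewrite -[x](_ : 0 *: v + x = x); last by rewrite scale0r add0r.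
apply/is_derive_lineP.
apply: (@is_derive1_comp _ h (fun s : R => f (s *: v + x))).
  by rewrite scale0r add0r.
by apply/is_derive_lineP; rewrite scale0r add0r.
Qed.

Lemma classC_comp H k j f : smooth_family H -> classC k setT f ->
  classC k setT (fun x => H j (f x)).
Proof.
move=> Hs; have Hc i := @smooth_family_cts H i Hs.
elim: k j f => [j f fc x xT|k IH j f fk].
  by apply: (@continuous_comp _ _ _ f (H j)); [exact: fc | exact: Hc].
refine (@classCS_intro _ _ (fun i x => H j.+1 (f x) * partial i f x) _ _) => [|i]; last split=> [x|].
- move=> x; apply: (@continuous_comp _ _ _ f (H j)); last exact: Hc.
  exact: (classC_cts fk).
- by apply: is_derive_comp1; [exact: Hs | exact: classC_is_derive fk].
- apply: classCM; first by apply: IH; exact: classCW.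
  by have [_ /(_ i)[]] := fk.
Qed.

Lemma is_derive_affine f (t : R) (a x v : V) (d : R) :
  is_derive (t *: x + a) v f d ->
  is_derive x v (fun y => f (t *: y + a)) (t * d).
Proof.
move=> /(@is_derive_scale_dir _ _ f _ _ t) fd.
rewrite -[x](_ : 0 *: v + x = x); last by rewrite scale0r add0r.
apply/is_derive_lineP.
have -> : (fun s : R => f (t *: (s *: v + x) + a)) =
          (fun s : R => f (s *: (t *: v) + (t *: x + a))).
  by apply/funext => s; rewrite scalerDr !scalerA mulrC addrA.
by apply/is_derive_lineP; rewrite scale0r add0r.
Qed.

Lemma classC_affine k f (t : R) (a : V) : classC k setT f ->
  classC k setT (fun y => f (t *: y + a)).
Proof.
have ac : continuous (fun y : V => t *: y + a).
  by move=> y; apply: continuousD; [exact: scaler_continuous | exact: (@cst_continuous V V a y)].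
elim: k f => [f fc x _|k IH f fk].
  by apply: (@continuous_comp _ _ _ (fun y : V => t *: y + a) f);
    [exact: ac | exact: fc].
refine (@classCS_intro _ _ (fun i x => t * partial i f (t *: x + a)) _ _) => [|i]; last split=> [x|].
- move=> x; apply: (@continuous_comp _ _ _ (fun y : V => t *: y + a) f).
    exact: ac.
  exact: (classC_cts fk).
- by apply: is_derive_affine; exact: classC_is_derive fk.
- apply: classCM; first exact: classC_cst.
  by apply: IH; have [_ /(_ i)[]] := fk.
Qed.

End smooth_functions.

(** * Smooth functions of one variable *)

Section one_variable.
Context {R : realType}.

(* Restated with the product of R, which the ring tactic recognizes. *)
Let is_deriveMr (f g : R -> R) (x df dg : R) : is_derive x 1 f df ->
  is_derive x 1 g dg -> is_derive x 1 (fun y => f y * g y) (f x * dg + g x * df).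
Proof. exact: is_deriveM. Qed.

Let is_deriveVr (f : R -> R) (x df : R) : f x != 0 -> is_derive x 1 f df ->
  is_derive x 1 (fun y => (f y)^-1) (- (f x ^- 2) * df).
Proof. by move=> f0 fd; exact: is_deriveV. Qed.

Implicit Types (p q : {poly R}) (s t : R).

Lemma exprn_le_expR n s : 0 <= s -> s ^+ n <= n`!%:R * expR s.
Proof.
case: n => [|n] s0; first by rewrite expr0 mul1r -expR0 ler_expR.
rewrite -ler_pdivrMl ?ltr0n ?fact_gt0// mulrC.
by apply: le_trans (expR_ge1Dxn n s0); rewrite lerDr.
Qed.

Lemma poly_le_expR p : exists2 C : R, 0 <= C & forall s, 0 <= s -> `|p.[s]| <= C * expR s.
Proof.
exists (\sum_(i < size p) `|p`_i| * i`!%:R) => [|s s0].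
  by apply: sumr_ge0 => i _; rewrite mulr_ge0.
rewrite horner_coef mulr_suml; apply: (le_trans (ler_norm_sum _ _ _)).
apply: ler_sum => i _; rewrite normrM -mulrA ler_wpM2l//.
by rewrite ger0_norm ?exprn_ge0// exprn_le_expR.
Qed.

(** For [p = 1] this is the standard smooth function that is flat at the
    origin; the polynomial factor makes the family stable under derivation. *)
Definition flat p t : R := if 0 < t then p.[t^-1] * expR (- t^-1) else 0.

(** The chain rule in terms of the polynomial factor. *)
Definition flat_step p : {poly R} := 'X ^+ 2 * (p - p^`()).

(** The exponential beats any power of [1/t], so [flat p] is differentiable at
    [0] with derivative [0]. *)
Lemma flat_le_sqr p : exists2 C : R, 0 <= C & forall t, `|flat p t| <= C * t ^+ 2.
Proof.
have [C C0 CP] := poly_le_expR ('X ^+ 2 * p).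
exists C => // t; rewrite /flat; case: ifPn => t0; last first.
  by rewrite normr0 mulr_ge0// sqr_ge0.
have ti0 : 0 <= t^-1 by rewrite invr_ge0 ltW.
have := CP _ ti0; rewrite hornerM hornerXn normrM (ger0_norm (exprn_ge0 _ ti0)) => h.
rewrite normrM (ger0_norm (expR_ge0 _)) expRN ler_pdivrMr ?expR_gt0//.
rewrite -(ler_pM2l (x := t^-1 ^+ 2)) ?exprn_gt0 ?invr_gt0//.
apply: (le_trans h); rewrite le_eqVlt; apply/orP; left; apply/eqP.
have : t != 0 by rewrite gt_eqF.
by move=> ?; field.
Qed.

Lemma is_derive_flat p t : is_derive t 1 (flat p) (flat (flat_step p) t).
Proof.
have [t0|t0|t0] := ltgtP t 0.
- have -> : flat (flat_step p) t = 0 by rewrite /flat ifN// -leNgt ltW.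
  apply: (@near_eq_is_derive _ _ _ (cst 0)).
  near=> y; rewrite /flat ifN// -leNgt ltW//; near: y.
  exact: lt_nbhsl.
- have -> : flat (flat_step p) t = (flat_step p).[t^-1] * expR (- t^-1).
    by rewrite /flat ifT.
  apply: (@near_eq_is_derive _ _ _ (fun t => p.[t^-1] * expR (- t^-1))).
    near=> y; rewrite /flat ifT//; near: y; exact: lt_nbhsr.
  have tn0 : t != 0 by rewrite gt_eqF.
  have Dinv : is_derive t (1 : R) (fun t : R => t^-1) (- (t ^- 2)).
    by apply: is_derive_eq; first exact: is_deriveV; rewrite [_ *: _]mulr1.
  have Dp : is_derive t (1 : R) (fun t : R => p.[t^-1]) (p^`().[t^-1] * - (t ^- 2)).
    apply: (@is_derive1_comp _ (horner p) (fun t : R => t^-1)) => //.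
  have De : is_derive t (1 : R) (fun t : R => expR (- t^-1))
      (expR (- t^-1) * - - (t ^- 2)).
    exact: (@is_derive1_comp _ expR (fun t : R => - t^-1)).
  apply: (is_derive_eq (is_deriveMr Dp De)).
  by rewrite /flat_step !(hornerM, hornerXn, hornerX, hornerD, hornerN) -exprVn; ring.
- rewrite t0 /flat ltxx -/(flat p); apply: is_derive_eps => e e0.
  have [C C0 CP] := flat_le_sqr p.
  have C1 : 0 < C + 1 by rewrite ltr_wpDl.
  exists (e / (C + 1)) => [|h hr]; first by rewrite divr_gt0.
  rewrite addr0 {2}/flat ltxx mulr0 !subr0 [h *: _]mulr1.
  apply: (le_trans (CP h)); rewrite -(real_normK (num_real h)).
  rewrite expr2 mulrA ler_wpM2r//.
  rewrite (@le_trans _ _ ((C + 1) * `|h|))// ?ler_wpM2r// ?lerDl//.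
  by rewrite mulrC -ler_pdivlMr// ltW.
Unshelve. all: by end_near. Qed.

Lemma smooth_flat p : smooth_family (fun j => flat (iter j flat_step p)).
Proof. by move=> j t; rewrite iterS; exact: is_derive_flat. Qed.

Definition logistic (b t : R) : R := (1 + expR (- (b * t)))^-1.

(** Since [s = logistic b] solves [s' = b s (1 - s)], deriving [p(s)] amounts to
    this operation on [p]. *)
Definition logistic_step (b : R) p : {poly R} := b *: ('X * (1 - 'X) * p^`()).

Lemma is_derive_logistic b t :
  is_derive t 1 (logistic b) (b * (logistic b t * (1 - logistic b t))).
Proof.
have e1 : 1 + expR (- (b * t)) != 0 by rewrite gt_eqF// addr_gt0// expR_gt0.
have De : is_derive t (1 : R) (fun t => 1 + expR (- (b * t)))
    (expR (- (b * t)) * - b).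
  have -> : (fun t => 1 + expR (- (b * t))) = cst 1 + (expR \o (fun t => - b * t)).
    by apply/funext => u; congr (_ + expR _); rewrite mulNr.
  have D1 : is_derive t (1 : R) (fun t => - b * t) (- b).
    rewrite (_ : (fun _ => _) = (- b) *: id)//.
    by apply: is_derive_eq; rewrite [_ *: _]mulr1.
  rewrite -mulNr -[_ * - b]add0r; apply: is_deriveD.
have DV := @is_deriveVr (fun t => 1 + expR (- (b * t))) t _ e1 De.
apply: (is_derive_eq DV).
rewrite /logistic.
set E := expR _ in e1 *; field; exact: e1.
Qed.

Lemma smooth_logistic b p :
  smooth_family (fun j t => (iter j (logistic_step b) p).[logistic b t]).
Proof.
move=> j t; rewrite iterS; set q := iter _ _ _.
have -> : (logistic_step b q).[logistic b t] =
    q^`().[logistic b t] * (b * (logistic b t * (1 - logistic b t))).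
  by rewrite /logistic_step !(hornerZ, hornerM, hornerX, hornerD, hornerN, hornerC); ring.
apply: (@is_derive1_comp _ (horner q) (logistic b)) => //.
exact: is_derive_logistic.
Qed.

Lemma logistic_gt0 b t : 0 < logistic b t.
Proof. by rewrite invr_gt0 addr_gt0// expR_gt0. Qed.

Lemma logistic_lt1 b t : logistic b t < 1.
Proof.
by rewrite invf_lt1 ?ltrDl ?expR_gt0// addr_gt0// expR_gt0.
Qed.

End one_variable.

(** * Borel sets and Lebesgue measure on R^N *)

Section borel_rV.
Context {R : realType} {N : nat}.
Local Notation V := 'rV[R]_N.

Definition box (r : R) : set V := [set x | `|x| <= r].

Let cube (p : 'rV[rat]_N * nat) : set V :=
  [set y | forall i, `|ratr (p.1 ord0 i) - y ord0 i| < p.2.+1%:R^-1].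

Let measurable_cube p : measurable (cube p).
Proof.
have -> : cube p = \bigcap_(i in [set: 'I_N])
    ((fun x : V => x ord0 i) @^-1` ball (ratr (p.1 ord0 i) : R) p.2.+1%:R^-1).
  by apply/seteqP; split => [y yp i _|y yp i]; [exact: yp | exact: (yp i)].
apply: fin_bigcap_measurable => // i _; rewrite -[X in measurable X]setTI.
apply: (@measurable_coord _ (measurableTypeR R)) => //; exact: measurable_ball.
Qed.

(** The product sigma-algebra contains the Borel sets because the cubes with
    rational centre and radius [1/k] are countable and generate the topology. *)
Lemma open_measurable_rV (U : set V) : open U -> measurable U.
Proof.
move=> oU.
pose B p := if asbool (cube p `<=` U) then cube p else set0.
have -> : U = \bigcup_p B p.
  apply/seteqP; split => [x Ux|x [p _]]; last first.
    by rewrite /B; case: asboolP => // pU; exact: pU.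
  have /nbhs_ballP[e /= e0 xe] : nbhs x U by exact: open_nbhs_nbhs.
  have [k ke] : exists k, k.+1%:R^-1 < e / 2 :> R.
    by have [k _ /(_ k (leqnn k))] := near_infty_natSinv_lt (PosNum (divr_gt0 e0 (ltr0Sn R 1))); exists k.
  have qP i : exists q : rat, `|ratr q - x ord0 i| < k.+1%:R^-1.
    have k0 : 0 < k.+1%:R^-1 :> R by rewrite invr_gt0.
    have [|q] := @rat_in_itvoo R (x ord0 i - k.+1%:R^-1) (x ord0 i + k.+1%:R^-1).
      by rewrite ltrD2l gtrN.
    rewrite in_itv/= => qx; exists q; by rewrite ltr_distl.
  have [q qx] := choice qP.
  exists (\row_i q i, k) => //; rewrite /B ifT.
    by move=> i; rewrite mxE.
  apply/asboolP => y /= yq; apply: xe; rewrite -ball_normE/=.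
  apply: (@le_lt_trans _ _ (k.+1%:R^-1 + k.+1%:R^-1)); last first.
    by rewrite [e]splitr ltrD.
  apply: norm_le_coord => [|i]; first by rewrite addr_ge0.
  rewrite !mxE -(subrKA (ratr (q i))) (le_trans (ler_normD _ _))// lerD ?ltW//.
    by rewrite distrC.
  by have := yq i; rewrite mxE.
apply: countable_bigcupT_measurable => [|p]; first exact: countableP.
by rewrite /B; case: ifP.
Qed.

Lemma closed_measurable_rV (A : set V) : closed A -> measurable A.
Proof.
by move=> /closed_openC/open_measurable_rV/measurableC; rewrite setCK.
Qed.

(** The exceptional point accommodates functions that are merely continuous away
    from the origin. *)
Lemma measurable_continuous_off (f : V -> R) (a : V) :
  (forall x, x != a -> {for x, continuous f}) -> measurable_fun setT f.
Proof.
move=> fc; apply: (measurability _ (RGenOInfty.measurableE R)).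
move=> _ [_ [y ->] <-]; rewrite setTI.
pose A : set V := [set x | x != a /\ y < f x].
have oA : open A.
  rewrite openE => x [xa yx]; near=> z; split.
    near: z; apply: open_nbhs_nbhs; split => //.
    rewrite (_ : (fun z => _) = ~` [set a]); last first.
      by apply/seteqP; split => z /eqP.
    apply: closed_openC; apply: accessible_closed_set1.
    exact/hausdorff_accessible/norm_hausdorff.
  by near: z; exact: (cvgr_gt (f x) (fc _ xa)).
have ma : measurable [set a].
  apply: closed_measurable_rV; apply: accessible_closed_set1.
  exact/hausdorff_accessible/norm_hausdorff.
have -> : f @^-1` `]y, +oo[ = A `|` ([set a] `&` (f @^-1` `]y, +oo[)).
  apply/seteqP; split => [x /=|x [[xa yx]|[]//]]; last by rewrite /= in_itv/= yx.
  move=> yx; have [xa|xa] := eqVneq x a; first by right.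
  by left; split => //; move: yx; rewrite in_itv/= andbT.
apply: measurableU; first exact: open_measurable_rV.
have [ya|ya] := asboolP ((f @^-1` `]y, +oo[) a).
  by rewrite (_ : _ `&` _ = [set a])//; apply/seteqP; split => x; [case|move=> /= ->].
by rewrite (_ : _ `&` _ = set0)//; apply/seteqP; split => x // [/= ->].
Unshelve. all: by end_near. Qed.

Lemma continuous_measurable_rV (f : V -> R) : continuous f -> measurable_fun setT f.
Proof. by move=> fc; apply: (@measurable_continuous_off _ 0) => x _; exact: fc. Qed.

Lemma compact_box r : compact (box r).
Proof.
apply: bounded_closed_compact.
  exists r; split; first exact: num_real.
  by move=> M rM x /= xr; exact: le_trans (ltW rM).
apply: (@closed_comp _ _ (fun x : V => `|x|) [set y : R | y <= r]).
  by move=> x _; exact: norm_continuous.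
exact: closed_le.
Qed.

Lemma measurable_box r : measurable (box r).
Proof.
apply: closed_measurable_rV; apply: compact_closed; last exact: compact_box.
exact: norm_hausdorff.
Qed.

End borel_rV.

Section lebesgue_rV_invariance.
Context {R : realType}.

Let shift1_integral (f : R -> \bar R) (a : R) :
  measurable_fun [set: measurableTypeR R] f -> (forall x, 0 <= f x)%E ->
  (\int[lebesgue_measure]_x f (x + a)%R = \int[lebesgue_measure]_x f x)%E.
Proof.
move=> mf f0.
pose sh (x : measurableTypeR R) : measurableTypeR R := (x : R) + a.
have msh : measurable_fun setT sh by exact: measurable_funD.
transitivity (\int[pushforward lebesgue_measure sh]_x f x)%E.
  by rewrite ge0_integral_pushforward.
apply: eq_measure_integral => A mA _; apply/esym/lebesgue_measure_unique => //.
move=> _ [[b c]] _ <-.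
rewrite [RHS](_ : _ = lebesgue_measure `]b - a, c - a]%classic); last first.
  rewrite /= /pushforward; congr (lebesgue_measure _).
  by apply/seteqP; split => x /=; rewrite !in_itv/= /sh ltrBlDr lerBrDr.
rewrite !lebesgue_measure_itv/= !lte_fin ltrBlDr subrK -!EFinB.
by congr (if _ then _%:E else _); ring.
Qed.

Lemma ge0_integral_rV_step n (f : 'rV[R]_n.+1 -> \bar R) :
  measurable_fun setT f -> (forall x, 0 <= f x)%E ->
  (\int[lebesgue_rV n.+1]_x f x =
   \int[lebesgue_measure]_t \int[lebesgue_rV n]_x f (rV_cons (t, x)))%E.
Proof.
move=> mf f0.
transitivity (\int[pushforward (lebesgue_measure \x lebesgue_rV n)
   (@rV_cons R n)]_x f x)%E.
  by apply: eq_measure_integral; [exact: measurable_rV_cons | move=> ? A mA _].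
rewrite ge0_integral_pushforward//; last exact: measurable_rV_cons.
rewrite preimage_setT fubini_tonelli1//; last by move=> x; exact: f0.
by apply: measurableT_comp => //; exact: measurable_rV_cons.
Qed.

(** Translation invariance, by induction on the dimension through Tonelli's
    theorem. *)
Lemma ge0_integral_rV_shift n (f : 'rV[R]_n -> \bar R) (a : 'rV[R]_n) :
  measurable_fun setT f -> (forall x, 0 <= f x)%E ->
  (\int[lebesgue_rV n]_x f (x + a)%R = \int[lebesgue_rV n]_x f x)%E.
Proof.
elim: n f a => [|n IH] f a mf f0.
  by apply: eq_integral => x _; rewrite [x]thinmx0 [a]thinmx0 addr0.
have mfc : measurable_fun setT (f \o @rV_cons R n).
  by apply: measurableT_comp => //; exact: measurable_rV_cons.
have madd : measurable_fun setT (fun x : 'rV[R]_n.+1 => x + a).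
  apply: measurable_fun_rV => i.
  rewrite (_ : (fun _ => _) = (fun x : 'rV[R]_n.+1 => x ord0 i + a ord0 i)).
    by apply: measurable_funD => //; exact: (@measurable_coord _ (measurableTypeR R)).
  by apply/funext => x; rewrite mxE.
rewrite (ge0_integral_rV_step mf f0).
rewrite (ge0_integral_rV_step (measurableT_comp mf madd) (fun x => f0 (x + a))).
pose b := rV_uncons a.
have E t x : rV_cons (t, x) + a = rV_cons (t + b.1, x + b.2).
  apply/rowP => i; rewrite mxE; case: (splitP (i : 'I_(1 + n))) => [j|k] ij.
    have -> : i = lshift n j by exact/val_inj.
    rewrite ![rV_cons _ _ _]row_mxEl !mxE; congr (_ + a _ _).
    by apply/val_inj; rewrite /= ord1.
  have -> : i = rshift 1 k by exact/val_inj.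
  by rewrite ![rV_cons _ _ _]row_mxEr !mxE.
pose G (t : R) := (\int[lebesgue_rV n]_x f (rV_cons (t, x)))%E.
have <- : (\int[lebesgue_measure]_t G (t + b.1)%R = \int[lebesgue_measure]_t G t)%E.
  apply: shift1_integral.
    exact: (@measurable_fun_fubini_tonelli_F _ _ _ _ R (lebesgue_rV n)
      (f \o @rV_cons R n) mfc (fun p => f0 _)).
  by move=> t; apply: integral_ge0 => x _; exact: f0.
apply: eq_integral => t _.
under eq_integral do rewrite /= E.
apply: (IH (fun x => f (rV_cons (t + b.1, x)))) => [|x]; last exact: f0.
exact: (measurableT_comp mfc (measurable_pair1 _)).
Qed.

Lemma lebesgue_rV_box n (r : R) : 0 <= r ->
  lebesgue_rV n (box r) = ((r *+ 2) ^+ n)%:E.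
Proof.
move=> r0; elim: n => [|n IH].
  rewrite expr0 /= diracE mem_set//=.
  by rewrite /box /= normr0.
rewrite /= /lebesgue_rV_step /pushforward.
rewrite (_ : _ @^-1` _ = `[- r, r]%classic `*` box r).
  rewrite product_measure1E//; last exact: measurable_box.
  have -> : lebesgue_rV n (box r) = ((r *+ 2) ^+ n)%:E by exact: IH.
  rewrite /= lebesgue_measure_itv/= lte_fin exprS.
  have [r_gt0|r_le0] := ltP (- r) r; first by rewrite -EFinB -EFinM opprK -mulr2n.
  have -> : r = 0 by lra.
  by rewrite mul0rn mul0r mul0e.
apply/seteqP; split => -[t x] /=; rewrite in_itv/=.
  move=> h; have h' i := le_trans (coord_le_norm _ i) h.
  split; last first.
    apply: norm_le_coord => // i.
    by have := h' (rshift 1 i); rewrite [rV_cons _ _ _]row_mxEr.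
  have := h' (lshift n (ord0 : 'I_1)); rewrite [rV_cons _ _ _]row_mxEl mxE.
  by rewrite ler_norml.
move=> [tr xr]; apply: norm_le_coord => // i.
case: (splitP (i : 'I_(1 + n))) => [j|k] ij.
  have -> : i = lshift n j by exact/val_inj.
  by rewrite [rV_cons _ _ _]row_mxEl !mxE ler_norml.
have -> : i = rshift 1 k by exact/val_inj.
rewrite [rV_cons _ _ _]row_mxEr; exact: le_trans (coord_le_norm _ _) xr.
Qed.

End lebesgue_rV_invariance.

(** * Compactly supported functions and convolution *)

Section compactly_supported.
Context {R : realType} {N : nat}.
Local Notation V := 'rV[R]_N.
Local Notation mu := (@lebesgue_rV R N).
Implicit Types (f g u : V -> R) (x y : V).

(** Support in a cube: the form in which compactness of the support is used. *)
Definition vanish_off (r : R) f := forall x, r < `|x| -> f x = 0.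

Definition loc_integrable f := measurable_fun setT f /\
  forall r, mu.-integrable (box r) (EFin \o f).

Lemma vanish_compact_support r f : vanish_off r f -> compact_support setT f.
Proof.
move=> fr; split => //.
have sub : closure [set x | f x != 0] `<=` box r.
  rewrite -(_ : closure (box r) = box r).
    apply: closure_subset => x /= fx; rewrite /box /= leNgt; apply/negP => /fr f0.
    by rewrite f0 eqxx in fx.
  apply/esym/closure_id; apply: compact_closed; last exact: compact_box.
  exact: norm_hausdorff.
apply: (subclosed_compact _ (@compact_box R N r) sub).
exact: closed_closure.
Qed.

Lemma vanish_bounded r f : continuous f -> vanish_off r f ->
  exists2 M : R, 0 <= M & forall x, `|f x| <= M.
Proof.
move=> fc fr.
have : compact (f @` box r).
  apply: continuous_compact; last exact: compact_box.
  exact: continuous_subspaceT.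
move=> /compact_bounded[M [_ fM]].
exists (`|M| + 1) => [|x]; first by rewrite addr_ge0.
have [xr|/fr ->] := leP `|x| r; last by rewrite normr0 addr_ge0.
by apply: (fM (`|M| + 1)); [rewrite ltr_pwDr// ler_norm | exists x].
Qed.

Lemma vanish_partial r f i : vanish_off r f -> vanish_off r (partial i f).
Proof.
move=> fr x rx; apply: partial_val.
apply: (@near_eq_is_derive _ _ _ (cst 0)).
near=> y; rewrite fr//; near: y.
exact: (cvgr_gt `|x| (@norm_continuous _ _ x)).
Unshelve. all: by end_near. Qed.

Lemma vanish_lipschitz r f : classC 1 setT f -> vanish_off r f ->
  exists2 L : R, 0 <= L & forall x y, `|f x - f y| <= L * `|x - y|.
Proof.
move=> f1 fr.
have fd i : continuous (partial i f) by move=> x; exact: (f1.2 i).2.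
have /choice[M MP] : forall i, exists M, 0 <= M /\ forall x, `|partial i f x| <= M.
  by move=> i; have [M M0 MP] := vanish_bounded (fd i) (vanish_partial i fr); exists M.
exists (\sum_(i < N) M i) => [|x y]; first by apply: sumr_ge0 => i _; case: (MP i).
have [|c [_ ]] := @telescoped_mvt _ _ f y (x - y).
  by move=> z i _; exact: (f1.2 i).1.
rewrite subrK => ->; rewrite mulr_suml; apply: (le_trans (ler_norm_sum _ _ _)).
apply: ler_sum => i _; rewrite normrM mulrC ler_pM//; first exact: (MP i).2.
exact: coord_le_norm.
Qed.

Lemma box_finite r : (mu (box r) < +oo)%E.
Proof.
have [r0|r0] := leP 0 r; first by rewrite lebesgue_rV_box// ltry.
rewrite (_ : box r = set0) ?measure0//; apply/seteqP; split => x //=.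
by move=> /(le_trans (normr_ge0 _)); rewrite leNgt r0.
Qed.

Lemma bounded_box_integrable r f (M : R) : measurable_fun setT f ->
  (forall x, box r x -> `|f x| <= M) -> mu.-integrable (box r) (EFin \o f).
Proof.
move=> mf fM; apply: measurable_bounded_integrable.
- exact: measurable_box.
- exact: box_finite.
- exact: measurable_funTS.
- by exists M; split; rewrite ?num_real// => M' MM' x xr; exact: le_trans (fM _ xr) (ltW MM').
Qed.

Lemma le_box_integrable r f g : measurable_fun setT f ->
  mu.-integrable (box r) (EFin \o g) -> (forall x, `|f x| <= g x) ->
  mu.-integrable (box r) (EFin \o f).
Proof.
move=> mf ig fg; apply: (le_integrable _ _ _ ig).
- exact: measurable_box.
- by apply/measurable_EFinP; exact: measurable_funTS.
- by move=> x _ /=; rewrite lee_fin (le_trans (fg x))// ler_norm.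
Qed.

Lemma vanish_integrable r f : measurable_fun setT f -> vanish_off r f ->
  mu.-integrable (box r) (EFin \o f) -> mu.-integrable setT (EFin \o f).
Proof.
move=> mf fr ig; have := (integrable_mkcond (EFin \o f) (measurable_box r)).1 ig.
apply: eq_integrable => // x _; rewrite /patch; case: ifPn => //.
by rewrite notin_setE /= => /negP; rewrite -ltNge => /fr ->.
Qed.

Lemma vanish_Rintegral r f : vanish_off r f ->
  \int[mu]_x f x = \int[mu]_(x in box r) f x.
Proof.
move=> fr; rewrite [RHS]Rintegral_mkcond; apply: eq_Rintegral => x _.
rewrite /patch; case: ifPn => //.
by rewrite notin_setE /= => /negP; rewrite -ltNge => /fr ->.
Qed.

Lemma box_integrable_abs r u (C : R) : mu.-integrable (box r) (EFin \o u) ->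
  mu.-integrable (box r) (EFin \o (fun x => C * `|u x|)).
Proof.
move=> iu; have iau : mu.-integrable (box r) (EFin \o (fun x => `|u x|)).
  by have := integrable_abse iu.
exact: (integrableZl (measurable_box r) C iau).
Qed.

Lemma box_integrableD r f g : mu.-integrable (box r) (EFin \o f) ->
  mu.-integrable (box r) (EFin \o g) ->
  mu.-integrable (box r) (EFin \o (fun x => f x + g x)).
Proof. by move=> jf jg; have := integrableD (measurable_box r) jf jg. Qed.

Lemma box_integrableZ r f (c : R) : mu.-integrable (box r) (EFin \o f) ->
  mu.-integrable (box r) (EFin \o (fun x => c * f x)).
Proof. by move=> jf; exact: (integrableZl (measurable_box r) c jf). Qed.

Lemma box_integrable_cst r (c : R) : mu.-integrable (box r) (EFin \o (fun=> c)).
Proof. exact: (@bounded_box_integrable _ _ `|c|). Qed.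

Lemma box_integrable_sum r (I : Type) (s : seq I) (h : I -> V -> R) :
  (forall i, mu.-integrable (box r) (EFin \o h i)) ->
  mu.-integrable (box r) (EFin \o (fun x => \sum_(i <- s) h i x)).
Proof.
move=> ih; elim: s => [|i s IH].
  by under eq_fun do rewrite big_nil; exact: box_integrable_cst.
by under eq_fun do rewrite big_cons; exact: box_integrableD.
Qed.

Lemma le_Rintegral_vanish r f u (C : R) : loc_integrable u ->
  measurable_fun setT f -> vanish_off r f -> (forall x, `|f x| <= C * `|u x|) ->
  `|\int[mu]_x f x| <= C * \int[mu]_(x in box r) `|u x|.
Proof.
move=> [mu_ iu] mf fr fu.
have iau : mu.-integrable (box r) (EFin \o (fun x => `|u x|)).
  by have := integrable_abse (iu r).
have iCu := box_integrable_abs C (iu r).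
have if_ := le_box_integrable mf iCu fu.
rewrite (vanish_Rintegral fr) -RintegralZl//; last exact: measurable_box.
apply: (le_trans (le_normr_Rintegral (measurable_box r) if_)).
apply: le_Rintegral => //; first exact: measurable_box.
by have := integrable_abse if_.
Qed.

End compactly_supported.

Section convolution.
Context {R : realType} {N : nat}.
Local Notation V := 'rV[R]_N.
Local Notation mu := (@lebesgue_rV R N).
Implicit Types (u f rho : V -> R) (x y : V).

Definition convol u rho x : R := \int[mu]_y (u y * rho (x - y)).

Let measurable_reflect rho x : continuous rho ->
  measurable_fun setT (fun y => rho (x - y)).
Proof.
move=> rc; apply: continuous_measurable_rV => y.
apply: (@continuous_comp _ _ _ (fun y : V => x - y) rho); last exact: rc.
by apply: continuousB; [exact: (@cst_continuous V V x y) | by apply: cvg_id].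
Qed.

Let measurable_convol_integrand u rho x : loc_integrable u -> continuous rho ->
  measurable_fun setT (fun y => u y * rho (x - y)).
Proof. by move=> [mu_ _] rc; apply: measurable_funM => //; exact: measurable_reflect. Qed.

Lemma vanish_convol_integrand u rho r x s : vanish_off r rho -> `|x| + r <= s ->
  vanish_off s (fun y => u y * rho (x - y)).
Proof.
move=> rr xs y sy; rewrite rr ?mulr0//.
rewrite distrC (lt_le_trans _ (lerB_dist _ _))// ltrBrDl.
exact: le_lt_trans sy.
Qed.

Lemma convol_integrable u rho r x : loc_integrable u -> continuous rho ->
  vanish_off r rho -> mu.-integrable setT (EFin \o (fun y => u y * rho (x - y))).
Proof.
move=> iu rc rr; have [M M0 rM] := vanish_bounded rc rr.
apply: (@vanish_integrable _ _ (`|x| + r)).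
- exact: measurable_convol_integrand.
- exact: (vanish_convol_integrand _ rr).
- apply: (@le_box_integrable _ _ _ _ (fun y => M * `|u y|)).
  + exact: measurable_convol_integrand.
  + exact: box_integrable_abs (iu.2 _).
  + by move=> y; rewrite normrM mulrC ler_wpM2r.
Qed.

Lemma loc_lipschitz_cts f x (C : R) : 0 <= C ->
  (forall z, `|z - x| <= 1 -> `|f x - f z| <= C * `|x - z|) ->
  {for x, continuous f}.
Proof.
move=> C0 fC; apply/(@cvgrPdist_le _ _ _ (nbhs x)) => e e0.
have C1 : 0 < C + 1 by rewrite ltr_wpDl.
near=> z; apply: (le_trans (fC z _)).
  by rewrite distrC; near: z; apply: cvgr_dist_le => //; apply: cvg_id.
rewrite (@le_trans _ _ ((C + 1) * `|x - z|))// ?ler_wpM2r// ?lerDl//.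
rewrite -ler_pdivlMl// mulrC; near: z.
by apply: cvgr_dist_le; [apply: cvg_id | rewrite divr_gt0].
Unshelve. all: by end_near. Qed.

Lemma convol_cts u rho r : loc_integrable u -> classC 1 setT rho ->
  vanish_off r rho -> continuous (convol u rho).
Proof.
move=> iu r1 rr x; have rc : continuous rho by move=> z; exact: (classC_cts r1).
have [L L0 rL] := vanish_lipschitz r1 rr.
pose s := `|x| + 1 + r; pose I := \int[mu]_(y in box s) `|u y|.
have I0 : 0 <= I by apply: Rintegral_ge0.
apply: (@loc_lipschitz_cts _ _ (L * I)) => [|z zx]; first exact: mulr_ge0.
have zs : `|z| + r <= s.
  rewrite lerD2r -[z](subrK x) (le_trans (ler_normD _ _))// addrC lerD2l.
  exact: zx.
have xs : `|x| + r <= s by rewrite lerD2r lerDl.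
rewrite /convol -RintegralB//; try exact: (convol_integrable _ iu rc rr).
rewrite mulrAC; apply: le_Rintegral_vanish => //.
- by apply: measurable_funB; exact: measurable_convol_integrand.
- move=> y sy; rewrite (vanish_convol_integrand u rr xs)//.
  by rewrite (vanish_convol_integrand u rr zs)// subrr.
- move=> y; rewrite -mulrBr normrM mulrC ler_wpM2r//.
  have := rL (x - y) (z - y).
  by rewrite (_ : x - y - (z - y) = x - z)// opprB addrA subrK.
Qed.

(** Differentiation under the integral sign, quantitatively: the first order
    Taylor remainder of [rho] is at most [L h^2], with [L] a Lipschitz constant
    of the derivative, and [u] is integrable on the cubes that matter. *)
Lemma convol_is_derive u rho r x i : loc_integrable u -> classC 2 setT rho ->
  vanish_off r rho ->
  is_derive x (delta_mx ord0 i) (convol u rho) (convol u (partial i rho) x).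
Proof.
move=> iu r2 rr; have rc : continuous rho by move=> z; exact: (classC_cts r2).
have dr1 : classC 1 setT (partial i rho) by exact: (r2.2 i).2.
have drc : continuous (partial i rho) by move=> z; exact: (classC_cts dr1).
have drr := vanish_partial i rr.
have [L L0 rL] := vanish_lipschitz dr1 drr.
pose s := `|x| + 1 + r; pose I := \int[mu]_(y in box s) `|u y|.
have I0 : 0 <= I by apply: Rintegral_ge0.
have e1 : `|delta_mx ord0 i : V| <= 1.
  apply: norm_le_coord => // j; rewrite mxE/=.
  by case: eqVneq; rewrite /= ?normr1 ?normr0.
have taylor z (h : R) :
    `|rho (h *: delta_mx ord0 i + z) - rho z - h * partial i rho z| <= L * h ^+ 2.
  have D y : is_derive y (h *: (delta_mx ord0 i : V)) rho (h * partial i rho y).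
    by apply: is_derive_scale_dir; exact: classC_is_derive r2.
  have [t _|c c01 ->] := @line_mvt _ _ rho z (h *: delta_mx ord0 i).
    by have [] := D (t *: (h *: delta_mx ord0 i) + z).
  have [_ ->] := D (c *: (h *: delta_mx ord0 i) + z).
  rewrite -mulrBr normrM -(real_normK (num_real h)) expr2 mulrCA ler_wpM2l//.
  apply: (le_trans (rL _ _)); rewrite ler_wpM2l// addrK !normrZ.
  have /andP[c0 c1] := c01; rewrite (ger0_norm c0).
  by rewrite -[leRHS]mul1r ler_pM// ?mulr_ge0// -[leRHS]mulr1 ler_wpM2l.
apply: is_derive_eps => e e0.
exists (Num.min 1 (e / (L * I + 1))) => [|h].
  by rewrite lt_min ltr01 divr_gt0// ltr_wpDl// mulr_ge0.
rewrite lt_min => /andP[h1 he].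
have hs : `|h *: delta_mx ord0 i + x| + r <= s.
  rewrite lerD2r addrC (le_trans (ler_normD _ _))// lerD2l normrZ.
  by rewrite -[leRHS]mulr1 ler_pM// ltW.
have xs : `|x| + r <= s by rewrite lerD2r lerDl.
pose g y := u y * rho (h *: delta_mx ord0 i + x - y).
pose g0 y := u y * rho (x - y).
pose g1 y := h * (u y * partial i rho (x - y)).
have ig : mu.-integrable setT (EFin \o g) by exact: (convol_integrable _ iu rc rr).
have ig0 : mu.-integrable setT (EFin \o g0) by exact: (convol_integrable _ iu rc rr).
have ig1 : mu.-integrable setT (EFin \o g1).
  exact: (integrableZl measurableT h (convol_integrable x iu drc drr)).
have -> : convol u rho (h *: delta_mx ord0 i + x) - convol u rho x -
    h * convol u (partial i rho) x = \int[mu]_y (g y - g0 y - g1 y).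
  rewrite RintegralB//; last by have := integrableB measurableT ig ig0.
  rewrite RintegralB//; congr (_ - _).
  by rewrite RintegralZl//; exact: (convol_integrable _ iu drc drr).
apply: (@le_trans _ _ (L * h ^+ 2 * I)).
  apply: le_Rintegral_vanish => //.
  - apply: measurable_funB; last apply: measurable_funM => //.
      by apply: measurable_funB; exact: measurable_convol_integrand.
    exact: measurable_convol_integrand.
  - move=> y sy; rewrite /g (vanish_convol_integrand u rr hs)//.
    rewrite /g0 (vanish_convol_integrand u rr xs)//.
    by rewrite /g1 (vanish_convol_integrand u drr xs)// mulr0 !subr0.
  - move=> y; rewrite (_ : _ - _ = u y * (rho (h *: delta_mx ord0 i + (x - y)) -
        rho (x - y) - h * partial i rho (x - y))).
      by rewrite normrM mulrC ler_wpM2r.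
    by rewrite /g /g0 /g1 addrA; ring.
have LI : 0 < L * I + 1 by rewrite ltr_wpDl ?mulr_ge0.
rewrite -(real_normK (num_real h)) expr2.
rewrite (_ : _ * I = (L * I * `|h|) * `|h|); last by ring.
rewrite ler_wpM2r// (@le_trans _ _ ((L * I + 1) * `|h|))//.
  by rewrite ler_wpM2r// lerDl.
by rewrite mulrC -ler_pdivlMr// ltW.
Qed.

Lemma convol_classC u rho r k : loc_integrable u ->
  (forall k, classC k setT rho) -> vanish_off r rho ->
  classC k setT (convol u rho).
Proof.
elim: k rho => [|k IH] rho iu rk rr.
  by move=> x _; exact: (convol_cts iu (rk 1) rr).
refine (@classCS_intro _ _ _ _ (fun i => convol u (partial i rho)) _ _) => [|i].
  exact: (convol_cts iu (rk 1) rr).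
split=> [x|]; first exact: (convol_is_derive x i iu (rk 2) rr).
apply: IH => //; first by move=> l; have [_ /(_ i)[]] := rk l.+1.
exact: vanish_partial.
Qed.

(** The translated and reflected kernel [y |-> rho (x - y)] is a test function in
    the definition of the weak gradient. *)
Lemma weak_partial_convol u (Du : V -> V) rho r x i : weak_gradient setT u Du ->
  loc_integrable u -> loc_integrable (fun y => Du y ord0 i) ->
  (forall k, classC k setT rho) -> vanish_off r rho ->
  partial i (convol u rho) x = convol (fun y => Du y ord0 i) rho x.
Proof.
move=> wD iu iDu rk rr.
rewrite (partial_val (convol_is_derive x i iu (rk 2) rr)).
pose phi y := rho (-1 *: y + x).
have phiE y : phi y = rho (x - y) by rewrite /phi scaleN1r addrC.
have phir : vanish_off (`|x| + r) phi.
  move=> y sy; rewrite phiE rr// distrC (lt_le_trans _ (lerB_dist _ _))// ltrBrDl.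
  exact: sy.
have phic : classCcoo setT phi.
  split; last exact: (vanish_compact_support phir).
  by move=> k; exact: classC_affine.
have dphi y : partial i phi y = - partial i rho (x - y).
  have D := is_derive_affine (classC_is_derive (-1 *: y + x) i (rk 1)).
  by rewrite (partial_val D) mulN1r scaleN1r addrC.
have := wD i phi phic; under eq_Rintegral do rewrite dphi mulrN -mulN1r.
under [X in _ = - X]eq_Rintegral do rewrite phiE.
rewrite RintegralZl//; last first.
  apply: (convol_integrable _ iu); last exact: vanish_partial rr.
  have dr1 : classC 1 setT (partial i rho) by exact: ((rk 2).2 i).2.
  by move=> z; exact: (classC_cts dr1).
by rewrite mulN1r => /oppr_inj.
Qed.

End convolution.

(** * Mollification in L^2 *)

Section mollifier.
Context {R : realType} {N : nat}.
Local Notation V := 'rV[R]_N.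
Local Notation mu := (@lebesgue_rV R N).
Implicit Types (x y z : V).

Definition radial_bump x : R := flat 1 (1 - dotp x x).

Lemma flat1_ge0 (t : R) : 0 <= flat 1 t.
Proof. by rewrite /flat; case: ifP => // _; rewrite hornerC mul1r expR_ge0. Qed.

Lemma flat1_le1 (t : R) : flat 1 t <= 1.
Proof.
rewrite /flat; case: ifP => // t0; rewrite hornerC mul1r -[leRHS]expR0 ler_expR.
by rewrite lerNl oppr0 invr_ge0 ltW.
Qed.

Lemma flat1_gt0 (t : R) : 0 < t -> 0 < flat 1 t.
Proof. by move=> t0; rewrite /flat t0 hornerC mul1r expR_gt0. Qed.

Lemma flat1_le (s t : R) : 0 < s -> s <= t -> flat 1 s <= flat 1 t.
Proof.
move=> s0 st; have t0 := lt_le_trans s0 st; rewrite /flat s0 t0 !hornerC !mul1r.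
by rewrite ler_expR lerN2 lef_pV2.
Qed.

Lemma radial_bump_ge0 x : 0 <= radial_bump x. Proof. exact: flat1_ge0. Qed.

Lemma radial_bump_le1 x : radial_bump x <= 1. Proof. exact: flat1_le1. Qed.

Lemma radial_bump_classC k : classC k setT radial_bump.
Proof.
apply: (classC_comp 0 (smooth_flat 1) (f := fun x => 1 - dotp x x)).
apply: (@classCD _ _ _ (fun=> 1) (fun x => - dotp x x)); first exact: classC_cst.
rewrite (_ : (fun _ => _) = (fun x => -1 * dotp x x)); last first.
  by apply/funext => x; rewrite mulN1r.
apply: classCM; first exact: classC_cst.
by apply: classC_sum => i; apply: classCM; exact: classC_coord.
Qed.

Lemma radial_bump_vanish : vanish_off 1 radial_bump.
Proof.
move=> x x1; rewrite /radial_bump /flat ifN// -leNgt subr_le0 leNgt.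
apply: contraTN x1 => xx; rewrite -leNgt; apply: norm_le_coord => // i.
rewrite -[leRHS]ger0_norm// -ler_sqr ?nnegrE//= !real_normK ?num_real//.
by rewrite expr1n (le_trans (sqr_coord_le_dotp x i))// ltW.
Qed.

Lemma radial_bump_lb x (e : R) : e < 1 -> dotp x x <= e -> flat 1 (1 - e) <= radial_bump x.
Proof. by move=> e1 xe; apply: flat1_le; rewrite ?subr_gt0// lerD2l lerN2. Qed.

Lemma mollifier n : exists rho : V -> R, [/\ forall k, classC k setT rho,
  vanish_off n.+1%:R^-1 rho, forall x, 0 <= rho x, forall x, rho (- x) = rho x &
  (\int[mu]_x (rho x)%:E = 1)%E].
Proof.
pose b x := radial_bump (n.+1%:R *: x + 0).
have bk k : classC k setT b by apply: classC_affine; exact: radial_bump_classC.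
have bc : continuous b by move=> x; exact: (classC_cts (bk 0)).
have bv : vanish_off n.+1%:R^-1 b.
  move=> x nx; rewrite /b radial_bump_vanish// addr0 normrZ ger0_norm//.
  by rewrite mulrC -ltr_pdivrMr// mul1r.
have b0 x : 0 <= b x by exact: radial_bump_ge0.
have mb := continuous_measurable_rV bc.
have bi : mu.-integrable setT (EFin \o b).
  apply: (vanish_integrable mb bv); apply: (@bounded_box_integrable _ _ _ _ 1) => // x _.
  by rewrite ger0_norm// radial_bump_le1.
pose I := \int[mu]_x b x.
have EI : (\int[mu]_x (b x)%:E = I%:E)%E.
  by rewrite /I /Rintegral fineK//; exact: integrable_fin_num.
have N2 : 0 < N%:R + 1 :> R by rewrite ltr_wpDl.
have I0 : 0 < I.
  pose d : R := (n.+1%:R * (N%:R + 1) * 2)^-1.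
  have d0 : 0 < d by rewrite invr_gt0 !mulr_gt0.
  have m0 : 0 < flat 1 (1 - 2^-1 : R) by apply: flat1_gt0; lra.
  rewrite -lte_fin -EI.
  apply: (@lt_le_trans _ _ (\int[mu]_(x in box d) (flat 1 (1 - 2^-1 : R))%:E)%E).
    rewrite integral_cst; last exact: measurable_box.
    rewrite [X in (_ < _ * X)%E](_ : _ = ((d *+ 2) ^+ N)%:E); last first.
      by apply: lebesgue_rV_box; exact: ltW.
    by rewrite -EFinM lte_fin mulr_gt0// exprn_gt0// mulrn_wgt0.
  apply: (@le_trans _ _ (\int[mu]_(x in box d) (b x)%:E)%E).
    apply: ge0_le_integral => //.
    - exact: measurable_box.
    - by move=> x _; rewrite lee_fin ltW.
    - by apply/measurable_EFinP; exact: measurable_funTS.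
    - move=> x xd; rewrite lee_fin; apply: radial_bump_lb; first lra.
      rewrite addr0; apply: (le_trans (dotp_sqr_le _)).
      rewrite normrZ ger0_norm//.
      have nx : n.+1%:R * `|x| <= ((N%:R + 1) * 2)^-1.
        rewrite mulrC -ler_pdivlMr//; apply: (le_trans xd).
        by rewrite /d -mulrA invfM mulrC.
      apply: (@le_trans _ _ (N%:R * (((N%:R + 1) * 2)^-1 ^+ 2))).
        by rewrite ler_wpM2l// lerXn2r ?nnegrE ?mulr_ge0.
      have := N2; set a := N%:R + 1 => a0.
      have Na : N%:R <= a by rewrite lerDl.
      have a1 : 1 <= a by rewrite /a lerDr.
      rewrite exprVn ler_pdivrMr ?exprn_gt0 ?mulr_gt0//; nra.
  apply: ge0_subset_integral => //; first exact: measurable_box.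
    exact/measurable_EFinP.
  by move=> x _; rewrite lee_fin.
exists (fun x => I^-1 * b x); split.
- by move=> k; apply: classCM; [exact: classC_cst | exact: bk].
- by move=> x nx; rewrite bv// mulr0.
- by move=> x; rewrite mulr_ge0// invr_ge0 ltW.
- move=> x; rewrite /b /radial_bump; congr (_ * flat 1 (1 - _)).
  by apply: eq_bigr => i _; rewrite !mxE addr0 mulrN mulrNN addr0.
- under eq_integral do rewrite EFinM.
  rewrite ge0_integralZl_EFin ?invr_ge0 ?ltW//;
    [ | by move=> x _; rewrite lee_fin | exact/measurable_EFinP].
  by rewrite EI -EFinM mulVf// gt_eqF.
Qed.

End mollifier.

Section mollification.
Context {R : realType} {N : nat}.
Local Notation V := 'rV[R]_N.
Local Notation mu := (@lebesgue_rV R N).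
Implicit Types (f g u : V -> R) (x y z : V).

Variable rho : nat -> V -> R.
Hypothesis rho_classC : forall n k, classC k setT (rho n).
Hypothesis rho_vanish : forall n, vanish_off n.+1%:R^-1 (rho n).
Hypothesis rho_ge0 : forall n x, 0 <= rho n x.
Hypothesis rho_even : forall n x, rho n (- x) = rho n x.
Hypothesis rho_int1 : forall n, (\int[mu]_x (rho n x)%:E = 1)%E.

Let rho_cts n : continuous (rho n).
Proof. by move=> x; exact: (classC_cts (rho_classC n 0)). Qed.

Let rho_meas n : measurable_fun setT (rho n).
Proof. exact: continuous_measurable_rV. Qed.

Variable r : R.

Let D : set V := box (r + 1).
Let K : set V := box r.

Let mK : measurable K. Proof. exact: measurable_box. Qed.
Let mD : measurable D. Proof. exact: measurable_box. Qed.

(** Weighted pairs: for each [x] in [K] the measure [W n (x, y) dy] is a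
    probability, and its second marginal is at most Lebesgue measure on [D]. *)
Let W n (p : V * V) : R := \1_K p.1 * rho n (p.1 - p.2).

Let measurable_sub : measurable_fun setT (fun p : V * V => p.1 - p.2).
Proof.
apply: measurable_fun_rV => i.
rewrite (_ : (fun _ => _) = (fun p : V * V => p.1 ord0 i - p.2 ord0 i)); last first.
  by apply/funext => p; rewrite !mxE.
have mc := @measurable_coord _ (measurableTypeR R) N i.
apply: measurable_funB.
  exact: (measurableT_comp mc measurable_fst).
exact: (measurableT_comp mc measurable_snd).
Qed.

Let mrho n : measurable_fun setT (fun p : V * V => rho n (p.1 - p.2)).
Proof. exact: (measurableT_comp (rho_meas n) measurable_sub). Qed.

Let mW n : measurable_fun setT (W n).
Proof.
apply: measurable_funM => //.
exact: (measurableT_comp (measurable_indic mK) measurable_fst).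
Qed.

Let W_ge0 n p : 0 <= W n p.
Proof. by rewrite mulr_ge0. Qed.

Let rho_int1y n x : (\int[mu]_y (rho n (x - y))%:E = 1)%E.
Proof.
rewrite -(rho_int1 n).
transitivity (\int[mu]_y (rho n (y + - x))%:E)%E.
  by apply: eq_integral => y _; rewrite -rho_even opprB.
apply: (ge0_integral_rV_shift (f := fun y => (rho n y)%:E)) => //.
  exact/measurable_EFinP.
by move=> y; rewrite lee_fin.
Qed.

Let rho_int1x n y : (\int[mu]_x (rho n (x - y))%:E = 1)%E.
Proof.
rewrite -(rho_int1 n).
apply: (ge0_integral_rV_shift (f := fun y => (rho n y)%:E)) => //.
  exact/measurable_EFinP.
by move=> z; rewrite lee_fin.
Qed.

Let mrho1 n x : measurable_fun setT (fun y => rho n (x - y)).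
Proof. exact: (measurableT_comp (mrho n) (measurable_pair1 _)). Qed.

Let mrho2 n y : measurable_fun setT (fun x => rho n (x - y)).
Proof. exact: (measurableT_comp (mrho n) (measurable_pair2 _)). Qed.

Let int_indicE (A : set V) g : measurable A ->
  (\int[mu]_x (\1_A x * g x)%:E = \int[mu]_(x in A) (g x)%:E)%E.
Proof.
move=> mA; rewrite [RHS]integral_mkcond; apply: eq_integral => x _.
by rewrite /patch indicE; case: (x \in A); rewrite ?mul1r ?mul0r.
Qed.

Let W_int1 n g : measurable_fun setT g -> (forall x, 0 <= g x) ->
  (\int[mu \x mu]_p (W n p * g p.1)%:E <= \int[mu]_(x in D) (g x)%:E)%E.
Proof.
move=> mg g0.
have mWg : measurable_fun setT (fun p : V * V => W n p * g p.1).
  by apply: measurable_funM => //; exact: (measurableT_comp mg measurable_fst).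
rewrite fubini_tonelli1; last 2 first.
- exact/measurable_EFinP.
- by move=> p; rewrite lee_fin mulr_ge0.
rewrite /fubini_F.
under eq_integral => x _.
  under eq_integral => y _ do rewrite /W /= mulrAC EFinM.
  rewrite ge0_integralZl_EFin//; last 3 first.
  - by move=> y _; rewrite lee_fin.
  - exact/measurable_EFinP.
  - by rewrite mulr_ge0.
  rewrite rho_int1y mule1.
  over.
rewrite int_indicE//; apply: ge0_subset_integral => //.
- by apply/measurable_EFinP; exact: measurable_funTS.
- by move=> x _; rewrite lee_fin.
- by move=> x /= xr; apply: (le_trans xr); rewrite lerDl.
Qed.

Let W_support n p : W n p <= rho n (p.1 - p.2) * \1_D p.2.
Proof.
rewrite /W mulrC !indicE.
have [pD|pD] := boolP (p.2 \in D); first by rewrite ler_wpM2l//; case: (_ \in K).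
have [pK|_] := boolP (p.1 \in K); last by rewrite !mulr0.
rewrite mulr0 mulr1 rho_vanish//.
apply: (@le_lt_trans _ _ 1); first by rewrite invf_le1// ler1n.
move: pK pD; rewrite inE notin_setE /= => pK /negP; rewrite -ltNge => pD.
rewrite distrC (lt_le_trans _ (lerB_dist _ _))// ltrBrDl.
by rewrite (le_lt_trans _ pD)// lerD2r.
Qed.

Let W_int2 n g : measurable_fun setT g -> (forall x, 0 <= g x) ->
  (\int[mu \x mu]_p (W n p * g p.2)%:E <= \int[mu]_(x in D) (g x)%:E)%E.
Proof.
move=> mg g0.
have mWg : measurable_fun setT (fun p : V * V => W n p * g p.2).
  by apply: measurable_funM => //; exact: (measurableT_comp mg measurable_snd).
rewrite fubini_tonelli2; last 2 first.
- exact/measurable_EFinP.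
- by move=> p; rewrite lee_fin mulr_ge0.
rewrite -int_indicE//.
have m1g : measurable_fun setT (fun y => \1_D y * g y).
  by apply: measurable_funM => //; exact: measurable_indic.
apply: ge0_le_integral => //.
- by move=> y _; apply: integral_ge0 => x _; rewrite lee_fin mulr_ge0.
- apply: (@measurable_fun_fubini_tonelli_G _ _ _ _ R mu
    (fun p => (W n p * g p.2)%:E)).
    exact/measurable_EFinP.
  by move=> p; rewrite lee_fin mulr_ge0.
- exact/measurable_EFinP.
move=> y _; rewrite /fubini_G /=.
have -> : ((\1_D y * g y)%:E = \int[mu]_x ((\1_D y * g y)%:E * (rho n (x - y))%:E))%E.
  rewrite ge0_integralZl_EFin//; last 3 first.
  - by move=> x _; rewrite lee_fin.
  - exact/measurable_EFinP.
  - by rewrite mulr_ge0.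
  by rewrite rho_int1x mule1.
apply: ge0_le_integral => //.
- by move=> x _; rewrite lee_fin mulr_ge0.
- apply/measurable_EFinP; apply: measurable_funM => //.
  exact: (measurableT_comp (mW n) (measurable_pair2 _)).
- by apply/measurable_EFinP; apply: measurable_funM.
move=> x _; rewrite -EFinM lee_fin.
rewrite [leRHS](_ : _ = rho n (x - y) * \1_D y * g y); last by rewrite mulrC mulrA.
by rewrite ler_wpM2r//; exact: (W_support n (x, y)).
Qed.

(** The mean quadratic oscillation of [f] over pairs of points at distance of
    order [1/n], the first of which lies in [K]. By Jensen's inequality it bounds
    the L^2 distance on [K] between [f] and its mollification. *)
Let osc n f : \bar R := \int[mu \x mu]_p (W n p * (f p.2 - f p.1) ^+ 2)%:E.

Let mosc n f : measurable_fun setT f ->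
  measurable_fun setT (fun p : V * V => W n p * (f p.2 - f p.1) ^+ 2).
Proof.
move=> mf; apply: measurable_funM => //; apply: measurable_funX.
apply: measurable_funB; first exact: (measurableT_comp mf measurable_snd).
exact: (measurableT_comp mf measurable_fst).
Qed.

Let le_osc n f (h1 h2 : V * V -> R) (c : R) : 0 <= c ->
  measurable_fun setT f -> measurable_fun setT h1 -> measurable_fun setT h2 ->
  (forall p, 0 <= h1 p) -> (forall p, 0 <= h2 p) ->
  (forall p, W n p * (f p.2 - f p.1) ^+ 2 <= c * h1 p + c * h2 p) ->
  (osc n f <= c%:E * (\int[mu \x mu]_p (h1 p)%:E) +
              c%:E * (\int[mu \x mu]_p (h2 p)%:E))%E.
Proof.
move=> c0 mf m1 m2 h10 h20 fh.
rewrite -!ge0_integralZl_EFin//; last 4 first.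
- by move=> p _; rewrite lee_fin.
- exact/measurable_EFinP.
- by move=> p _; rewrite lee_fin.
- exact/measurable_EFinP.
rewrite -ge0_integralD//; last 4 first.
- by move=> p _; rewrite -EFinM lee_fin mulr_ge0.
- by apply/measurable_EFinP; exact: measurable_funM.
- by move=> p _; rewrite -EFinM lee_fin mulr_ge0.
- by apply/measurable_EFinP; exact: measurable_funM.
apply: ge0_le_integral => //.
- by move=> p _; rewrite lee_fin mulr_ge0// sqr_ge0.
- by apply/measurable_EFinP; exact: mosc.
- by apply/measurable_EFinP; apply: measurable_funD; exact: measurable_funM.
- by move=> p _; rewrite -!EFinM -EFinD lee_fin.
Qed.

(** The functions whose oscillation tends to [0]. They contain the Lipschitz
    functions and are closed under linear combinations and under L^2 limits; indicators
    of measurable sets and simple functions then give all of L^2. *)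
Let osc_small f := forall e : R, 0 < e -> \forall n \near \oo, (osc n f <= e%:E)%E.

Let osc_comb n f g (h : V -> R) : measurable_fun setT f -> measurable_fun setT g ->
  measurable_fun setT h ->
  (forall x y, (f x - f y) ^+ 2 <= 2 * (g x - g y) ^+ 2 + 2 * (h x - h y) ^+ 2) ->
  (osc n f <= 2%:E * osc n g + 2%:E * osc n h)%E.
Proof.
move=> mf mg mh fgh; apply: le_osc => //; try exact: mosc.
- by move=> p; rewrite mulr_ge0// sqr_ge0.
- by move=> p; rewrite mulr_ge0// sqr_ge0.
- move=> p; rewrite ![2 * (W n p * _)]mulrCA -mulrDr ler_wpM2l//.
Qed.

Let osc_small_comb f g (h : V -> R) : measurable_fun setT f -> measurable_fun setT g ->
  measurable_fun setT h -> osc_small g -> osc_small h ->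
  (forall x y, (f x - f y) ^+ 2 <= 2 * (g x - g y) ^+ 2 + 2 * (h x - h y) ^+ 2) ->
  osc_small f.
Proof.
move=> mf mg mh sg sh fgh e e0; have e4 : 0 < e / 4 by rewrite divr_gt0.
near=> n; apply: (le_trans (osc_comb n mf mg mh fgh)).
have -> : e%:E = (2%:E * (e / 4)%:E + 2%:E * (e / 4)%:E)%E.
  by rewrite -!EFinM -EFinD; congr (_%:E); lra.
apply: leeD; rewrite lee_pmul2l//; near: n; [exact: sg|exact: sh].
Unshelve. all: by end_near. Qed.

Let osc_le_L2 n f : measurable_fun setT f ->
  (osc n f <= 4%:E * \int[mu]_(x in D) (f x ^+ 2)%:E)%E.
Proof.
move=> mf; have mf2 : measurable_fun setT (fun x => f x ^+ 2) by exact: measurable_funX.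
apply: (@le_trans _ _ (2%:E * \int[mu]_(x in D) (f x ^+ 2)%:E +
                      2%:E * \int[mu]_(x in D) (f x ^+ 2)%:E)%E); last first.
  rewrite -ge0_muleDl ?lee_fin//.
  by rewrite -EFinD -natrD.
apply: (@le_trans _ _ (2%:E * \int[mu \x mu]_p (W n p * f p.1 ^+ 2)%:E +
                      2%:E * \int[mu \x mu]_p (W n p * f p.2 ^+ 2)%:E)%E).
  apply: le_osc => //.
  - apply: measurable_funM => //; exact: (measurableT_comp mf2 measurable_fst).
  - apply: measurable_funM => //; exact: (measurableT_comp mf2 measurable_snd).
  - by move=> p; rewrite mulr_ge0// sqr_ge0.
  - by move=> p; rewrite mulr_ge0// sqr_ge0.
  - move=> p; rewrite ![2 * (W n p * _)]mulrCA -mulrDr ler_wpM2l//.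
    by have := sqr_ge0 (f p.1 + f p.2); nra.
by apply: leeD; rewrite lee_pmul2l//; [apply: (W_int1 n mf2)|apply: (W_int2 n mf2)] => x;
   exact: sqr_ge0.
Qed.

(** If [g] is L^2-close to [f] on [D], the oscillation of [f] is controlled by
    that of [g], uniformly in the scale. *)
Let osc_small_closed f : measurable_fun setT f ->
  (forall e : R, 0 < e -> exists g, [/\ measurable_fun setT g, osc_small g &
     (\int[mu]_(x in D) ((f x - g x) ^+ 2)%:E <= e%:E)%E]) ->
  osc_small f.
Proof.
move=> mf fg e e0; have [|g [mg sg gfe]] := fg (e / 16); first by rewrite divr_gt0.
have mfg : measurable_fun setT (fun x => f x - g x) by exact: measurable_funB.
near=> n; apply: (le_trans (osc_comb n mf mg mfg _)).
  by move=> x y; have := sqr_ge0 (g x - g y - (f x - g x - (f y - g y))); nra.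
have -> : e%:E = (2%:E * (e / 4)%:E + 2%:E * (e / 4)%:E)%E.
  by rewrite -!EFinM -EFinD; congr (_%:E); lra.
apply: leeD; rewrite lee_pmul2l//.
  by near: n; apply: sg; rewrite divr_gt0.
apply: (le_trans (osc_le_L2 n mfg)).
have -> : (e / 4)%:E = (4%:E * (e / 16)%:E)%E.
  by rewrite -!EFinM; congr (_%:E); lra.
by rewrite lee_pmul2l.
Unshelve. all: by end_near. Qed.

Let osc_small_lipschitz f (L : R) : measurable_fun setT f -> 0 <= L ->
  (forall x y, `|f x - f y| <= L * `|x - y|) -> osc_small f.
Proof.
move=> mf L0 fL e e0.
have h (n : nat) : (osc n f <= 1%:E * (\int[mu \x mu]_p (W n p * (L / n.+1%:R) ^+ 2)%:E) +
    1%:E * (\int[mu \x mu]_p (0:R)%:E))%E.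
  apply: le_osc => //.
  - by apply: measurable_funM.
  - by move=> p; rewrite mulr_ge0// sqr_ge0.
  - move=> p; rewrite mulr0 addr0 mul1r.
    have [W0|W0] := eqVneq (W n p) 0; first by rewrite W0 !mul0r.
    rewrite ler_wpM2l// -(real_normK (num_real (_ - _))) lerXn2r ?nnegrE//.
      by rewrite divr_ge0.
    apply: (le_trans (fL _ _)); rewrite ler_wpM2l// leNgt distrC.
    by apply: contraNN W0 => pn; rewrite /W rho_vanish ?mulr0.
pose m := fine (mu D).
have mDE : mu D = m%:E by rewrite /m fineK// ge0_fin_numE//; exact: box_finite.
have m0 : 0 <= m by rewrite /m fine_ge0.
have c0 : 0 < L ^+ 2 * m + 1 by rewrite ltr_wpDl// mulr_ge0// sqr_ge0.
near=> n; apply: (le_trans (h n)).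
rewrite integral0 mule0 adde0 mul1e.
apply: (le_trans (W_int1 n (g := fun=> (L / n.+1%:R) ^+ 2) _ _)) => //.
  by move=> _; exact: sqr_ge0.
rewrite integral_cst// [X in (_ * X <= _)%E](_ : _ = m%:E); last exact: mDE.
rewrite -EFinM lee_fin expr_div_n mulrAC.
have n1 : 1 <= n.+1%:R :> R by rewrite ler1n.
apply: (@le_trans _ _ ((L ^+ 2 * m + 1) / n.+1%:R)).
  apply: ler_pM => //; first by rewrite mulr_ge0// sqr_ge0.
  - by rewrite lerDl.
  - by rewrite lef_pV2 ?posrE ?exprn_gt0// ?(lt_le_trans _ n1)// expr2 ler_peMl// (le_trans _ n1).
rewrite -ler_pdivlMl// mulrC ltW//; near: n.
exact: near_infty_natSinv_lt (PosNum (divr_gt0 e0 c0)).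
Unshelve. all: by end_near. Qed.

Let osc_small_limit f (g : nat -> V -> R) (G : V -> R) : measurable_fun setT f ->
  (forall k, measurable_fun setT (g k)) -> (forall k, osc_small (g k)) ->
  (forall x, g k x @[k --> \oo] --> f x) -> mu.-integrable D (EFin \o G) ->
  (forall k x, (f x - g k x) ^+ 2 <= G x) -> osc_small f.
Proof.
move=> mf mg sg gf iG fgG; apply: osc_small_closed => // e e0.
have mfg k : measurable_fun D (EFin \o (fun x => (f x - g k x) ^+ 2)).
  apply/measurable_EFinP; apply: measurable_funTS; apply: measurable_funX.
  exact: measurable_funB.
have [| | |_ _] := dominated_convergence mD mfg (f := cst 0%E) _ _ iG.
- exact: measurable_cst.
- apply: aeW => x _; apply: cvg_EFin; first exact: nearW.
  rewrite [X in _ --> X](_ : _ = (f x - f x) ^+ 2); last by rewrite subrr expr0n.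
  rewrite expr2; apply: cvgM; apply: cvgB => //; exact: cvg_cst.
- by apply: aeW => x k _; rewrite lee_fin ger0_norm ?sqr_ge0.
rewrite integral0 => /fine_cvgP[fn] /cvgrPdist_le/(_ e e0) h.
have [k _ /(_ k (leqnn k))[fk hk]] : \forall k \near \oo,
    (\int[mu]_(x in D) ((f x - g k x) ^+ 2)%:E)%E \is a fin_num /\
    `|0 - fine (\int[mu]_(x in D) ((f x - g k x) ^+ 2)%:E)%E| <= e.
  by near=> k; split; near: k.
exists (g k); split => //; rewrite -(fineK fk) lee_fin.
by rewrite (le_trans _ hk)// sub0r normrN ler_norm.
Unshelve. all: by end_near. Qed.

(** These sets form a sigma-algebra, which contains the half-spaces
    [{x | x_i > a}]; hence they are all the measurable sets. *)
Let osc_set (A : set V) := measurable A /\ osc_small (\1_A : V -> R).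

(** Here [A] is a Boolean combination of [B] and [C], so that two points which
    [A] separates are separated by [B] or by [C]. *)
Let indic_sqr_le (A B C : set V) : (forall x y, (x \in A) != (y \in A) ->
    (x \in B) != (y \in B) \/ (x \in C) != (y \in C)) ->
  forall x y, ((\1_A x : R) - \1_A y) ^+ 2 <=
    2 * (\1_B x - \1_B y) ^+ 2 + 2 * (\1_C x - \1_C y) ^+ 2.
Proof.
have sq (b c : bool) : b != c -> ((b%:R : R) - c%:R) ^+ 2 = 1.
  by case: b c => [] []; rewrite ?subr0 ?sub0r ?sqrrN ?expr1n.
move=> ABC x y; rewrite !indicE.
have [->|xy] := eqVneq (x \in A) (y \in A).
  by rewrite subrr expr0n /= addr_ge0// mulr_ge0// sqr_ge0.
rewrite (sq _ _ xy); have [/sq ->|/sq ->] := ABC x y xy.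
  by have := sqr_ge0 ((x \in C)%:R - (y \in C)%:R : R); lra.
by have := sqr_ge0 ((x \in B)%:R - (y \in B)%:R : R); lra.
Qed.

Let mindic (A : set V) : measurable A -> measurable_fun setT (\1_A : V -> R).
Proof. by move=> mA; exact: measurable_indic. Qed.

Let osc_set_setC A : osc_set A -> osc_set (~` A).
Proof.
move=> [mA sA]; have mAC := measurableC mA; split => //.
apply: (osc_small_comb (mindic mAC) (mindic mA) (mindic mA) sA sA).
by apply: indic_sqr_le => x y; rewrite !in_setC; case: (_ \in _) (_ \in _) => [] []; left.
Qed.

Let osc_set_setU A B : osc_set A -> osc_set B -> osc_set (A `|` B).
Proof.
move=> [mA sA] [mB sB]; have mAB := measurableU _ _ mA mB; split => //.
apply: (osc_small_comb (mindic mAB) (mindic mA) (mindic mB) sA sB).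
apply: indic_sqr_le => x y; rewrite !in_setU.
by case: (x \in A) (x \in B) (y \in A) (y \in B) => [] [] [] [] //= _; (left + right).
Qed.

Let osc_set_set0 : osc_set set0.
Proof.
split => //; apply: (osc_small_lipschitz (L := 0)) => // x y.
by rewrite !indicE !in_set0 subrr normr0 mul0r.
Qed.

Let osc_set_bigcup (A : (set V)^nat) : (forall k, osc_set (A k)) -> osc_set (\bigcup_k A k).
Proof.
move=> gA; have mA : measurable (\bigcup_k A k).
  by apply: bigcup_measurable => k _; case: (gA k).
split => //; pose B m := \bigcup_(k < m) A k.
have gB m : osc_set (B m).
  rewrite /B; elim: m => [|m IH].
    by rewrite bigcup_mkord big_ord0; exact: osc_set_set0.
  by rewrite bigcup_mkord big_ord_recr/= -bigcup_mkord; exact: osc_set_setU.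
apply: (osc_small_limit (g := fun m => \1_(B m)) (G := cst 1)).
- exact: mindic.
- by move=> m; apply: mindic; case: (gB m).
- by move=> m; case: (gB m).
- move=> x; have [[k _ Akx]|xA] := asboolP ((\bigcup_k A k) x).
    apply: (cvg_near_cst); exists k.+1 => // m /= km; rewrite !indicE !mem_set//.
      by exists k.
    by exists k.
  apply: cvg_near_cst; near=> m; rewrite !indicE !memNset// => -[k _ Akx].
  by apply: xA; exists k.
- by apply: (@bounded_box_integrable _ _ _ _ 1) => // x _; rewrite normr1.
- move=> k x; rewrite !indicE.
  by case: (_ \in _) (_ \in _) => [] []; rewrite ?subrr ?subr0 ?sub0r ?sqrrN ?expr0n ?expr1n.
Unshelve. all: by end_near. Qed.

(** The indicator of a half-space is the pointwise limit of the Lipschitz ramps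
    [x |-> min(1, max(0, k (x_i - a)))]. *)
Let osc_set_coord i (Y : set R) : measurable Y -> osc_set ((fun x : V => x ord0 i) @^-1` Y).
Proof.
rewrite [measurable Y](_ : _ = (@RGenOInfty.G R).-sigma.-measurable Y); last first.
  by rewrite -RGenOInfty.measurableE.
apply: (@smallest_sub _ _ _ [set Y | osc_set ((fun x : V => x ord0 i) @^-1` Y)]) => [|_ [a ->]].
  split => /=.
  - by rewrite preimage_set0; exact: osc_set_set0.
  - by move=> A gA; rewrite setTD preimage_setC; exact: osc_set_setC.
  - by move=> A gA; rewrite preimage_bigcup; exact: osc_set_bigcup.
have mi : measurable_fun setT (fun x : V => x ord0 i).
  exact: (@measurable_coord _ (measurableTypeR R)).
have mA : measurable ((fun x : V => x ord0 i) @^-1` `]a, +oo[%classic).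
  by rewrite -[X in measurable X]setTI; exact: mi.
split => //.
pose cl (t : R) : R := if t <= 0 then 0 else if t <= 1 then t else 1.
have cl_lip s t : `|cl s - cl t| <= `|s - t|.
  have := ler_norm (s - t); have := ler_norm (t - s); rewrite [`|t - s|]distrC => ? ?.
  by rewrite /cl ler_norml; case: (leP s 0) => ?; case: (leP t 0) => ?;
    case: (leP s 1) => ?; case: (leP t 1) => ?; lra.
have cl1 s : 0 <= cl s <= 1.
  by rewrite /cl; case: (leP s 0) => ?; case: (leP s 1) => ?; lra.
have hL k x y : `|cl (k%:R * (x ord0 i - a)) - cl (k%:R * (y ord0 i - a))| <=
    k%:R * `|x - y|.
  apply: (le_trans (cl_lip _ _)); rewrite -mulrBr opprB addrA subrK normrM normr_nat.
  by rewrite ler_wpM2l//; have := coord_le_norm (x - y) i; rewrite !mxE.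
pose h (k : nat) (x : V) : R := cl (k%:R * (x ord0 i - a)).
have hc k : continuous (h k).
  move=> x; apply: (@loc_lipschitz_cts _ _ _ _ k%:R) => // z _; exact: hL.
have mh k : measurable_fun setT (h k) by exact: continuous_measurable_rV.
apply: (osc_small_limit (g := h) (G := cst 1)) => //.
- by move=> k; apply: (osc_small_lipschitz (L := k%:R) (mh k)) => // x y; exact: hL.
- move=> x; apply: cvg_near_cst; rewrite indicE.
  have [xa|xa] := ltP a (x ord0 i).
    rewrite mem_set/= ?in_itv/= ?xa//.
    have d0 : 0 < x ord0 i - a by rewrite subr_gt0.
    near=> k; rewrite /h /cl.
    have k1 : 1 < k%:R * (x ord0 i - a).
      rewrite -ltr_pdivrMr//; near: k; exact: nbhs_infty_gtr.
    by rewrite leNgt (lt_trans _ k1)//= leNgt k1.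
  rewrite memNset/= ?in_itv/= ?andbT; last by apply/negP; rewrite -leNgt.
  near=> k; rewrite /h /cl ifT// mulr_ge0_le0// subr_le0//.
- by apply: (@bounded_box_integrable _ _ _ _ 1) => // x _; rewrite normr1.
- move=> k x; have /andP[h0 h1] := cl1 (k%:R * (x ord0 i - a)).
  rewrite indicE /cst /h; move: (cl _) h0 h1 => t t0 t1.
  by case: (_ \in _); rewrite /= ?mulr1n ?mulr0n; nra.
Unshelve. all: by end_near. Qed.

Let osc_set_measurable A : measurable A -> osc_set A.
Proof.
apply: (@smallest_sub _ _ _ osc_set) => [|B].
  split => [|B gB|B gB]; first exact: osc_set_set0.
    by rewrite setTD; exact: osc_set_setC.
  exact: osc_set_bigcup.
rewrite -bigcup_seq => -[i _ [Y mY <-]]; rewrite setTI; exact: osc_set_coord.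
Qed.

Let osc_small0 : osc_small (fun=> 0).
Proof. by apply: (osc_small_lipschitz (L := 0)) => // x y; rewrite subrr normr0 mul0r. Qed.

Let osc_smallD f g : measurable_fun setT f -> measurable_fun setT g ->
  osc_small f -> osc_small g -> osc_small (fun x => f x + g x).
Proof.
move=> mf mg sf sg; apply: (osc_small_comb _ mf mg sf sg).
  exact: measurable_funD.
by move=> x y; have := sqr_ge0 ((f x - f y) - (g x - g y)); nra.
Qed.

Let osc_small_scale f (c : R) : measurable_fun setT f -> osc_small f ->
  osc_small (fun x => c * f x).
Proof.
move=> mf sf e e0; have c0 : 0 < c ^+ 2 + 1 by rewrite ltr_wpDl// sqr_ge0.
have mcf : measurable_fun setT (fun x => c * f x) by exact: measurable_funM.
near=> n.
apply: (@le_trans _ _ ((c ^+ 2 + 1)%:E * osc n f + (c ^+ 2 + 1)%:E *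
   (\int[mu \x mu]_p (0:R)%:E))%E).
  apply: le_osc => //; first exact: ltW.
  - exact: mosc.
  - by move=> p; rewrite mulr_ge0// sqr_ge0.
  - move=> p; rewrite mulr0 addr0 -mulrBr exprMn mulrCA ler_wpM2r//.
      by rewrite mulr_ge0// sqr_ge0.
    by rewrite lerDl.
rewrite integral0 mule0 adde0 -lee_pdivlMl//.
rewrite -EFinM; near: n; apply: sf; by rewrite mulr_gt0// invr_gt0.
Unshelve. all: by end_near. Qed.

Import HBNNSimple.

Let osc_small_nnsfun (h : {nnsfun V >-> R}) : osc_small h.
Proof.
have sh (s : seq R) : (measurable_fun setT (fun x => \sum_(y <- s) y * \1_(h @^-1` [set y]) x)) /\
    osc_small (fun x => \sum_(y <- s) y * \1_(h @^-1` [set y]) x).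
  elim: s => [|y s [IHm IHs]].
    by under eq_fun do rewrite big_nil; split.
  under eq_fun do rewrite big_cons.
  have [mA sA] : osc_set (h @^-1` [set y]) by exact: osc_set_measurable.
  have m1 : measurable_fun setT (fun x : V => y * (\1_(h @^-1` [set y]) x : R)).
    by apply: measurable_funM => //; exact: mindic.
  split; first exact: measurable_funD.
  by apply: osc_smallD => //; apply: osc_small_scale => //; exact: mindic.
pose s := finmap.enum_fset (fset_set (range h)).
rewrite (_ : (h : V -> R) = (fun x => \sum_(y <- s) y * \1_(h @^-1` [set y]) x)).
  by have [] := sh s.
by apply/funext => x; rewrite fimfunE fsbig_finite.
Qed.

Let osc_small_ge0 f : measurable_fun setT f -> (forall x, 0 <= f x) ->
  mu.-integrable D (EFin \o (fun x => f x ^+ 2)) -> osc_small f.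
Proof.
move=> mf f0 if2; have mEf : measurable_fun setT (EFin \o f) by exact/measurable_EFinP.
have f0E x : setT x -> (0 <= (EFin \o f) x)%E by move=> _; rewrite lee_fin.
pose g n : {nnsfun V >-> R} := nnsfun_approx measurableT mEf n.
have gf x : g n x @[n --> \oo] --> f x.
  by have := cvg_nnsfun_approx measurableT mEf f0E (x := x) I; move=> /fine_cvgP[].
have gle n x : g n x <= f x.
  have ndg : nondecreasing_seq (fun n => g n x).
    by move=> k l kl; have /lefP := nd_nnsfun_approx measurableT mEf kl; exact.
  rewrite -(cvg_lim _ (gf x))//; apply: nondecreasing_cvgn_le => //.
  by apply/cvg_ex; exists (f x).
apply: (osc_small_limit (g := fun n => g n) (G := fun x => f x ^+ 2)) => //.
move=> k x; have := gle k x; have : 0 <= g k x by exact: fun_ge0.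
nra.
Qed.

Let osc_small_L2 f : measurable_fun setT f ->
  mu.-integrable D (EFin \o (fun x => f x ^+ 2)) -> osc_small f.
Proof.
move=> mf if2.
have part (h : V -> R) : measurable_fun setT h -> (forall x, `|h x| <= `|f x|) ->
    (forall x, 0 <= h x) -> osc_small h.
  move=> mh hf h0; apply: osc_small_ge0 => //.
  apply: (le_box_integrable _ if2); first exact: measurable_funX.
  move=> x; rewrite normrX -(real_normK (num_real (f x))) lerXn2r ?nnegrE//.
pose fp x := Num.max (f x) 0; pose fm x := Num.max (- f x) 0.
have mfp : measurable_fun setT fp by exact: measurable_maxr.
have mfm : measurable_fun setT fm by apply: measurable_maxr => //; exact: measurable_funN.
rewrite (_ : f = (fun x => fp x + -1 * fm x)); last first.
  apply/funext => x; rewrite /fp /fm.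
  by case: (leP (f x) 0) => ?; case: (leP (- f x) 0) => ?; lra.
apply: osc_smallD => //; first exact: measurable_funM.
- apply: part => // x; rewrite /fp; last by rewrite le_max lexx orbT.
  by case: (leP (f x) 0) => // ?; rewrite normr0.
- apply: osc_small_scale => //; apply: part => // x; rewrite /fm.
    by case: (leP (- f x) 0) => // ?; rewrite ?normr0 ?normrN.
  by rewrite le_max lexx orbT.
Qed.

(** Jensen's inequality for the probability density [rho n (x - _)]. *)
Let convol_sub_sqr_le n f x : loc_integrable f -> loc_integrable (fun x => f x ^+ 2) ->
  (((convol f (rho n) x - f x) ^+ 2)%:E <=
   \int[mu]_y (rho n (x - y) * (f y - f x) ^+ 2)%:E)%E.
Proof.
move=> lf lf2.
have i0 : mu.-integrable setT (EFin \o (fun y => rho n (x - y))).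
  apply/integrableP; split; first exact/measurable_EFinP.
  under eq_integral do rewrite /= ger0_norm//.
  by rewrite rho_int1y ltry.
have i1 := convol_integrable x lf (@rho_cts n) (@rho_vanish n).
have i2 := convol_integrable x lf2 (@rho_cts n) (@rho_vanish n).
have e0 : \int[mu]_y rho n (x - y) = 1 by rewrite /Rintegral rho_int1y.
set m := convol f (rho n) x; pose A := convol (fun x => f x ^+ 2) (rho n) x.
have quad (c : R) :
    mu.-integrable setT (EFin \o (fun y => rho n (x - y) * (f y - c) ^+ 2)) /\
    \int[mu]_y (rho n (x - y) * (f y - c) ^+ 2) = A - 2 * c * m + c ^+ 2.
  have E : (fun y => rho n (x - y) * (f y - c) ^+ 2) = (fun y =>
      f y ^+ 2 * rho n (x - y) - 2 * c * (f y * rho n (x - y)) + c ^+ 2 * rho n (x - y)).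
    by apply/funext => y; ring.
  have j1 : mu.-integrable setT (EFin \o (fun y => 2 * c * (f y * rho n (x - y)))).
    exact: (integrableZl measurableT (2 * c) i1).
  have j0 : mu.-integrable setT (EFin \o (fun y => c ^+ 2 * rho n (x - y))).
    exact: (integrableZl measurableT (c ^+ 2) i0).
  have j2 : mu.-integrable setT (EFin \o (fun y => f y ^+ 2 * rho n (x - y) -
      2 * c * (f y * rho n (x - y)))).
    by have := integrableB measurableT i2 j1.
  rewrite E; split; first by have := integrableD measurableT j2 j0.
  rewrite RintegralD// RintegralB// RintegralZl// RintegralZl// e0 mulr1.
  by [].
(* The mean [m] minimizes the second moment: its value at [m] is the variance
   [A - m ^ 2], which is nonnegative. *)
have [ic vc] := quad (f x); have [_ vm] := quad m.
have Am : 0 <= A - 2 * m * m + m ^+ 2.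
  by rewrite -vm; apply: Rintegral_ge0 => y _; rewrite mulr_ge0// sqr_ge0.
rewrite -[leRHS]fineK; last exact: (integrable_fin_num measurableT ic).
rewrite lee_fin -/(Rintegral mu setT _) vc; nra.
Qed.

Lemma mollification_cvg f : loc_integrable f -> loc_integrable (fun x => f x ^+ 2) ->
  forall e : R, 0 < e ->
  \forall n \near \oo, (\int[mu]_(x in K) ((convol f (rho n) x - f x) ^+ 2)%:E <= e%:E)%E.
Proof.
move=> lf lf2 e e0; have mf := lf.1.
have := osc_small_L2 mf (lf2.2 (r + 1)) e0; apply: filterS => n.
apply: le_trans; rewrite -int_indicE//.
have mc : measurable_fun setT (convol f (rho n)).
  exact: continuous_measurable_rV (convol_cts lf (rho_classC n 1) (@rho_vanish n)).
have mE : measurable_fun setT (fun p : V * V => (W n p * (f p.2 - f p.1) ^+ 2)%:E).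
  by apply/measurable_EFinP; exact: mosc.
have E0 (p : V * V) : (0 <= (W n p * (f p.2 - f p.1) ^+ 2)%:E)%E.
  by rewrite lee_fin mulr_ge0// sqr_ge0.
rewrite /osc fubini_tonelli1//; apply: ge0_le_integral => //.
- by move=> x _; rewrite lee_fin mulr_ge0// sqr_ge0.
- apply/measurable_EFinP; apply: measurable_funM; first exact: mindic.
  by apply: measurable_funX; exact: measurable_funB.
- exact: (@measurable_fun_fubini_tonelli_F _ _ _ _ R mu _ mE E0).
move=> x _; rewrite /fubini_F /W /=.
have mg : measurable_fun setT (fun y => rho n (x - y) * (f y - f x) ^+ 2).
  by apply: measurable_funM => //; apply: measurable_funX; exact: measurable_funB.
under eq_integral do rewrite -mulrA EFinM.
rewrite ge0_integralZl_EFin//; last 2 first.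
- by move=> y _; rewrite lee_fin mulr_ge0// sqr_ge0.
- exact/measurable_EFinP.
by rewrite EFinM lee_wpmul2l ?lee_fin//; exact: convol_sub_sqr_le.
Qed.

End mollification.

(** * Approximation of functions in H^1_loc *)

Section H1_approximation.
Context {R : realType} {N : nat}.
Local Notation V := 'rV[R]_N.
Local Notation mu := (@lebesgue_rV R N).
Implicit Types (u : V -> R) (Du : V -> V).

Lemma L2loc_loc_integrable (f : V -> R) : L2loc setT f ->
  loc_integrable f /\ loc_integrable (fun x => f x ^+ 2).
Proof.
move=> [mf if2].
have mf2 : measurable_fun setT (fun x => f x ^+ 2) by exact: measurable_funX.
have i2 s : mu.-integrable (box s) (EFin \o (fun x => f x ^+ 2)).
  by apply: if2 => //; exact: compact_box.
split; split => // s.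
apply: (@le_box_integrable _ _ _ _ (fun x => 1 + f x ^+ 2)) => //.
  have i1 : mu.-integrable (box s) (EFin \o (fun=> 1)).
    by apply: (@bounded_box_integrable _ _ _ _ 1) => // x _; rewrite normr1.
  by have := integrableD (measurable_box s) i1 (i2 s).
by move=> x; rewrite -(real_normK (num_real (f x))); have := normr_ge0 (f x); nra.
Qed.

(** Choosing the scales so that the errors are summable gives at once almost
    everywhere convergence and an integrable bound for all the errors. *)
Lemma H1loc_approx (r : R) u Du : H1loc setT u Du ->
  exists (v : nat -> V -> R) (S : V -> R),
    [/\ forall n k, classC k setT (v n),
        mu.-integrable (box r) (EFin \o S) &
        {ae mu, forall x, box r x -> v n x @[n --> \oo] --> u x /\
          forall i, partial i (v n) x @[n --> \oo] --> Du x ord0 i /\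
            forall n, (partial i (v n) x - Du x ord0 i) ^+ 2 <= S x}].
Proof.
move=> [Lu LDu wD].
have [rho rhoP] := choice (@mollifier R N).
have rk n : forall k, classC k setT (rho n) by have [] := rhoP n.
have rv n : vanish_off n.+1%:R^-1 (rho n) by have [] := rhoP n.
(* [None] stands for [u] and [Some i] for the i-th partial derivative, so that
   one scale serves them all. *)
pose f (o : option 'I_N) : V -> R := if o is Some i then (fun x => Du x ord0 i) else u.
have lf o : loc_integrable (f o) /\ loc_integrable (fun x => f o x ^+ 2).
  by case: o => [i|]; apply: L2loc_loc_integrable; [exact: LDu|exact: Lu].
pose e (j : nat) : R := (1 / (2 ^ j.+1)%:R) / N.+1%:R.
have e0 j : 0 < e j by rewrite !divr_gt0// ltr0n expn_gt0.
have /choice[n nP] : forall j, exists n, forall o,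
    (\int[mu]_(x in box r) ((convol (f o) (rho n) x - f o x) ^+ 2)%:E <= (e j)%:E)%E.
  move=> j.
  have : \forall n \near \oo, forall o,
     (\int[mu]_(x in box r) ((convol (f o) (rho n) x - f o x) ^+ 2)%:E <= (e j)%:E)%E.
    apply: filter_forall => o; have [lo lo2] := lf o.
    by apply: mollification_cvg => // m; have [] := rhoP m.
  by move=> [m _ /(_ m (leqnn m))] ?; exists m.
have mc o j : measurable_fun setT (convol (f o) (rho (n j))).
  exact: continuous_measurable_rV (convol_cts (lf o).1 (rk (n j) 1) (@rv (n j))).
pose T j x : R := \sum_(o : option 'I_N) (convol (f o) (rho (n j)) x - f o x) ^+ 2.
have mT1 o j : measurable_fun setT (fun x => (convol (f o) (rho (n j)) x - f o x) ^+ 2).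
  by apply: measurable_funX; apply: measurable_funB => //; exact: (lf o).1.1.
have mT j : measurable_fun setT (T j) by apply: measurable_sum => o; exact: mT1.
have mTr j : measurable_fun (box r) (EFin \o T j).
  by apply/measurable_EFinP; exact: measurable_funTS.
have T0 j x : 0 <= T j x by apply: sumr_ge0 => o _; exact: sqr_ge0.
have T0E j x : box r x -> (0 <= (EFin \o T j) x)%E by rewrite lee_fin.
have intT j : (\int[mu]_(x in box r) (T j x)%:E <= (1 / (2 ^ j.+1)%:R)%:E)%E.
  under eq_integral do rewrite -sumEFin.
  rewrite ge0_integral_sum//; last 3 first.
  - exact: measurable_box.
  - by move=> o; apply/measurable_EFinP; exact: measurable_funTS.
  - by move=> o x _; rewrite lee_fin sqr_ge0.
  apply: (@le_trans _ _ (\sum_(o : option 'I_N) (e j)%:E)%E).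
    by apply: lee_sum => o _; exact: nP.
  rewrite sumEFin lee_fin sumr_const card_option card_ord -[leLHS]mulr_natr /e.
  by rewrite mulfVK.
pose TT x : \bar R := (\sum_(j <oo) (T j x)%:E)%E.
have TT0 x : (0 <= TT x)%E by apply: nneseries_ge0 => j _ _; rewrite lee_fin.
have mTT : measurable_fun (box r) TT.
  apply: (@ge0_emeasurable_sum _ _ _ (box r) (fun j x => (T j x)%:E) xpredT).
    by move=> j x _ _; rewrite lee_fin.
  by move=> j _; exact: mTr.
have iTT : mu.-integrable (box r) TT.
  apply/integrableP; split => //.
  under eq_integral => x _ do rewrite gee0_abs//.
  rewrite integral_nneseries//; last exact: measurable_box.
  apply: (@le_lt_trans _ _ 1%E); last exact: ltry.
  apply: (le_trans _ (epsilon_trick0 xpredT ler01)).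
  by apply: lee_nneseries => // j _ _; apply: integral_ge0 => x _; rewrite lee_fin.
exists (fun j => convol u (rho (n j))), (fine \o TT); split.
- by move=> j k; apply: (convol_classC k (lf None).1 (rk (n j)) (@rv (n j))).
- apply: (le_integrable _ _ _ iTT); first exact: measurable_box.
    by apply/measurable_EFinP; apply: measurableT_comp => //.
  move=> x _ /=; case: (TT x) (TT0 x) => [t||] //= _; rewrite ?normr0 ?lee_fin ?leey//.
- have := integrable_ae (measurable_box r) iTT; apply: filterS => x fx xr.
  have {fx}fx := fx xr.
  have TS j : T j x <= fine (TT x).
    rewrite -lee_fin fineK//.
    apply: (le_trans _ (nneseries_lim_ge j.+1 _)); last by move=> k _ _; rewrite lee_fin.
    rewrite big_nat_recr//= leeDr// sume_ge0// => k _; by rewrite lee_fin.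
  have Tc : T j x @[j --> \oo] --> 0.
    apply: cvg_series_cvg_0; apply: nondecreasing_is_cvgn.
      by apply/nondecreasing_series => k _ _.
    exists (fine (TT x)) => _ [k _ <-]; rewrite -lee_fin fineK// seriesEnat/= -sumEFin.
    by apply: nneseries_lim_ge => l _ _; rewrite lee_fin.
  have sqT o j : (convol (f o) (rho (n j)) x - f o x) ^+ 2 <= T j x.
    by rewrite /T (bigD1 o)//= lerDl sumr_ge0// => p _; exact: sqr_ge0.
  have cf o : convol (f o) (rho (n j)) x @[j --> \oo] --> f o x.
    apply/cvgrPdist_le => d d0; have d2 : 0 < d ^+ 2 by rewrite exprn_gt0.
    move/cvgrPdist_le : Tc => /(_ _ d2); apply: filterS => j.
    rewrite sub0r normrN ger0_norm// => Td.
    rewrite distrC -(ler_pXn2r (n := 2)) ?nnegrE ?(ltW d0)//.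
    by rewrite real_normK ?num_real// (le_trans (sqT _ _)).
  split; first exact: (cf None).
  move=> i.
  have E j : partial i (convol u (rho (n j))) x = convol (f (Some i)) (rho (n j)) x.
    exact: (weak_partial_convol x wD (lf None).1 (lf (Some i)).1 (rk (n j)) (@rv (n j))).
  split; first by under eq_cvg do rewrite E; exact: (cf (Some i)).
  by move=> j; rewrite E (le_trans (sqT (Some i) j)).
Qed.

End H1_approximation.

(** * Gradient and Hessian of a Finsler norm *)

Section quadratic_forms.
Context {R : realType} {N : nat}.
Local Notation V := 'rV[R]_N.

Definition quad (A : 'I_N -> 'I_N -> R) (w : V) : R :=
  \sum_(i < N) \sum_(j < N) A i j * w ord0 i * w ord0 j.

Lemma quad_kernel (A : 'I_N -> 'I_N -> R) (k w : V) (c : R) :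
  (forall i, \sum_(j < N) k ord0 j * A i j = 0) ->
  (forall j, \sum_(i < N) k ord0 i * A i j = 0) ->
  quad A (c *: k + w) = quad A w.
Proof.
move=> Akr Akl.
transitivity (quad A w + (\sum_(i < N) (c * w ord0 i + c ^+ 2 * k ord0 i) *
     (\sum_(j < N) k ord0 j * A i j) +
   \sum_(j < N) c * w ord0 j * (\sum_(i < N) k ord0 i * A i j))); last first.
  rewrite (eq_bigr (fun=> 0)) => [|i _]; last by rewrite Akr mulr0.
  rewrite [X in _ + (_ + X)](eq_bigr (fun=> 0)) => [|i _]; last by rewrite Akl mulr0.
  by rewrite !sumr_const !mul0rn !addr0.
under [X in _ + (X + _)]eq_bigr do rewrite mulr_sumr.
under [X in _ + (_ + X)]eq_bigr do rewrite mulr_sumr.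
rewrite [X in _ + (_ + X)]exchange_big -!big_split /=; apply: eq_bigr => i _.
by rewrite -!big_split /=; apply: eq_bigr => j _; rewrite !mxE; ring.
Qed.

(** Where the limit of the difference quotients fails to exist, ['D_v f x] is
    [0], and the bound holds trivially. *)
Lemma derive_bound (f : V -> R) (x v : V) (M : R) : 0 <= M ->
  (forall h : R, `|f (h *: v + x) - f x| <= `|h| * M) -> `|'D_v f x| <= M.
Proof.
move=> M0 fM; rewrite /derive.
have [qc|qd] := pselect (cvg ((fun h => h^-1 *: ((f \o shift x) (h *: v) - f x)) @ 0^')).
  have qM : \forall h \near 0^', `|h^-1 *: ((f \o shift x) (h *: v) - f x)| <= M.
    near=> h; have h0 : h != 0 by near: h; exact: nbhs_dnbhs_neq.
    rewrite normrM normfV ler_pdivrMl ?normr_gt0//.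
    exact: fM.
  rewrite ler_norml; apply/andP; split; [apply: limr_ge|apply: limr_le] => //.
    by apply: filterS qM => h; rewrite ler_norml => /andP[].
  by apply: filterS qM => h; rewrite ler_norml => /andP[].
rewrite (_ : lim _ = 0) ?normr0//.
exact: (dvgP qd).
Unshelve. all: by end_near. Qed.

Lemma partial_homogeneous (f : V -> R) (x : V) (t c : R) i :
  (forall y, f (t *: y) = c * f y) ->
  derivable f x (delta_mx ord0 i) -> derivable f (t *: x) (delta_mx ord0 i) ->
  t * partial i f (t *: x) = c * partial i f x.
Proof.
move=> fh /derivableP fx /derivableP ftx.
have D1 : is_derive x (delta_mx ord0 i) (fun y => f (t *: y + 0)) (t * partial i f (t *: x)).
  by apply: is_derive_affine; rewrite addr0.
have D2 : is_derive x (delta_mx ord0 i) (fun y => c *: f y) (c *: partial i f x).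
  exact: is_deriveZ.
rewrite -(partial_val D1); apply: partial_val.
by rewrite (_ : (fun y => _) = (fun y => c *: f y))//; apply/funext => y; rewrite addr0 fh.
Qed.

End quadratic_forms.

Section finsler_norm.
Context {R : realType} {N : nat}.
Local Notation V := 'rV[R]_N.
Variable F : V -> R.
Hypothesis F_ge0 : forall xi : V, 0 <= F xi.
Hypothesis F_convex : @convex_function R V setT F.
Hypothesis F_C2 : classC 2 [set xi : V | xi != 0] F.
Hypothesis F_homogeneous : forall (t : R) (xi : V), F (t *: xi) = `|t| * F xi.
Variables (b lambda Lambda : R).
Hypothesis b_gt0 : 0 < b.
Hypothesis F_le : forall xi : V, F xi <= b * enorm xi.
Hypothesis Lambda_gt0 : 0 < Lambda.
Hypothesis F_elliptic : forall xi W : V, enorm xi = 1 -> dotp W xi = 0 ->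
  lambda ^+ 2 * enorm W ^+ 2 <=
    \sum_(i < N) \sum_(j < N) partial j (partial i F) xi * W ord0 i * W ord0 j
  <= Lambda * enorm W ^+ 2.

Lemma finsler0 : F 0 = 0.
Proof. by rewrite -(scale0r 0) F_homogeneous normr0 mul0r. Qed.

Let F_sub (x y : V) : F (x + y) <= F x + F y.
Proof.
have h0 : 0 <= 2^-1 :> R by lra.
have h1 : 2^-1 <= 1 :> R by lra.
pose t : {i01 R} := Itv01 h0 h1.
have h : F (2^-1 *: (2 *: x) + (1 - 2^-1) *: (2 *: y)) <=
    2^-1 * F (2 *: x) + (1 - 2^-1) * F (2 *: y).
  exact: (F_convex t (mem_set I) (mem_set I)).
have e2 : 1 - 2^-1 = 2^-1 :> R by lra.
have E (z : V) : 2^-1 *: (2 *: z) = z.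
  by rewrite scalerA mulVf ?scale1r.
move: h; rewrite e2 !E !F_homogeneous ger0_norm// => h.
by apply: (le_trans h); lra.
Qed.

Let enorm_delta (i : 'I_N) : enorm (delta_mx ord0 i : V) = 1.
Proof.
rewrite /enorm /dotp (bigD1 i)//= big1 => [|j ji]; last first.
  by rewrite mxE (negbTE ji) andbF mul0r.
by rewrite mxE !eqxx mul1r addr0 sqrtr1.
Qed.

(** [F] is subadditive, being convex and homogeneous, so it is Lipschitz with
    constant [b] along the coordinate axes, and this bound includes the
    origin. *)
Lemma finsler_partial_le (xi : V) i : `|partial i F xi| <= b.
Proof.
apply: derive_bound; first exact: ltW.
move=> h; have Fh : F (h *: delta_mx ord0 i) <= `|h| * b.
  rewrite F_homogeneous ler_wpM2l// (le_trans (F_le _))//.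
  by rewrite enorm_delta mulr1.
rewrite ler_norml; apply/andP; split; last first.
  by rewrite lerBlDr (le_trans (F_sub _ _))// lerD2r.
have := F_sub (- h *: delta_mx ord0 i) (h *: delta_mx ord0 i + xi).
rewrite [_ *: _ + (_ + _)]addrA scaleNr addNr add0r -scaleNr.
rewrite [F (- h *: _)]F_homogeneous normrN -(F_homogeneous h); lra.
Qed.

Let F_derivable (xi : V) i : xi != 0 -> derivable F xi (delta_mx ord0 i).
Proof. by move=> x0; have [_ /(_ i)[+ _]] := F_C2; apply. Qed.

Let pF_cts (xi : V) i : xi != 0 -> {for xi, continuous (partial i F)}.
Proof. by move=> x0; have [_ /(_ i)[_ [+ _]]] := F_C2; apply. Qed.

Let pF_derivable (xi : V) i j : xi != 0 -> derivable (partial i F) xi (delta_mx ord0 j).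
Proof. by move=> x0; have [_ /(_ i)[_ [_ /(_ j)[+ _]]]] := F_C2; apply. Qed.

Let H_cts (xi : V) i j : xi != 0 -> {for xi, continuous (partial j (partial i F))}.
Proof. by move=> x0; have [_ /(_ i)[_ [_ /(_ j)[_ +]]]] := F_C2; apply. Qed.

Lemma measurable_finsler : measurable_fun setT F.
Proof. by apply: (@measurable_continuous_off _ _ _ 0) => x x0; have [+ _] := F_C2; apply. Qed.

Lemma measurable_finsler_partial i : measurable_fun setT (partial i F).
Proof. by apply: (@measurable_continuous_off _ _ _ 0) => x; exact: pF_cts. Qed.

Lemma measurable_finsler_hessian i j : measurable_fun setT (partial j (partial i F)).
Proof. by apply: (@measurable_continuous_off _ _ _ 0) => x; exact: H_cts. Qed.

Let neq0_nbhs (xi : V) : xi != 0 -> \forall y \near xi, y != 0.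
Proof.
rewrite -normr_gt0 => x0; near=> y; rewrite -normr_gt0; near: y.
exact: (cvgr_gt `|xi| (@norm_continuous _ _ xi)).
Unshelve. all: by end_near. Qed.

Let homogeneous1 (G : V -> R) (xi : V) (d : R) :
  (forall h : R, `|h| < 1 -> G (h *: xi + xi) = G xi + h * d) ->
  is_derive xi xi G d.
Proof.
move=> Gh; apply: is_derive_eps => e e0; exists 1 => // h h1.
by rewrite Gh// [G xi + _]addrC addrK subrr normr0 mulr_ge0// ltW.
Qed.

(** [F] is linear along the ray through [xi]. *)
Lemma finsler_euler (xi : V) : \sum_(i < N) xi ord0 i * partial i F xi = F xi.
Proof.
have [->|x0] := eqVneq xi 0.
  by rewrite finsler0 big1// => i _; rewrite mxE mul0r.
have D : is_derive xi xi F (\sum_(i < N) xi ord0 i * partial i F xi).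
  apply: is_derive_C1 => [|i]; last exact: pF_cts.
  by apply: filterS (neq0_nbhs x0) => y y0 i; exact: F_derivable.
have D' : is_derive xi xi F (F xi).
  apply: homogeneous1 => // h h1; rewrite -{2}[xi]scale1r -scalerDl F_homogeneous.
  by rewrite ger0_norm ?mulrDl ?mul1r 1?addrC//; move: h1; rewrite ltr_norml; lra.
by rewrite -(derive_val (is_derive := D)) (derive_val (is_derive := D')).
Qed.

Let partial_finsler_pos (t : R) (y : V) i : 0 < t -> partial i F (t *: y) = partial i F y.
Proof.
move=> t0; have [->|y0] := eqVneq y 0; first by rewrite scaler0.
have ty0 : t *: y != 0 by rewrite scaler_eq0 negb_or gt_eqF.
have Ft z : F (t *: z) = t * F z by rewrite F_homogeneous gtr0_norm.
have := partial_homogeneous Ft (F_derivable y0) (F_derivable ty0).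
by move=> /(_ i)/mulfI; apply; rewrite gt_eqF.
Qed.

(** The gradient of [F] is constant along the ray through [xi]. *)
Lemma hessian_kernel_right (xi : V) i : xi != 0 ->
  \sum_(j < N) xi ord0 j * partial j (partial i F) xi = 0.
Proof.
move=> x0.
have D : is_derive xi xi (partial i F) (\sum_(j < N) xi ord0 j * partial j (partial i F) xi).
  apply: is_derive_C1 => [|j]; last exact: H_cts.
  by apply: filterS (neq0_nbhs x0) => y y0 j; exact: pF_derivable.
have D' : is_derive xi xi (partial i F) 0.
  apply: homogeneous1 => // h h1; rewrite -{2}[xi]scale1r -scalerDl mulr0 addr0.
  by rewrite partial_finsler_pos//; move: h1; rewrite ltr_norml; lra.
by rewrite -(derive_val (is_derive := D)) (derive_val (is_derive := D')).
Qed.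

(** Differentiating Euler's identity avoids an appeal to the symmetry of the
    second derivatives. *)
Lemma hessian_kernel_left (xi : V) j : xi != 0 ->
  \sum_(i < N) xi ord0 i * partial j (partial i F) xi = 0.
Proof.
move=> x0.
have DF : is_derive xi (delta_mx ord0 j) F (partial j F xi).
  exact/derivableP/F_derivable.
have D i : is_derive xi (delta_mx ord0 j) (fun y : V => y ord0 i * partial i F y)
    (xi ord0 i * partial j (partial i F) xi + partial i F xi * (i == j)%:R).
  apply: is_deriveM; last exact/derivableP/pF_derivable.
  apply: is_derive_eps => e e0; exists 1 => // h _.
  by rewrite !mxE eqxx/= addrK subrr normr0 mulr_ge0// ltW.
have DS : is_derive xi (delta_mx ord0 j) (\sum_(i < N) (fun y : V => y ord0 i * partial i F y))
   (\sum_(i < N) (xi ord0 i * partial j (partial i F) xi + partial i F xi * (i == j)%:R)).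
  exact: is_derive_sum.
move: DS; rewrite (_ : \sum_(i < N) _ = F); last first.
  by apply/funext => y; rewrite fct_sumE finsler_euler.
rewrite big_split/= [X in _ + X](bigD1 j)//= eqxx mulr1 [X in _ + (_ + X)]big1; last first.
  by move=> i ij; rewrite (negbTE ij) mulr0.
rewrite addr0 => DS; have := derive_val (is_derive := DS).
by rewrite (derive_val (is_derive := DF)) => /eqP; rewrite -subr_eq subrr eq_sym => /eqP.
Qed.

Lemma finsler_quad_shift (xi : V) (c : R) (w : V) :
  F xi * quad (fun i j => partial j (partial i F) xi) (c *: xi + w) =
  F xi * quad (fun i j => partial j (partial i F) xi) w.
Proof.
have [->|x0] := eqVneq xi 0; first by rewrite finsler0 !mul0r.
congr (_ * _); apply: quad_kernel => i.
  exact: hessian_kernel_right.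
exact: hessian_kernel_left.
Qed.

(** [F] times its Hessian is homogeneous of degree [0], which reduces to unit
    vectors [z]; there the component of [w] along [z] drops out, and the
    ellipticity condition applies to the orthogonal component. *)
Lemma finsler_quad_bounds (xi w : V) :
  0 <= F xi * quad (fun i j => partial j (partial i F) xi) w <= b * Lambda * dotp w w.
Proof.
have [->|x0] := eqVneq xi 0.
  by rewrite finsler0 mul0r lexx !mulr_ge0 ?dotp_ge0 ?ltW.
have dx0 : 0 < dotp xi xi.
  rewrite lt_neqAle dotp_ge0 andbT eq_sym; apply: contraNneq x0 => d0.
  apply/eqP/rowP => i; rewrite mxE; apply/eqP.
  by rewrite -sqrf_eq0 eq_le sqr_ge0 andbT -d0 sqr_coord_le_dotp.
pose t := enorm xi; have t0 : 0 < t by rewrite sqrtr_gt0.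
have t2 : t ^+ 2 = dotp xi xi by rewrite sqr_sqrtr// ltW.
pose z : V := t^-1 *: xi; have tz : t *: z = xi by rewrite scalerA divff ?gt_eqF// scale1r.
have z0 : z != 0 by rewrite scaler_eq0 negb_or x0 invr_eq0 gt_eqF.
have dotpZ (c : R) (x y : V) : dotp (c *: x) y = c * dotp x y.
  by rewrite mulr_sumr; apply: eq_bigr => i _; rewrite mxE mulrA.
have dotpC (x y : V) : dotp x y = dotp y x by apply: eq_bigr => i _; rewrite mulrC.
have dotpD (x y v : V) : dotp (x + y) v = dotp x v + dotp y v.
  by rewrite -big_split; apply: eq_bigr => i _; rewrite mxE mulrDl.
have zz : dotp z z = 1.
  have tn0 : t != 0 by rewrite gt_eqF.
  by rewrite /z dotpZ dotpC dotpZ -t2; field.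
clearbody z.
have ez : enorm z = 1 by rewrite /enorm zz sqrtr1.
have Hz i j : t * partial j (partial i F) xi = partial j (partial i F) z.
  have := partial_homogeneous (f := partial i F) (x := z) (t := t) (c := 1) (i := j).
  rewrite tz mul1r; apply.
  - by move=> y; rewrite mul1r partial_finsler_pos.
  - exact: pF_derivable.
  - exact: pF_derivable.
have -> : F xi * quad (fun i j => partial j (partial i F) xi) w =
    F z * quad (fun i j => partial j (partial i F) z) w.
  have G (q1 q2 : R) : t * q1 = q2 -> F xi * q1 = F z * q2.
    by move=> <-; rewrite -tz F_homogeneous gtr0_norm// [t * F z]mulrC mulrA.
  apply: G.
  rewrite mulr_sumr; apply: eq_bigr => i _; rewrite mulr_sumr.
  by apply: eq_bigr => j _; rewrite -Hz !mulrA.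
pose s : R := dotp w z; pose W : V := w - s *: z.
have Wz : dotp W z = 0.
  by rewrite /W dotpD -scaleN1r !dotpZ zz mulr1 mulN1r subrr.
have -> : w = s *: z + W by rewrite addrC subrK.
rewrite finsler_quad_shift.
have dW : dotp (s *: z + W) (s *: z + W) = s ^+ 2 + dotp W W.
  rewrite dotpD dotpZ [dotp z _]dotpC dotpD dotpZ zz mulr1 Wz addr0.
  by rewrite [dotp W _]dotpC dotpD dotpZ [dotp z W]dotpC Wz mulr0 add0r expr2.
have := F_elliptic ez Wz; rewrite -/(quad _ W) => /andP[Ql Qu].
have eW : enorm W ^+ 2 = dotp W W by rewrite sqr_sqrtr ?dotp_ge0.
rewrite eW in Ql Qu.
have Q0 := le_trans (mulr_ge0 (sqr_ge0 lambda) (dotp_ge0 W)) Ql.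
rewrite mulr_ge0//= -mulrA ler_pM//.
  by rewrite (le_trans (F_le z))// ez mulr1.
by rewrite (le_trans Qu)// ler_wpM2l ?(ltW Lambda_gt0)// dW lerDr sqr_ge0.
Qed.

End finsler_norm.

(** * Stability and equation for nonsmooth test functions *)

Section limits.
Context {R : realType} {N : nat}.
Local Notation V := 'rV[R]_N.
Local Notation mu := (@lebesgue_rV R N).

Lemma sqr_sum_le (a : 'I_N -> R) :
  (\sum_(i < N) a i) ^+ 2 <= N%:R * \sum_(i < N) a i ^+ 2.
Proof.
rewrite expr2 mulr_suml.
apply: (@le_trans _ _ (\sum_(i < N) \sum_(j < N) (a i ^+ 2 + a j ^+ 2) / 2)).
  apply: ler_sum => i _; rewrite mulr_sumr; apply: ler_sum => j _.
  by have := sqr_ge0 (a i - a j); nra.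
under eq_bigr do rewrite -mulr_suml big_split/= sumr_const card_ord.
rewrite -mulr_suml big_split/= sumr_const card_ord sumrMnl.
rewrite -[_ *+ N]mulr_natl; set S := N%:R * _; lra.
Qed.

Lemma sqr_pairing_le (p : 'I_N -> R) (q : V) (b : R) : (forall i, `|p i| <= b) ->
  (\sum_(i < N) p i * q ord0 i) ^+ 2 <= N%:R * b ^+ 2 * dotp q q.
Proof.
move=> pb; apply: (le_trans (sqr_sum_le _)); rewrite -mulrA ler_wpM2l// mulr_sumr.
apply: ler_sum => i _; rewrite exprMn -expr2 ler_wpM2r ?sqr_ge0//.
rewrite -(real_normK (num_real (p i))) lerXn2r ?nnegrE//.
exact: le_trans (normr_ge0 _) (pb i).
Qed.

Lemma dominated_Rintegral (D : set V) (J : nat -> V -> R) (J0 G : V -> R) :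
  measurable D -> (forall n, measurable_fun setT (J n)) -> measurable_fun setT J0 ->
  {ae mu, forall x, D x -> J n x @[n --> \oo] --> J0 x} ->
  mu.-integrable D (EFin \o G) ->
  {ae mu, forall x, D x -> forall n, `|J n x| <= G x} ->
  [/\ mu.-integrable D (EFin \o J0), forall n, mu.-integrable D (EFin \o J n) &
    \int[mu]_(x in D) J n x @[n --> \oo] --> \int[mu]_(x in D) J0 x].
Proof.
move=> mD mJ mJ0 JJ iG JG.
have mJE n : measurable_fun D (EFin \o J n).
  by apply/measurable_EFinP; exact: measurable_funTS.
have mJ0E : measurable_fun D (EFin \o J0).
  by apply/measurable_EFinP; exact: measurable_funTS.
have [||iJ0 _ cJ] := @dominated_convergence _ _ _ mu D mD (fun n => EFin \o J n)
    (EFin \o J0) (EFin \o G) mJE mJ0E _ iG.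
- by apply: filterS JJ => x h Dx; apply: cvg_EFin; [exact: nearW|exact: h].
- by apply: filterS JG => x h n Dx; rewrite lee_fin; exact: h.
have iJ n : mu.-integrable D (EFin \o J n).
  apply/integrableP; split => //.
  apply: (@le_lt_trans _ _ (\int[mu]_(x in D) `|(EFin \o G) x|)%E); last first.
    by case/integrableP : iG.
  apply: ae_ge0_le_integral => //.
  - exact: measurableT_comp.
  - by apply: measurableT_comp => //; case/integrableP : iG.
  - by apply: filterS JG => x h Dx; rewrite lee_fin (le_trans (h Dx n))// ler_norm.
split => //; apply: fine_cvg; rewrite fineK//.
exact: (integrable_fin_num mD iJ0).
Qed.

End limits.

Section test_functions.
Context {R : realType} {N : nat}.
Local Notation V := 'rV[R]_N.
Local Notation mu := (@lebesgue_rV R N).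
Variables (u : V -> R) (Du : V -> V).
Hypothesis uH1 : H1loc setT u Du.

Variables (P : nat -> R -> R) (chi : V -> R) (r B : R).
Hypothesis P_smooth : smooth_family P.
Hypothesis P0_le : forall t, `|P 0 t| <= B.
Hypothesis P1_le : forall t, `|P 1 t| <= B.
Hypothesis chi_smooth : forall k, classC k setT chi.
Hypothesis chi_vanish : vanish_off r chi.

(** The gradient of [P 0 (u x) * chi x], by the chain rule. *)
Definition test_grad (x : V) : V :=
  \row_i (P 1 (u x) * chi x * Du x ord0 i + P 0 (u x) * partial i chi x).

(** The approximations are [P 0 (v n x) * chi x] with [v n] smooth and tending to
    [u]. The function [G] dominates the squared norms of their gradients. *)
Lemma test_function_approx : exists (phi : nat -> V -> R) (G : V -> R) (M : R),
  [/\ forall n k, classC k setT (phi n),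
      forall n, vanish_off r (phi n),
      forall n x, `|phi n x| <= M,
      mu.-integrable (box r) (EFin \o G) &
      {ae mu, forall x, box r x ->
        [/\ phi n x @[n --> \oo] --> P 0 (u x) * chi x,
            forall i, partial i (phi n) x @[n --> \oo] --> test_grad x ord0 i &
            forall n, dotp (grad (phi n) x) (grad (phi n) x) <= G x]}].
Proof.
have [v [S [vk iS vS]]] := H1loc_approx r uH1.
have [Lu LDu _] := uH1.
have B0 : 0 <= B := le_trans (normr_ge0 _) (P0_le 0).
have cc : continuous chi by move=> x; exact: (classC_cts (chi_smooth 0)).
have cd i : continuous (partial i chi).
  have d0 : classC 0 setT (partial i chi) by exact: ((chi_smooth 1).2 i).2.
  by move=> x; exact: (classC_cts d0).
have [C C0 chiC] := vanish_bounded cc chi_vanish.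
have /choice[C' C'P] : forall i, exists M : R, 0 <= M /\ forall x, `|partial i chi x| <= M.
  move=> i; have [M M0 MP] := vanish_bounded (cd i) (vanish_partial i chi_vanish).
  by exists M.
pose phi n x := P 0 (v n x) * chi x.
pose G x := \sum_(i < N) (4 * (B * C) ^+ 2 * (Du x ord0 i ^+ 2 + S x) +
                          2 * (B * C' i) ^+ 2).
have phid n i x : partial i (phi n) x =
    P 1 (v n x) * chi x * partial i (v n) x + P 0 (v n x) * partial i chi x.
  have Dv := is_derive_comp1 (P_smooth 0 (v n x)) (classC_is_derive x i (vk n 1)).
  have Dc := classC_is_derive x i (chi_smooth 1).
  rewrite (partial_val (is_deriveM Dv Dc)) addrC; congr (_ + _).
  by rewrite [LHS]mulrC mulrAC.
exists phi, G, (B * C); split.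
- by move=> n k; apply: classCM => //; exact: (classC_comp 0 P_smooth).
- by move=> n x xr; rewrite /phi chi_vanish// mulr0.
- by move=> n x; rewrite normrM ler_pM.
- have iDu i := (L2loc_loc_integrable (LDu i)).2.
  apply: box_integrable_sum => i; apply: box_integrableD; last exact: box_integrable_cst.
  by apply: box_integrableZ; apply: box_integrableD => //; exact: (iDu i).2.
- apply: filterS vS => x h xr; have {h}[vu h] := h xr.
  have cP j : P j (v n x) @[n --> \oo] --> P j (u x).
    apply: (cvg_comp (fun n => v n x) (P j) vu).
    exact: (@smooth_family_cts _ P j P_smooth (u x)).
  split.
  + by apply: cvgM => //; exact: cvg_cst.
  + move=> i; under eq_cvg do rewrite phid; rewrite mxE.
    apply: cvgD; apply: cvgM; do ?exact: cP; do ?exact: cvg_cst.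
      by apply: cvgM; [exact: cP | exact: cvg_cst].
    exact: (h i).1.
  + move=> n; apply: ler_sum => i _; rewrite -expr2 mxE phid.
    have := (h i).2 n; set d := partial i (v n) x; set e := Du x ord0 i => dS.
    have aB := P1_le (v n x); have bB := P0_le (v n x).
    have cC := chiC x; have c'C := (C'P i).2 x.
    have X : (P 1 (v n x) * chi x) ^+ 2 <= (B * C) ^+ 2.
      rewrite -(real_normK (num_real (_ * _))) lerXn2r ?nnegrE ?mulr_ge0//.
      by rewrite normrM ler_pM.
    have Y : (P 0 (v n x) * partial i chi x) ^+ 2 <= (B * C' i) ^+ 2.
      rewrite -(real_normK (num_real (_ * _))) lerXn2r ?nnegrE ?mulr_ge0//.
        exact: (C'P i).1.
      by rewrite normrM ler_pM.
    have dd : d ^+ 2 <= 2 * (e ^+ 2 + S x).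
      by have := sqr_ge0 (d - 2 * e); nra.
    set p := P 1 _ * chi x in X *; set q := P 0 _ * _ in Y *.
    have pd : (p * d) ^+ 2 <= 2 * (B * C) ^+ 2 * (e ^+ 2 + S x).
      rewrite exprMn (le_trans (ler_pM _ _ X dd)) ?sqr_ge0//.
      by rewrite mulrA [_ * 2]mulrC.
    have := sqr_ge0 (p * d - q); nra.
Qed.

End test_functions.

Section limit_inequalities.
Context {R : realType} {N : nat}.
Local Notation V := 'rV[R]_N.
Local Notation mu := (@lebesgue_rV R N).
Variables (F : V -> R) (b K : R).
Hypothesis K_ge0 : 0 <= K.
Hypothesis F_ge0 : forall xi : V, 0 <= F xi.
Hypothesis F_le : forall xi : V, F xi <= b * enorm xi.
Hypothesis dF_le : forall (xi : V) i, `|partial i F xi| <= b.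
Hypothesis Hess_bounds : forall xi w : V,
  0 <= F xi * quad (fun i j => partial j (partial i F) xi) w <= K * dotp w w.
Hypothesis mF : measurable_fun setT F.
Hypothesis mdF : forall i, measurable_fun setT (partial i F).
Hypothesis mHF : forall i j, measurable_fun setT (partial j (partial i F)).

Variables (u : V -> R) (Du : V -> V).
Hypothesis uH1 : H1loc setT u Du.
Hypothesis expu : L1loc setT (fun x => expR (u x)).

Let dir (xi q : V) : R := \sum_(i < N) partial i F xi * q ord0 i.

(** The integrands of the stability condition and of the equation, as functions
    of [xi = Du], of the exponential [e = e^u], and of the test function with
    value [t] and gradient [q]. *)
Definition stab_form (xi q : V) (e t : R) : R :=
  dir xi q ^+ 2 + F xi * quad (fun i j => partial j (partial i F) xi) q - e * t ^+ 2.

Definition flux_form (xi q : V) (e t : R) : R := F xi * dir xi q - e * t.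

Lemma stability_integrandE phi x :
  stability_integrand F expR u Du phi x =
  stab_form (Du x) (grad phi x) (expR (u x)) (phi x).
Proof.
rewrite /stability_integrand /stab_form; congr (_ + _ - _ * _).
- rewrite /dir expr2 big_distrlr /=; apply: eq_bigr => i _; apply: eq_bigr => j _.
  by rewrite !mxE mulrACA !mulrA.
- rewrite mulr_sumr; apply: eq_bigr => i _; rewrite mulr_sumr.
  by apply: eq_bigr => j _; rewrite !mxE !mulrA.
- by rewrite derive1E derive_val.
Qed.

Let dir_sqr_le xi q : dir xi q ^+ 2 <= N%:R * b ^+ 2 * dotp q q.
Proof. exact: sqr_pairing_le. Qed.

Let mDu : measurable_fun setT Du.
Proof.
apply: measurable_fun_rV => i; have [_ LDu _] := uH1.
by have [] := LDu i.
Qed.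

Let mu_ : measurable_fun setT u. Proof. by have [[]] := uH1. Qed.

Let mexpu : measurable_fun setT (fun x => expR (u x)). Proof. by have [] := expu. Qed.

Let mdir (q : V -> V) : (forall i, measurable_fun setT (fun x => q x ord0 i)) ->
  measurable_fun setT (fun x => dir (Du x) (q x)).
Proof.
move=> mq; apply: measurable_sum => i; apply: measurable_funM => //.
exact: (measurableT_comp (mdF i) mDu).
Qed.

Lemma measurable_stab_form (q : V -> V) (t : V -> R) :
  (forall i, measurable_fun setT (fun x => q x ord0 i)) -> measurable_fun setT t ->
  measurable_fun setT (fun x => stab_form (Du x) (q x) (expR (u x)) (t x)).
Proof.
move=> mq mt; apply: measurable_funB; last first.
  by apply: measurable_funM => //; exact: measurable_funX.
apply: measurable_funD; first by apply: measurable_funX; exact: mdir.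
apply: measurable_funM; first exact: (measurableT_comp mF mDu).
apply: measurable_sum => i; apply: measurable_sum => j.
apply: measurable_funM => //; apply: measurable_funM => //.
exact: (measurableT_comp (mHF i j) mDu).
Qed.

Lemma measurable_flux_form (q : V -> V) (t : V -> R) :
  (forall i, measurable_fun setT (fun x => q x ord0 i)) -> measurable_fun setT t ->
  measurable_fun setT (fun x => flux_form (Du x) (q x) (expR (u x)) (t x)).
Proof.
move=> mq mt; apply: measurable_funB; last exact: measurable_funM.
apply: measurable_funM; first exact: (measurableT_comp mF mDu).
exact: mdir.
Qed.

Variables (P : nat -> R -> R) (chi : V -> R) (r B : R).
Hypothesis P_smooth : smooth_family P.
Hypothesis P0_le : forall t, `|P 0 t| <= B.
Hypothesis P1_le : forall t, `|P 1 t| <= B.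
Hypothesis chi_smooth : forall k, classC k setT chi.
Hypothesis chi_vanish : vanish_off r chi.

Let q : V -> V := test_grad u Du P chi.
Let t (x : V) : R := P 0 (u x) * chi x.

Let mP j : measurable_fun setT (fun x => P j (u x)).
Proof.
apply: (measurableT_comp _ mu_); apply: continuous_measurable_fun.
exact: smooth_family_cts.
Qed.

Let mt : measurable_fun setT t.
Proof.
apply: measurable_funM => //; apply: continuous_measurable_rV => x.
exact: (classC_cts (chi_smooth 0)).
Qed.

Let mq i : measurable_fun setT (fun x => q x ord0 i).
Proof.
rewrite (_ : (fun _ => _) = (fun x => P 1 (u x) * chi x * Du x ord0 i +
    P 0 (u x) * partial i chi x)); last by apply/funext => x; rewrite mxE.
have mc : measurable_fun setT chi.
  by apply: continuous_measurable_rV => x; exact: (classC_cts (chi_smooth 0)).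
have mdc : measurable_fun setT (partial i chi).
  have d0 : classC 0 setT (partial i chi) by exact: ((chi_smooth 1).2 i).2.
  by apply: continuous_measurable_rV => x; exact: (classC_cts d0).
apply: measurable_funD; apply: measurable_funM => //.
  by apply: measurable_funM.
by have [_ LDu _] := uH1; have [] := LDu i.
Qed.

Let mgrad (phi : V -> R) i : (forall k, classC k setT phi) ->
  measurable_fun setT (fun x => grad phi x ord0 i).
Proof.
move=> pk; rewrite (_ : (fun _ => _) = partial i phi); last first.
  by apply/funext => x; rewrite mxE.
have d0 : classC 0 setT (partial i phi) by exact: ((pk 1).2 i).2.
by apply: continuous_measurable_rV => x; exact: (classC_cts d0).
Qed.

Let iexpu : mu.-integrable (box r) (EFin \o (fun x => expR (u x))).
Proof. by apply: expu.2 => //; exact: compact_box. Qed.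

Let cvg_sum (a : nat -> 'I_N -> R) (l : 'I_N -> R) :
  (forall i, a n i @[n --> \oo] --> l i) ->
  \sum_(i < N) a n i @[n --> \oo] --> \sum_(i < N) l i.
Proof.
move=> al; elim: (index_enum _) => [|i s IH].
  by under eq_cvg do rewrite big_nil; rewrite big_nil; exact: cvg_cst.
by under eq_cvg do rewrite big_cons; rewrite big_cons; exact: cvgD.
Qed.

Let cvg_dir (p : nat -> V) (p0 xi : V) :
  (forall i, p n ord0 i @[n --> \oo] --> p0 ord0 i) ->
  dir xi (p n) @[n --> \oo] --> dir xi p0.
Proof.
move=> pc; apply: cvg_sum => i; apply: cvgM => //; exact: cvg_cst.
Qed.

(** Both gradient terms are quadratic in the gradient of the test function, with
    coefficients bounded independently of [Du]; they are dominated by [G], and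
    the exponential term by a multiple of [e^u]. *)
Lemma stability_limit : stable F expR setT u Du ->
  mu.-integrable (box r) (EFin \o (fun x => stab_form (Du x) (q x) (expR (u x)) (t x))) /\
  0 <= \int[mu]_(x in box r) stab_form (Du x) (q x) (expR (u x)) (t x).
Proof.
move=> [_ st].
have [phi [G [M [phik phiv phiM iG phiP]]]] :=
  test_function_approx uH1 P_smooth P0_le P1_le chi_smooth chi_vanish.
pose J n x := stab_form (Du x) (grad (phi n) x) (expR (u x)) (phi n x).
pose C := N%:R * b ^+ 2 + K.
have mJ n : measurable_fun setT (J n).
  apply: measurable_stab_form => [i|]; first exact: mgrad.
  by apply: continuous_measurable_rV => x; exact: (classC_cts (phik n 0)).
have [|||iJ0 iJ cJ] := @dominated_Rintegral _ _ (box r) J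
    (fun x => stab_form (Du x) (q x) (expR (u x)) (t x))
    (fun x => C * G x + M ^+ 2 * expR (u x)) (measurable_box r) mJ
    (measurable_stab_form mq mt).
- apply: filterS phiP => x h xr; have {h}[pc dc _] := h xr.
  have gc i : grad (phi n) x ord0 i @[n --> \oo] --> q x ord0 i.
    by under eq_cvg do rewrite mxE; exact: dc.
  apply: cvgB; last by apply: cvgM; [exact: cvg_cst | rewrite expr2; apply: cvgM].
  apply: cvgD; first by rewrite expr2; apply: cvgM; exact: cvg_dir.
  apply: cvgM; first exact: cvg_cst.
  apply: cvg_sum => i; apply: cvg_sum => j.
  by apply: cvgM => //; apply: cvgM => //; exact: cvg_cst.
- by apply: box_integrableD; apply: box_integrableZ.
- apply: filterS phiP => x h xr n; have {h}[_ _ /(_ n) gG] := h xr.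
  have := dir_sqr_le (Du x) (grad (phi n) x).
  have /andP[] := Hess_bounds (Du x) (grad (phi n) x).
  rewrite /J /stab_form; set D2 := dir _ _ ^+ 2; set Q := F _ * _ => Q0 QK DK.
  have D0 : 0 <= D2 by exact: sqr_ge0.
  have e0 : 0 <= expR (u x) by exact: expR_ge0.
  have pM : phi n x ^+ 2 <= M ^+ 2.
    rewrite -(real_normK (num_real (phi n x))) lerXn2r ?nnegrE//.
    exact: le_trans (normr_ge0 _) (phiM n x).
  have g0 := dotp_ge0 (grad (phi n) x).
  have p0 := sqr_ge0 (phi n x).
  have b0 : 0 <= N%:R * b ^+ 2 by rewrite mulr_ge0// sqr_ge0.
  have A1 : D2 <= N%:R * b ^+ 2 * G x by apply: (le_trans DK); rewrite ler_wpM2l.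
  have A2 : Q <= K * G x by apply: (le_trans QK); rewrite ler_wpM2l.
  have A3 : expR (u x) * phi n x ^+ 2 <= M ^+ 2 * expR (u x).
    by rewrite mulrC ler_wpM2r.
  have A4 : 0 <= expR (u x) * phi n x ^+ 2 by rewrite mulr_ge0.
  by rewrite ler_norml /C mulrDl; apply/andP; split; lra.
split => //; rewrite -(cvg_lim _ cJ)//; apply: limr_ge.
  by apply/cvg_ex; eexists; exact: cJ.
near=> n.
have phic : classCc 1 setT (phi n).
  by split; [exact: phik | exact: (vanish_compact_support (phiv n))].
have := st _ phic; rewrite (@vanish_Rintegral _ _ r) => [|x xr].
  by under eq_Rintegral do rewrite stability_integrandE.
have dphi0 i : partial i (phi n) x = 0 by exact: vanish_partial xr.
rewrite stability_integrandE /stab_form /dir /quad phiv// expr0n mulr0 subr0.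
rewrite !big1 ?expr0n ?mulr0 ?addr0// => i _; last by rewrite mxE dphi0 mulr0.
by rewrite big1// => j _; rewrite mxE dphi0 mulr0 mul0r.
Unshelve. all: by end_near. Qed.

(** The flux grows linearly in [Du], so the product with the gradient of the test
    function is dominated by [|Du|^2 + G]. *)
Lemma equation_limit : weak_solution F expR setT u Du ->
  mu.-integrable (box r) (EFin \o (fun x => flux_form (Du x) (q x) (expR (u x)) (t x))) /\
  \int[mu]_(x in box r) flux_form (Du x) (q x) (expR (u x)) (t x) = 0.
Proof.
move=> [_ _ eqn].
have [phi [G [M [phik phiv phiM iG phiP]]]] :=
  test_function_approx uH1 P_smooth P0_le P1_le chi_smooth chi_vanish.
pose J n x := flux_form (Du x) (grad (phi n) x) (expR (u x)) (phi n x).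
pose A n x := F (Du x) * dir (Du x) (grad (phi n) x).
pose E n x := expR (u x) * phi n x.
pose U x := b ^+ 2 * dotp (Du x) (Du x) + N%:R * b ^+ 2 * G x.
have mphi n : measurable_fun setT (phi n).
  by apply: continuous_measurable_rV => x; exact: (classC_cts (phik n 0)).
have mA n : measurable_fun setT (A n).
  apply: measurable_funM; first exact: (measurableT_comp mF mDu).
  by apply: mdir => i; exact: mgrad.
have mE n : measurable_fun setT (E n) by exact: measurable_funM.
have mJ n : measurable_fun setT (J n).
  by apply: measurable_flux_form => // i; exact: mgrad.
have iDu i : mu.-integrable (box r) (EFin \o (fun x => Du x ord0 i * Du x ord0 i)).
  have [_ LDu _] := uH1; have [_ /(_ (box r) (@compact_box _ _ r))] := LDu i.
  by apply => //.
have iU : mu.-integrable (box r) (EFin \o U).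
  apply: box_integrableD; apply: box_integrableZ => //.
  exact: box_integrable_sum.
have EM n x : `|E n x| <= M * expR (u x).
  by rewrite normrM mulrC (ger0_norm (expR_ge0 _)) ler_wpM2r// expR_ge0.
have AU n x : dotp (grad (phi n) x) (grad (phi n) x) <= G x -> `|A n x| <= U x.
  move=> gG; have := dir_sqr_le (Du x) (grad (phi n) x).
  rewrite /A /U; set d := dir _ _ => dK.
  have b0 : 0 <= N%:R * b ^+ 2 by rewrite mulr_ge0// sqr_ge0.
  have A1 : d ^+ 2 <= N%:R * b ^+ 2 * G x by apply: (le_trans dK); rewrite ler_wpM2l.
  have A2 : F (Du x) ^+ 2 <= b ^+ 2 * dotp (Du x) (Du x).
    rewrite -(sqr_sqrtr (dotp_ge0 (Du x))) -exprMn lerXn2r ?nnegrE//.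
    exact: le_trans (F_ge0 _) (F_le _).
  have := sqr_ge0 (F (Du x) - d); have := sqr_ge0 (F (Du x) + d).
  by rewrite ler_norml => ? ?; apply/andP; split; nra.
have [|||iJ0 iJ cJ] := @dominated_Rintegral _ _ (box r) J
    (fun x => flux_form (Du x) (q x) (expR (u x)) (t x))
    (fun x => U x + M * expR (u x)) (measurable_box r) mJ
    (measurable_flux_form mq mt).
- apply: filterS phiP => x h xr; have {h}[pc dc _] := h xr.
  have gc i : grad (phi n) x ord0 i @[n --> \oo] --> q x ord0 i.
    by under eq_cvg do rewrite mxE; exact: dc.
  apply: cvgB; last by apply: cvgM; [exact: cvg_cst | exact: pc].
  by apply: cvgM; [exact: cvg_cst | exact: cvg_dir].
- by apply: box_integrableD => //; apply: box_integrableZ.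
- apply: filterS phiP => x h xr n; have {h}[_ _ /(_ n) gG] := h xr.
  rewrite /J /flux_form (le_trans (ler_normB _ _))// lerD//; first exact: AU.
  exact: EM.
split => //; rewrite -(cvg_lim _ cJ)//.
have iE n : mu.-integrable (box r) (EFin \o E n).
  by apply: (le_box_integrable (mE n) _ (EM n)); exact: box_integrableZ.
have iA n : mu.-integrable (box r) (EFin \o A n).
  have := box_integrableD (iJ n) (iE n).
  by under eq_fun do rewrite /J /flux_form subrK.
rewrite (_ : (fun n => _) = (fun=> 0)); first exact: lim_cst.
apply/funext => n; rewrite (RintegralB (measurable_box r) (iA n) (iE n)).
have phic : classCcoo setT (phi n).
  by split; [exact: phik | exact: (vanish_compact_support (phiv n))].
have := eqn _ phic; rewrite (@vanish_Rintegral _ _ r) => [|x xr]; last first.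
  rewrite (_ : grad (phi n) x = 0) ?/dotp ?big1 ?mulr0// => [i _|].
    by rewrite [X in _ * X]mxE mulr0.
  by apply/rowP => i; rewrite !mxE; exact: vanish_partial xr.
rewrite [X in _ = X -> _](@vanish_Rintegral _ _ r) => [|x xr]; last by rewrite phiv ?mulr0.
move=> AE; apply/eqP; rewrite subr_eq0; apply/eqP.
rewrite -[RHS]AE; apply: eq_Rintegral => x _; congr (_ * _).
by apply: eq_bigr => i _; rewrite [grad F _ _ _]mxE.
Qed.

End limit_inequalities.

(** * The energy estimate *)

Section algebra.
Context {R : realType}.
Implicit Types (s m A D tau sg : R).

(** The inequality behind the estimate: the coefficient of [Y ^ 2] on the left is
    [81/25 (1 - 19/18) = - 9/50], that of [Y E] is [17/10 - 9/5 s], and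
    completing the square leaves at most [7 E ^ 2]. *)
Lemma quadratic_young s Y E : 0 < s -> s < 1 ->
  (9 / 5 * Y + (1 - s) * E) ^+ 2 - 171 / 50 * Y ^+ 2
    - 2 * (19 / 20 - 9 / 10 * s) * Y * E <= 7 * E ^+ 2.
Proof.
move=> s0 s1; pose c := 17 / 10 - 9 / 5 * s.
have c2 : c ^+ 2 <= 3 by rewrite /c; nra.
have := ler_wpM2r (sqr_ge0 E) c2; have := sqr_ge0 E.
have := sqr_ge0 (Y - 25 / 9 * c * E); rewrite /c; nra.
Qed.

(** With [m = g(u) = s^9] one has [g'(u) = 9/5 m (1 - s)],
    [h'(u) = 81/25 m^2 (1 - s)^2] and [h(u) = 81/5 (m^2 / 18 - m^2 s / 19)].
    The letters [A] and [D] stand for [F(Du) psi] and for the directional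
    derivative of [F] in the direction [grad psi]. *)
Lemma profile_young s m A D : 0 < s -> s < 1 ->
  (9 / 5 * m * (1 - s) * A + m * D) ^+ 2 -
    19 / 18 * (81 / 25 * m ^+ 2 * (1 - s) ^+ 2 * A ^+ 2 +
      2 * (81 / 5 * (m ^+ 2 / 18 - m ^+ 2 * s / 19)) * A * D) <=
  7 * (m ^+ 2 / (1 - s) ^+ 2 * D ^+ 2).
Proof.
move=> s0 s1; have sg0 : 1 - s != 0 by rewrite subr_eq0 gt_eqF.
have := quadratic_young ((1 - s) * m * A) (m * D / (1 - s)) s0 s1.
apply: etrans; congr (_ <= _); first by field.
by field.
Qed.

(** Young's inequality with exponents [23/18] and [23/5] would absorb [tau ^ 18];
    the powers of [sg <= 1], which come from the bounded profile, are harmless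
    because [(tau^5 sg^2)^4] has more powers of [tau] and fewer of [sg] than
    [tau^18 sg^16]. *)
Lemma absorption (C : R) : 1 <= C -> exists2 C' : R, 0 <= C' &
  forall tau sg, 0 <= tau -> 0 <= sg -> sg <= 1 ->
    C * (tau ^+ 18 * sg ^+ 16) <= 1 / 40 * (tau ^+ 23 * sg ^+ 18) + C'.
Proof.
move=> C1; have C0 : 0 < C by lra.
pose d := 40 * C; have d1 : 1 <= d by rewrite /d; lra.
exists (C * d ^+ 4) => [|tau sg t0 s0 s1]; first by rewrite mulr_ge0 ?exprn_ge0; lra.
(* Where [tau^5 sg^2 >= 40 C] the left-hand side is absorbed; elsewhere it is
   bounded. *)
have [big|small] := leP d (tau ^+ 5 * sg ^+ 2).
  have : 0 <= tau ^+ 18 * sg ^+ 16 by rewrite mulr_ge0 ?exprn_ge0.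
  set q := tau ^+ 18 * sg ^+ 16 => q0.
  have -> : tau ^+ 23 * sg ^+ 18 = q * (tau ^+ 5 * sg ^+ 2) by rewrite /q; ring.
  have := ler_wpM2l q0 big; have : 0 <= C * d ^+ 4 by rewrite mulr_ge0 ?exprn_ge0; lra.
  rewrite /d; lra.
have X : tau ^+ 18 * sg ^+ 16 <= d ^+ 4.
  have [t1|t1] := leP tau 1.
    apply: (@le_trans _ _ 1); last exact: exprn_ege1.
    by rewrite -[leRHS]mulr1 ler_pM ?exprn_ge0// exprn_ile1.
  apply: (@le_trans _ _ ((tau ^+ 5 * sg ^+ 2) ^+ 4)).
    rewrite exprMn -!exprM ler_pM ?exprn_ge0//.
      by rewrite ler_weXn2l// ltW.
    by rewrite ler_wiXn2l.
  by rewrite lerXn2r ?nnegrE ?mulr_ge0 ?exprn_ge0// ltW//; lra.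
have : 0 <= tau ^+ 23 * sg ^+ 18 by rewrite mulr_ge0 ?exprn_ge0.
by have := ler_wpM2l (ltW C0) X; lra.
Qed.

End algebra.

Section profiles.
Context {R : realType}.

(** [w / (1 + w)] with [w = e^(t/5)]. *)
Definition profile (t : R) : R := logistic (1 / 5) t.

(** The derivatives of all orders of [g = s^9]. *)
Definition test_stab (j : nat) (t : R) : R :=
  (iter j (logistic_step (1 / 5)) 'X^9).[profile t].

(** The derivatives of all orders of [h = 81/5 (s^18 / 18 - s^19 / 19)], the
    primitive of [g'^2] that vanishes with [s]: as [s' = s (1 - s) / 5],
    [dh/ds = 5 g'^2 / (s (1 - s)) = 81/5 s^17 (1 - s)]. *)
Definition test_flux (j : nat) (t : R) : R :=
  (iter j (logistic_step (1 / 5))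
    ((81 / 5) *: (18^-1 *: 'X^18 - 19^-1 *: 'X^19))).[profile t].

Lemma test_stab0 t : test_stab 0 t = profile t ^+ 9.
Proof. by rewrite /test_stab /= hornerXn. Qed.

Lemma test_stab1 t : test_stab 1 t = 9 / 5 * profile t ^+ 9 * (1 - profile t).
Proof.
rewrite /test_stab /= /logistic_step derivXn !(hornerZ, hornerM, hornerX, hornerD,
  hornerN, hornerC, hornerMn, hornerXn) /=.
by set s := profile t; ring.
Qed.

Lemma test_flux0 t : test_flux 0 t =
  81 / 5 * ((profile t ^+ 9) ^+ 2 / 18 - (profile t ^+ 9) ^+ 2 * profile t / 19).
Proof.
rewrite /test_flux /= !(hornerZ, hornerD, hornerN, hornerXn).
by set s := profile t; ring.
Qed.

Lemma test_flux1 t : test_flux 1 t =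
  81 / 25 * (profile t ^+ 9) ^+ 2 * (1 - profile t) ^+ 2.
Proof.
rewrite /test_flux /= /logistic_step derivZ derivB !derivZ !derivXn.
rewrite hornerZ hornerM [_.[_] * _]mulrC hornerZ hornerD hornerN !hornerZ !hornerMn.
rewrite !hornerXn hornerM hornerD hornerN hornerX hornerC /=.
by set s := profile t; field.
Qed.

Lemma expR_profile t : expR t = (profile t / (1 - profile t)) ^+ 5.
Proof.
have -> : profile t / (1 - profile t) = expR (t / 5).
  have e0 := expR_gt0 (t / 5); rewrite /profile /logistic.
  rewrite (_ : 1 / 5 * t = t / 5); last by rewrite mul1r mulrC.
  rewrite expRN; set e := expR _ in e0 *; field.
  by rewrite !gt_eqF//; lra.
by rewrite -expRM_natr; congr expR; field.
Qed.

Lemma test_stab0_le t : `|test_stab 0 t| <= 4.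
Proof.
rewrite test_stab0; have := logistic_gt0 (1 / 5) t; have := logistic_lt1 (1 / 5) t.
rewrite -/(profile t); set s := profile t => s1 s0.
have m1 : s ^+ 9 <= 1 by rewrite exprn_ile1// ltW.
have m0 : 0 <= s ^+ 9 by rewrite exprn_ge0// ltW.
by rewrite ger0_norm//; lra.
Qed.

Lemma test_stab1_le t : `|test_stab 1 t| <= 4.
Proof.
rewrite test_stab1; have := logistic_gt0 (1 / 5) t; have := logistic_lt1 (1 / 5) t.
rewrite -/(profile t); set s := profile t => s1 s0.
have m1 : s ^+ 9 <= 1 by rewrite exprn_ile1// ltW.
have m0 : 0 <= s ^+ 9 by rewrite exprn_ge0// ltW.
move: (s ^+ 9) m0 m1 => m m0 m1.
have p0 : 0 <= m * (1 - s) by rewrite mulr_ge0//; lra.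
have p1 : m * (1 - s) <= 1 by rewrite -[leRHS]mulr1 ler_pM//; lra.
by rewrite -mulrA ger0_norm; lra.
Qed.

Lemma test_flux0_le t : `|test_flux 0 t| <= 4.
Proof.
rewrite test_flux0; have := logistic_gt0 (1 / 5) t; have := logistic_lt1 (1 / 5) t.
rewrite -/(profile t); set s := profile t => s1 s0.
have m1 : (s ^+ 9) ^+ 2 <= 1 by rewrite -exprM exprn_ile1// ltW.
have m0 : 0 <= (s ^+ 9) ^+ 2 by exact: sqr_ge0.
move: ((s ^+ 9) ^+ 2) m0 m1 => m m0 m1.
have p0 : 0 <= m * s by rewrite mulr_ge0//; lra.
have p1 : m * s <= 1 by rewrite -[leRHS]mulr1 ler_pM//; lra.
by rewrite ler_norml; apply/andP; split; lra.
Qed.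

Lemma test_flux1_le t : `|test_flux 1 t| <= 4.
Proof.
rewrite test_flux1; have := logistic_gt0 (1 / 5) t; have := logistic_lt1 (1 / 5) t.
rewrite -/(profile t); set s := profile t => s1 s0.
have m1 : (s ^+ 9) ^+ 2 <= 1 by rewrite -exprM exprn_ile1// ltW.
have m0 : 0 <= (s ^+ 9) ^+ 2 by exact: sqr_ge0.
have q1 : (1 - s) ^+ 2 <= 1 by rewrite exprn_ile1//; lra.
have q0 := sqr_ge0 (1 - s).
move: ((s ^+ 9) ^+ 2) ((1 - s) ^+ 2) m0 m1 q0 q1 => m q m0 m1 q0 q1.
have p0 : 0 <= m * q by rewrite mulr_ge0.
have p1 : m * q <= 1 by rewrite -[leRHS]mulr1 ler_pM.
by rewrite -mulrA ger0_norm; lra.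
Qed.

End profiles.

Section energy.
Context {R : realType} {N : nat}.
Local Notation V := 'rV[R]_N.
Variables (F : V -> R) (b K : R).
Hypothesis K_ge0 : 0 <= K.
Hypothesis dF_le : forall (xi : V) i, `|partial i F xi| <= b.
Hypothesis euler : forall xi : V, \sum_(i < N) xi ord0 i * partial i F xi = F xi.
Hypothesis quad_shift : forall (xi : V) (c : R) (w : V),
  F xi * quad (fun i j => partial j (partial i F) xi) (c *: xi + w) =
  F xi * quad (fun i j => partial j (partial i F) xi) w.
Hypothesis Hess_bounds : forall xi w : V,
  0 <= F xi * quad (fun i j => partial j (partial i F) xi) w <= K * dotp w w.

(** The pointwise inequality in which the gradient [xi] has disappeared. The
    cut-off [psi = eta^23] has gradient [23 eta^22 y], where [y] is the gradient
    of [eta] and [|y|^2 <= T]. After profile_young the remaining terms are at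
    most a constant times [m^2 / (1 - s)^2 eta^44 T], whereas
    [e (m^2 - 19/18 h) = e m^2 (1/20 + 9/10 s)]. In terms of [w = s / (1 - s)] the
    two weights are [w^18 (1 - s)^16] and [w^23 (1 - s)^18], and absorption applies
    to [tau = w rr^2 eta^2]: since [T] is of order [rr^-10], the total is
    [rr^-46] times a combination of [tau^18] and [tau^23]. *)
Lemma energy_density_le (xi y : V) (s m e eta C C' rr T : R) :
  0 < s -> s < 1 -> m = s ^+ 9 -> e = (s / (1 - s)) ^+ 5 -> 
  0 <= eta -> eta <= 1 -> 1 <= rr ->
  T * rr ^+ 10 * (23 ^+ 2 * (7 * (N%:R * b ^+ 2) + K)) <= C -> dotp y y <= T ->
  (forall tau sg, 0 <= tau -> 0 <= sg -> sg <= 1 ->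
    C * (tau ^+ 18 * sg ^+ 16) <= 1 / 40 * (tau ^+ 23 * sg ^+ 18) + C') ->
  stab_form F xi ((9 / 5 * m * (1 - s) * eta ^+ 23) *: xi + (m * (23 * eta ^+ 22)) *: y) e
      (m * eta ^+ 23) -
  19 / 18 * flux_form F xi ((81 / 25 * m ^+ 2 * (1 - s) ^+ 2 * eta ^+ 46) *: xi +
      (81 / 5 * (m ^+ 2 / 18 - m ^+ 2 * s / 19) * (46 * eta ^+ 45)) *: y) e
      (81 / 5 * (m ^+ 2 / 18 - m ^+ 2 * s / 19) * eta ^+ 46) <=
  - (1 / 40) * (e * m ^+ 2 * eta ^+ 46) + C' / rr ^+ 46.
Proof.
move=> s0 s1 mE eE eta0 eta1 rr1 TC yT absorb.
pose d := \sum_(i < N) partial i F xi * y ord0 i.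
have sg0 : 0 < 1 - s by lra.
have dirE (c k : R) : \sum_(i < N) partial i F xi * (c *: xi + k *: y) ord0 i =
    c * F xi + k * d.
  rewrite -euler !mulr_sumr -big_split; apply: eq_bigr => i _ /=.
  by rewrite !mxE mulrDr; congr (_ + _); rewrite mulrCA// [xi _ _ * _]mulrC.
rewrite /stab_form /flux_form !dirE quad_shift.
have Qle (k : R) : F xi * quad (fun i j => partial j (partial i F) xi) (k *: y) <=
    K * (k ^+ 2 * T).
  have /andP[_ /le_trans] := Hess_bounds xi (k *: y); apply; rewrite ler_wpM2l//.
  rewrite (_ : dotp _ _ = k ^+ 2 * dotp y y); last first.
    by rewrite mulr_sumr; apply: eq_bigr => i _; rewrite !mxE; ring.
  by rewrite ler_wpM2l ?sqr_ge0.
have dle : d ^+ 2 <= N%:R * b ^+ 2 * T.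
  apply: (le_trans (sqr_pairing_le _ (dF_le xi))).
  by rewrite ler_wpM2l// mulr_ge0// sqr_ge0.
have := Qle (m * (23 * eta ^+ 22)); set Q := F xi * _ => {}Qle.
clearbody Q d; move: (F xi) => Fx.
have := profile_young m (Fx * eta) (23 * d) s0 s1.
set PY := (X in X <= _) => young.
have e0 : 0 <= e by rewrite eE exprn_ge0// divr_ge0 ?ltW.
have m20 := sqr_ge0 m.
pose w := s / (1 - s); have w0 : 0 <= w by rewrite divr_ge0 ?ltW.
have sn0 : 1 - s != 0 by rewrite gt_eqF.
have E1 : m ^+ 2 / (1 - s) ^+ 2 = w ^+ 18 * (1 - s) ^+ 16.
  by rewrite mE /w; field.
have E2 : e * m ^+ 2 = w ^+ 23 * (1 - s) ^+ 18.
  by rewrite mE eE /w; field.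
have T0 : 0 <= T by exact: le_trans (dotp_ge0 y) yT.
have r0 : 0 < rr by lra.
have rn0 : rr != 0 by rewrite gt_eqF.
have c0 : 0 <= N%:R * b ^+ 2 by rewrite mulr_ge0// sqr_ge0.
set L := (X in X <= _).
have LE : L = (eta ^+ 22) ^+ 2 * PY + Q - e * eta ^+ 46 * m ^+ 2 * (1 / 20 + 9 / 10 * s).
  by rewrite /L /PY; field.
pose k : R := 23 ^+ 2; have k0 : 0 <= k by exact: sqr_ge0.
pose X := m ^+ 2 / (1 - s) ^+ 2.
have X0 : 0 <= X by rewrite divr_ge0 ?sqr_ge0.
pose a2 := (eta ^+ 22) ^+ 2; have a20 : 0 <= a2 by exact: sqr_ge0.
have h1 : a2 * PY <= a2 * (7 * (X * (k * (N%:R * b ^+ 2 * T)))).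
  apply: (ler_wpM2l a20); apply: (le_trans young).
  rewrite exprMn; apply: ler_wpM2l; first by [].
  by apply: (ler_wpM2l X0); apply: (ler_wpM2l k0).
have mm : m ^+ 2 <= X.
  rewrite /X ler_pdivlMr ?exprn_gt0//; apply: ler_piMr => //.
  by apply: exprn_ile1; lra.
have h2 : Q <= a2 * (X * (k * (K * T))).
  apply: (le_trans Qle).
  rewrite (_ : K * _ = a2 * (m ^+ 2 * (k * (K * T)))); last by rewrite /a2 /k; ring.
  apply: (ler_wpM2l a20); apply: ler_wpM2r => //.
  by apply: mulr_ge0 => //; exact: mulr_ge0.
have h3 : e * eta ^+ 46 * m ^+ 2 * (1 / 20) <=
    e * eta ^+ 46 * m ^+ 2 * (1 / 20 + 9 / 10 * s).
  apply: ler_wpM2l; last by lra.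
  by apply: mulr_ge0 => //; apply: mulr_ge0 => //; exact: exprn_ge0.
have h4 : a2 * X * (k * (7 * (N%:R * b ^+ 2) + K) * T) <=
    C * (eta ^+ 36 * X) / rr ^+ 10.
  rewrite ler_pdivlMr ?exprn_gt0//.
  have he : a2 <= eta ^+ 36 by rewrite /a2 -exprM ler_wiXn2l.
  rewrite (_ : _ * rr ^+ 10 = (a2 * X) *
     (T * rr ^+ 10 * (k * (7 * (N%:R * b ^+ 2) + K)))); last by ring.
  rewrite [C * _]mulrC; apply: ler_pM => //.
  - exact: mulr_ge0.
  - apply: mulr_ge0; first by apply: mulr_ge0 => //; apply: exprn_ge0; exact: ltW.
    by apply: mulr_ge0 => //; apply: addr_ge0 => //; exact: mulr_ge0.
  - exact: ler_wpM2r.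
have := absorb (w * rr ^+ 2 * eta ^+ 2) (1 - s).
have t0 : 0 <= w * rr ^+ 2 * eta ^+ 2 by apply: mulr_ge0; [apply: mulr_ge0 => //; exact: sqr_ge0 | exact: sqr_ge0].
have s1' : 1 - s <= 1 by lra.
move=> /(_ t0 (ltW sg0) s1').
have r46 : 0 <= (rr ^+ 46)^-1 by rewrite invr_ge0; exact: (exprn_ge0 46 (ltW r0)).
move=> /(ler_wpM2r r46).
rewrite mulrDl.
rewrite (_ : C * _ * _ = C * (eta ^+ 36 * X) / rr ^+ 10); last first.
  by rewrite /X E1; field.
rewrite (_ : 1 / 40 * _ * _ = 1 / 40 * (e * m ^+ 2 * eta ^+ 46)); last first.
  by rewrite E2; field.
rewrite LE -/a2 => hA.
have hk : a2 * (7 * (X * (k * (N%:R * b ^+ 2 * T)))) + a2 * (X * (k * (K * T))) =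
    a2 * X * (k * (7 * (N%:R * b ^+ 2) + K) * T) by ring.
have hz : e * eta ^+ 46 * m ^+ 2 * (1 / 20) = 1 / 20 * (e * m ^+ 2 * eta ^+ 46) by ring.
move: h3; rewrite hz => h3.
move: (e * eta ^+ 46 * m ^+ 2 * _) h3 => Z h3.
move: (e * m ^+ 2 * eta ^+ 46) hA h3 => Y hA h3.
move: (a2 * PY) (a2 * (7 * _)) (a2 * (X * _)) (a2 * X * _) h1 h2 hk h4
  => ? ? ? ? h1 h2 hk h4.
move: (C * _ / _) h4 hA => ? h4 hA; lra.
Qed.

End energy.

(** * Cut-off functions and conclusion *)

Section cutoff.
Context {R : realType} {N : nat}.
Local Notation V := 'rV[R]_N.

Lemma is_derive_exprS (n : nat) (t : R) :
  is_derive t 1 (fun s : R => s ^+ n.+1) (n.+1%:R * t ^+ n).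
Proof.
have := is_derive_poly ('X^(n.+1) : {poly R}) t.
rewrite derivXn /= hornerMn hornerXn mulr_natl.
by rewrite (_ : horner 'X^(n.+1) = (fun s : R => s ^+ n.+1))//; apply/funext => s; rewrite hornerXn.
Qed.

Lemma partial_exprS (eta : V -> R) n x i : classC 1 setT eta ->
  partial i (fun y => eta y ^+ n.+1) x = n.+1%:R * eta x ^+ n * partial i eta x.
Proof.
move=> e1; apply: partial_val.
exact: (is_derive_comp1 (is_derive_exprS n (eta x)) (classC_is_derive x i e1)).
Qed.

Lemma test_grad_exprS (u : V -> R) (Du : V -> V) (P : nat -> R -> R) (eta : V -> R) n x :
  classC 1 setT eta ->
  test_grad u Du P (fun y => eta y ^+ n.+1) x =
  (P 1 (u x) * eta x ^+ n.+1) *: Du x + (P 0 (u x) * (n.+1%:R * eta x ^+ n)) *: grad eta x.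
Proof.
by move=> e1; apply/rowP => i; rewrite !mxE partial_exprS// !mulrA.
Qed.

Lemma cutoff : exists2 T : R, 0 <= T & forall r : R, 0 < r -> exists eta : V -> R,
  [/\ forall k, classC k setT eta, vanish_off r eta,
      forall x, 0 <= eta x /\ eta x <= 1,
      forall x, dotp (grad eta x) (grad eta x) <= T / r ^+ 2 &
      N%:R * 2 <= r ^+ 2 -> forall x, box 1 x -> flat 1 (2^-1) <= eta x].
Proof.
have bk k : classC k setT (radial_bump : V -> R) by exact: radial_bump_classC.
have bd i : continuous (partial i (radial_bump : V -> R)).
  have d0 : classC 0 setT (partial i (radial_bump : V -> R)) by exact: ((bk 1).2 i).2.
  by move=> x; exact: (classC_cts d0).
have /choice[M MP] : forall i : 'I_N, exists M : R, forall x : V, `|partial i radial_bump x| <= M.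
  by move=> i; have [M _ MP] := vanish_bounded (bd i) (vanish_partial i radial_bump_vanish); exists M.
exists (\sum_i M i ^+ 2) => [|r r0]; first by rewrite sumr_ge0// => i _; exact: sqr_ge0.
have rn0 : r != 0 by rewrite gt_eqF.
exists (fun x => radial_bump (r^-1 *: x + 0)); split.
- by move=> k; exact: classC_affine.
- move=> x rx; apply: radial_bump_vanish; rewrite addr0 normrZ gtr0_norm ?invr_gt0//.
  by rewrite mulrC ltr_pdivlMr// mul1r.
- by move=> x; split; [exact: radial_bump_ge0 | exact: radial_bump_le1].
- move=> x; rewrite /dotp mulr_suml; apply: ler_sum => i _.
  rewrite mxE (_ : partial i _ x = r^-1 * partial i radial_bump (r^-1 *: x + 0)); last first.
    by apply: partial_val; apply: is_derive_affine; exact: (classC_is_derive _ _ (bk 1)).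
  rewrite mulrACA -expr2 exprVn mulrC ler_wpM2r ?invr_ge0 ?sqr_ge0//.
  rewrite -expr2 -(real_normK (num_real (partial _ _ _))) lerXn2r ?nnegrE//.
  exact: le_trans (normr_ge0 _) (MP i x).
- move=> Nr x x1; rewrite (_ : 2^-1 = 1 - 2^-1 :> R); last by lra.
  apply: radial_bump_lb; first by lra.
  rewrite addr0; apply: (le_trans (dotp_sqr_le _)).
  rewrite normrZ gtr0_norm ?invr_gt0// exprMn exprVn mulrA.
  apply: (@le_trans _ _ (N%:R / r ^+ 2)).
    rewrite -[leRHS]mulr1 ler_wpM2l ?divr_ge0 ?sqr_ge0//.
    by rewrite exprn_ile1.
  by rewrite ler_pdivrMr ?exprn_gt0//; lra.
Qed.

End cutoff.

Section energy_decay.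
Context {R : realType} {N : nat}.
Local Notation V := 'rV[R]_N.
Local Notation mu := (@lebesgue_rV R N).
Variables (F : V -> R) (b K : R).
Hypothesis K_ge0 : 0 <= K.
Hypothesis F_ge0 : forall xi : V, 0 <= F xi.
Hypothesis F_le : forall xi : V, F xi <= b * enorm xi.
Hypothesis dF_le : forall (xi : V) i, `|partial i F xi| <= b.
Hypothesis euler : forall xi : V, \sum_(i < N) xi ord0 i * partial i F xi = F xi.
Hypothesis quad_shift : forall (xi : V) (c : R) (w : V),
  F xi * quad (fun i j => partial j (partial i F) xi) (c *: xi + w) =
  F xi * quad (fun i j => partial j (partial i F) xi) w.
Hypothesis Hess_bounds : forall xi w : V,
  0 <= F xi * quad (fun i j => partial j (partial i F) xi) w <= K * dotp w w.
Hypothesis mF : measurable_fun setT F.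
Hypothesis mdF : forall i, measurable_fun setT (partial i F).
Hypothesis mHF : forall i j, measurable_fun setT (partial j (partial i F)).
Variables (u : V -> R) (Du : V -> V).
Hypothesis u_sol : weak_solution F expR setT u Du.
Hypothesis u_stable : stable F expR setT u Du.

Definition energy_density (x : V) : R := expR (u x) * (profile (u x) ^+ 9) ^+ 2.

Let uH1 : H1loc setT u Du. Proof. by case: u_sol. Qed.
Let expu : L1loc setT (fun x => expR (u x)). Proof. by case: u_sol. Qed.

Lemma profile_itv (t : R) : 0 < profile t < 1.
Proof. by rewrite /profile logistic_gt0 logistic_lt1. Qed.

Lemma energy_density_gt0 x : 0 < energy_density x.
Proof.
by rewrite mulr_gt0 ?expR_gt0 ?exprn_gt0//; case/andP: (profile_itv (u x)).
Qed.

Let mprofile : measurable_fun setT (fun x => profile (u x)).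
Proof.
have mu_ : measurable_fun setT u by have [[]] := uH1.
apply: (measurableT_comp _ mu_); apply: continuous_measurable_fun.
rewrite (_ : profile = (fun t => ('X : {poly R}).[logistic (1 / 5) t])); last first.
  by apply/funext => t; rewrite hornerX.
exact: (@smooth_family_cts R _ 0 (smooth_logistic (1 / 5) 'X)).
Qed.

Lemma energy_density_le_expR x : energy_density x <= expR (u x).
Proof.
rewrite -[leRHS]mulr1 ler_wpM2l ?expR_ge0// -exprM exprn_ile1//.
- by case/andP: (profile_itv (u x)) => /ltW.
- by case/andP: (profile_itv (u x)) => _ /ltW.
Qed.

Lemma measurable_energy_density : measurable_fun setT energy_density.
Proof.
by apply: measurable_funM; [case: expu | do 2 apply: measurable_funX].
Qed.

Lemma integrable_energy_density (r : R) : mu.-integrable (box r) (EFin \o energy_density).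
Proof.
apply: (@le_box_integrable _ _ _ _ (fun x => expR (u x)) measurable_energy_density).
  by apply: expu.2 => //; exact: compact_box.
move=> x; rewrite ger0_norm ?energy_density_le_expR//.
exact/ltW/energy_density_gt0.
Qed.

Lemma test_stab_smooth : smooth_family (@test_stab R).
Proof. exact: smooth_logistic. Qed.

Lemma test_flux_smooth : smooth_family (@test_flux R).
Proof. exact: smooth_logistic. Qed.

(** The cut-off lives at scale [r = rr^5], which makes the exponents integers:
    the error [C' rr^-46] is integrated over a cube of volume
    [(2 rr^5)^N <= 2^N rr^45]. *)
Lemma energy_decay : (N < 10)%N -> exists2 C : R, 0 <= C & forall rr : R,
  1 <= rr -> N%:R * 2 <= (rr ^+ 5) ^+ 2 ->
  \int[mu]_(x in box 1) energy_density x <= C / rr.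
Proof.
move=> N10; have [T T0 cut] := @cutoff R N.
pose C := T * (23 ^+ 2 * (7 * (N%:R * b ^+ 2) + K)) + 1.
have C1 : 1 <= C.
  rewrite lerDr; apply: mulr_ge0 => //; apply: mulr_ge0; first exact: sqr_ge0.
  by rewrite addr_ge0// mulr_ge0// mulr_ge0// sqr_ge0.
have [C' C'0 absorb] := absorption C1.
pose c0 : R := flat 1 (2^-1) ^+ 46.
have c00 : 0 < c0 by rewrite exprn_gt0// flat1_gt0// invr_gt0.
exists (c0^-1 * (40 * (C' * 2 ^+ N))) => [|rr rr1 Nrr].
  apply: mulr_ge0; first by rewrite invr_ge0 ltW.
  by apply: mulr_ge0 => //; apply: mulr_ge0 => //; exact: exprn_ge0.
have r0 : 0 < rr by lra.
have rn0 : rr != 0 by rewrite gt_eqF.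
pose r := rr ^+ 5; have rgt0 : 0 < r by rewrite exprn_gt0.
have r1 : 1 <= r by exact: exprn_ege1.
have [eta [etak eta_v eta01 deta eta_lb]] := cut r rgt0.
have eta1 := etak 1.
have chik n k : classC k setT (fun x => eta x ^+ n.+1) by exact: classCX.
have chiv n : vanish_off r (fun x => eta x ^+ n.+1).
  by move=> x xr; rewrite eta_v// expr0n.
have [iS S0] := stability_limit K_ge0 dF_le Hess_bounds mF mdF mHF uH1 expu
  test_stab_smooth (@test_stab0_le R) (@test_stab1_le R) (chik 22%N) (chiv 22%N) u_stable.
have [iE E0] := equation_limit F_ge0 F_le dF_le mF mdF uH1 expu
  test_flux_smooth (@test_flux0_le R) (@test_flux1_le R) (chik 45%N) (chiv 45%N) u_sol.
move: S0 E0 iS iE.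
set S := (fun x => stab_form _ _ _ _ _); set E := (fun x => flux_form _ _ _ _ _).
move=> S0 E0 iS iE.
pose Z x := energy_density x * eta x ^+ 46.
have SE x : S x - 19 / 18 * E x <= - (1 / 40) * Z x + C' / rr ^+ 46.
  rewrite /S /E /Z /energy_density !test_grad_exprS// test_stab0 test_stab1 test_flux0 test_flux1.
  have /andP[s0 s1] := profile_itv (u x); have [e0 e1] := eta01 x.
  have TC : T / r ^+ 2 * rr ^+ 10 * (23 ^+ 2 * (7 * (N%:R * b ^+ 2) + K)) <= C.
    by rewrite /C /r -exprM divfK ?expf_neq0// lerDl.
  exact: (energy_density_le K_ge0 dF_le euler quad_shift Hess_bounds (Du x) s0 s1
    erefl (expR_profile (u x)) e0 e1 rr1 TC (deta x) absorb).
have Z0 x : 0 <= Z x.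
  apply: mulr_ge0; first exact/ltW/energy_density_gt0.
  by apply: exprn_ge0; have [] := eta01 x.
have mZ : measurable_fun setT Z.
  apply: measurable_funM; first exact: measurable_energy_density.
  by apply: continuous_measurable_rV => x; exact: (classC_cts (chik 45%N 0%N)).
have iZ : mu.-integrable (box r) (EFin \o Z).
  apply: (le_box_integrable mZ (integrable_energy_density r)) => x.
  rewrite ger0_norm// ler_piMr//; first exact/ltW/energy_density_gt0.
  by have [e0 e1] := eta01 x; exact: exprn_ile1.
have mr := @measurable_box R N r.
have iE' : mu.-integrable (box r) (EFin \o (fun x => 19 / 18 * E x)).
  exact: box_integrableZ.
have : 0 <= \int[mu]_(x in box r) (- (1 / 40) * Z x + C' / rr ^+ 46).
  apply: (@le_trans _ _ (\int[mu]_(x in box r) (S x - 19 / 18 * E x))).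
    by rewrite (RintegralB mr iS iE') (RintegralZl _ mr iE) E0 mulr0 subr0.
  apply: (le_Rintegral mr) => [||x _]; last exact: SE.
  - have := box_integrableD iS (box_integrableZ (- (19 / 18)) iE).
    by under eq_fun do rewrite mulNr.
  - by apply: box_integrableD; [exact: box_integrableZ | exact: box_integrable_cst].
rewrite (RintegralD mr (box_integrableZ _ iZ) (box_integrable_cst _ _)).
rewrite (RintegralZl _ mr iZ) (Rintegral_cst _ mr).
rewrite (_ : fine _ = 2 ^+ N * r ^+ N); last first.
  transitivity (fine ((r *+ 2) ^+ N)%:E); last by rewrite /= -mulr_natl exprMn.
  by congr fine; exact/lebesgue_rV_box/ltW.
set IZ := (X in - (1 / 40) * X) => IZ0.
have IZle : IZ <= 40 * (C' * 2 ^+ N) / rr.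
  have rN : r ^+ N <= rr ^+ 45.
    by rewrite (_ : rr ^+ 45 = r ^+ 9) ?ler_weXn2l// /r -exprM.
  have : C' * 2 ^+ N * r ^+ N / rr ^+ 46 <= C' * 2 ^+ N / rr.
    rewrite (_ : _ / rr = C' * 2 ^+ N * rr ^+ 45 / rr ^+ 46); last by field.
    rewrite ler_wpM2r ?invr_ge0 ?exprn_ge0 ?(ltW r0)//.
    by apply: ler_wpM2l => //; apply: mulr_ge0 => //; exact: exprn_ge0.
  rewrite -[X in _ -> IZ <= X]mulrA.
  move: IZ0; rewrite (_ : C' / _ * _ = C' * 2 ^+ N * r ^+ N / rr ^+ 46); last by field.
  move: (C' * _ * _ / _) (C' * _ / _) => p q; lra.
rewrite -mulrA ler_pdivlMl//; apply: le_trans IZle.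
have sub : box 1 `<=` (box r : set V) by move=> x /le_trans; apply.
have i1 : mu.-integrable (box 1) (EFin \o Z).
  exact: (integrableS mr (@measurable_box R N 1) sub iZ).
apply: (@le_trans _ _ (\int[mu]_(x in box 1) Z x)).
  rewrite -(RintegralZl _ (@measurable_box R N 1) (integrable_energy_density 1)).
  apply: le_Rintegral => //; first exact: measurable_box.
    exact/box_integrableZ/integrable_energy_density.
  move=> x x1; rewrite mulrC; apply: ler_wpM2l; first exact/ltW/energy_density_gt0.
  by apply: lerXn2r; rewrite ?nnegrE ?flat1_ge0//; [have [] := eta01 x | exact: eta_lb].
apply: fine_le.
- exact: (integrable_fin_num (@measurable_box R N 1) i1).
- exact: (integrable_fin_num mr iZ).
- apply: ge0_subset_integral => //; first exact: measurable_box.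
    by apply/measurable_EFinP; exact: measurable_funTS.
  by move=> x _; rewrite lee_fin.
Qed.

Lemma no_stable_solution : (N < 10)%N -> False.
Proof.
move=> N10; have [C C0 CP] := energy_decay N10.
have m1 := @measurable_box R N 1.
have i1 := integrable_energy_density 1.
pose I := \int[mu]_(x in box 1) energy_density x.
have I0 : I <= 0.
  rewrite leNgt; apply/negP => I0; pose rr : R := 1 + N%:R * 2 + C / I.
  have CI : 0 <= C / I by rewrite divr_ge0// ltW.
  have N0 : 0 <= N%:R :> R by [].
  have rr1 : 1 <= rr by rewrite /rr; lra.
  have r0 : 0 < rr by lra.
  have Nr : N%:R * 2 <= (rr ^+ 5) ^+ 2.
    apply: (@le_trans _ _ rr); first by rewrite /rr; lra.
    by rewrite -exprM ler_eXnr.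
  have := CP rr rr1 Nr; rewrite -/I ler_pdivlMr// /rr leNgt => /negP; apply.
  have -> : I * (1 + N%:R * 2 + C / I) = I + I * (N%:R * 2) + C.
    by field; rewrite gt_eqF.
  by rewrite ltrDr ltr_wpDr// mulr_ge0 ?(ltW I0)// mulr_ge0.
have IE : (\int[mu]_(x in box 1) `|(energy_density x)%:E| = 0)%E.
  under eq_integral => x _ do rewrite gee0_abs ?lee_fin ?(ltW (energy_density_gt0 x))//.
  apply/eqP; rewrite eq_le integral_ge0 ?andbT; last first.
    by move=> x _; rewrite lee_fin ltW// energy_density_gt0.
  rewrite -(fineK (integrable_fin_num m1 i1)) lee_fin; exact: I0.
have mZ : measurable_fun (box 1) (EFin \o energy_density).
  by apply/measurable_EFinP; apply: measurable_funTS; exact: measurable_energy_density.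
have [A [mA A0 bA]] := (ae_eq_integral_abs mu m1 mZ).1 IE.
have b1 : box 1 `<=` A.
  by move=> x x1; apply: bA => /(_ x1) /= [] /eqP; rewrite gt_eqF// energy_density_gt0.
have : (mu (box 1) <= mu A)%E by apply: le_measure => //; rewrite inE.
rewrite [X in (_ <= X)%E]A0 [X in (X <= _)%E](_ : _ = ((1 *+ 2) ^+ N)%:E); last exact: lebesgue_rV_box.
by rewrite lee_fin leNgt exprn_gt0.
Qed.

End energy_decay.

Theorem theorem1p2 (R : realType) (N : nat) (F : 'rV[R]_N -> R)
    (F_ge0 : forall xi : 'rV[R]_N, 0 <= F xi)
    (F_convex : @convex_function R 'rV[R]_N setT F)
    (F_C2 : classC 2 [set xi : 'rV[R]_N | xi != 0] F)
    (F_homogeneous : forall (t : R) (xi : 'rV[R]_N), F (t *: xi) = `|t| * F xi)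
    (F_gt0 : forall xi : 'rV[R]_N, xi != 0 -> 0 < F xi)
    (a b : R) (a_gt0 : 0 < a) (a_le_b : a <= b)
    (F_bounds : forall xi : 'rV[R]_N, a * enorm xi <= F xi <= b * enorm xi)
    (lambda Lambda : R) (lambda_gt0 : 0 < lambda) (lambda_le : lambda <= Lambda)
    (F_elliptic : forall xi V : 'rV[R]_N, enorm xi = 1 -> dotp V xi = 0 ->
      lambda ^+ 2 * enorm V ^+ 2
        <= \sum_(i < N) \sum_(j < N)
             partial j (partial i F) xi * V ord0 i * V ord0 j
        <= Lambda * enorm V ^+ 2)
    (N_lt10 : (N < 10)%N) :
  ~ exists u : 'rV[R]_N -> R, stable_weak_solution F expR setT u.
Proof.
move=> [u [Du [u_sol u_stable]]].
have b_gt0 : 0 < b by exact: lt_le_trans a_gt0 a_le_b.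
have Lambda_gt0 : 0 < Lambda by exact: lt_le_trans lambda_gt0 lambda_le.
have F_le xi : F xi <= b * enorm xi by case/andP: (F_bounds xi).
apply: (@no_stable_solution R N F b (b * Lambda) _ F_ge0 F_le _ _ _ _ _ _ _
  u Du u_sol u_stable N_lt10).
- by rewrite mulr_ge0// ltW.
- exact: finsler_partial_le.
- exact: finsler_euler.
- exact: finsler_quad_shift.
- exact: (finsler_quad_bounds F_ge0 F_C2 F_homogeneous b_gt0 F_le Lambda_gt0 F_elliptic).
- exact: measurable_finsler.
- exact: measurable_finsler_partial.
- exact: measurable_finsler_hessian.
Qed.
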